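(* There exists an absolute positive constant $C$ such that the following holds. Let $\Omega$ be a hyperbolic domain in $\mathbb{C}$ and let $\Phi=\phi\,dz^2$ be a holomorphic quadratic differential defined on $\Omega$. Then for all $z\in\Omega$ $$R_z\le C\,\|\Phi\|^{\frac12}(z).$$ If in addition $\Omega$ is strongly hyperbolic, then there is a positive constant $C'$ depending only on $\Omega$ such that for all $z\in\Omega$ with $\Phi(z)\ne0$ $$R_z\ge C'\,\frac{\|\Phi\|^2(z)}{|||\Phi|||^{\frac32}}.$$
   Context: A domain $\Omega\subset\mathbb{C}$ is hyperbolic if its universal cover is conformal to the unit disk; its hyperbolic metric $\rho^2|dz|^2$ is the complete conformal metric of constant Gaussian curvature $-1$. A hyperbolic domain $\Omega$ is strongly hyperbolic if there is a constant $c>0$ with $\rho(z)\ge c/d(z,\partial\Omega)$ for all $z\in\Omega$, $d$ being Euclidean distance. For $\Phi=\phi\,dz^2$ on $\Omega$, $\|\Phi\|(z)=\rho^{-2}(z)|\phi(z)|$ and $|||\Phi|||=\sup_{z\in\Omega}\|\Phi\|(z)$. $R_z$ denotes the maximal $\Phi$-radius of $z$ with respect to $\Omega$: if $\phi(z_0)\ne0$, choose a branch of $\sqrt\phi$ near $z_0$ and let $f(z)=\int_{z_0}^z\sqrt{\phi(\zeta)}\,d\zeta$; let $B(R)=\{|w|<R\}$ be the maximal disk such that the local inverse $f^{-1}$ (with $f^{-1}(0)=z_0$) extends to a conformal diffeomorphism from $B(R)$ onto its image in $\Omega$; then $R_{z_0}=R$. By convention $R_{z_0}=0$ if $\phi(z_0)=0$.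 *)

(* Defs.v *)
From Stdlib Require Import Reals.
From Coquelicot Require Import Coquelicot.
Open Scope R_scope.

Definition disc (c : C) (r : R) (z : C) : Prop := Cmod (z - c)%C < r.

Definition unit_disc : C -> Prop := disc (RtoC 0) 1.

Definition image (f : C -> C) (U : C -> Prop) (w : C) : Prop :=
  exists z, U z /\ f z = w.

(** [ex_derive] is complex differentiability here: the scalars are [C_AbsRing]. *)
Definition holomorphic_on (U : C -> Prop) (f : C -> C) : Prop :=
  forall z, U z -> ex_derive (K := C_AbsRing) (V := C_NormedModule) f z.

(** For open [U], injectivity of [g] makes the image open (open mapping theorem),
    so asking [h] to be complex differentiable at its points is a genuine
    holomorphy requirement on the inverse. *)
Definition conformal_diffeo_into (U Omega : C -> Prop) (g : C -> C) : Prop :=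
  holomorphic_on U g /\
  (forall z, U z -> Omega (g z)) /\
  exists h : C -> C,
    holomorphic_on (image g U) h /\ (forall z, U z -> h (g z) = z).

Definition connected (A : C -> Prop) : Prop :=
  forall U V : C -> Prop, open U -> open V ->
    (forall z, A z -> U z \/ V z) ->
    (exists z, A z /\ U z) -> (exists z, A z /\ V z) ->
    exists z, A z /\ U z /\ V z.

Definition domain (Omega : C -> Prop) : Prop :=
  open Omega /\ (exists z, Omega z) /\ connected Omega.

Definition homeomorphism (U V : C -> Prop) (f : C -> C) : Prop :=
  (forall z, U z -> V (f z)) /\ (forall z, U z -> continuous f z) /\
  exists g : C -> C,
    (forall w, V w -> U (g w)) /\ (forall w, V w -> continuous g w) /\
    (forall z, U z -> g (f z) = z) /\ (forall w, V w -> f (g w) = w).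

Definition evenly_covered (D : C -> Prop) (p : C -> C) (V : C -> Prop) : Prop :=
  exists (I : Type) (S : I -> C -> Prop),
    (forall i, open (S i)) /\
    (forall i j z, S i z -> S j z -> i = j) /\
    (forall z, D z /\ V (p z) <-> exists i, S i z) /\
    (forall i, homeomorphism (S i) V p).

Definition covering_map (D Omega : C -> Prop) (p : C -> C) : Prop :=
  (forall z, D z -> Omega (p z)) /\
  (forall w, Omega w -> exists z, D z /\ p z = w) /\
  (forall w, Omega w -> exists V : C -> Prop,
     open V /\ V w /\ (forall v, V v -> Omega v) /\ evenly_covered D p V).

(** The disk is simply connected, so a covering of [Omega] by it is the
    universal one; its conformal structure is the one making [p] holomorphic. *)
Definition hyperbolic_domain (Omega : C -> Prop) : Prop :=
  domain Omega /\
  exists p : C -> C, holomorphic_on unit_disc p /\ covering_map unit_disc Omega p.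

Definition dx (u : C -> R) (z : C) : R := Derive (fun t => u (t, Im z)) (Re z).
Definition dy (u : C -> R) (z : C) : R := Derive (fun t => u (Re z, t)) (Im z).

Fixpoint Ck_on (n : nat) (Omega : C -> Prop) (u : C -> R) : Prop :=
  match n with
  | O => forall z, Omega z -> continuous u z
  | S m =>
      (forall z, Omega z -> continuous u z) /\
      (forall z, Omega z -> ex_derive (fun t => u (t, Im z)) (Re z)) /\
      (forall z, Omega z -> ex_derive (fun t => u (Re z, t)) (Im z)) /\
      Ck_on m Omega (dx u) /\ Ck_on m Omega (dy u)
  end.

Definition smooth_on (Omega : C -> Prop) (u : C -> R) : Prop :=
  forall n, Ck_on n Omega u.

Definition laplacian (u : C -> R) (z : C) : R := dx (dx u) z + dy (dy u) z.

(** Gaussian curvature of the conformal metric [rho^2 |dz|^2]. *)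
Definition gaussian_curvature (rho : C -> R) (z : C) : R :=
  - laplacian (fun w => ln (rho w)) z / (rho z) ^ 2.

Definition C1_path (Omega : C -> Prop) (x y : C) (g : R -> C) : Prop :=
  g 0 = x /\ g 1 = y /\
  forall t, 0 <= t <= 1 ->
    Omega (g t) /\
    ex_derive (fun s => Re (g s)) t /\ ex_derive (fun s => Im (g s)) t /\
    continuous (Derive (fun s => Re (g s))) t /\
    continuous (Derive (fun s => Im (g s))) t.

Definition path_length (rho : C -> R) (g : R -> C) : R :=
  RInt (fun t => rho (g t) *
          Cmod (Derive (fun s => Re (g s)) t, Derive (fun s => Im (g s)) t)) 0 1.

Definition metric_dist (Omega : C -> Prop) (rho : C -> R) (x y : C) : Rbar :=
  Glb_Rbar (fun l => exists g, C1_path Omega x y g /\ l = path_length rho g).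

Definition complete_metric (Omega : C -> Prop) (rho : C -> R) : Prop :=
  forall u : nat -> C,
    (forall n, Omega (u n)) ->
    (forall eps : R, 0 < eps -> exists N : nat, forall m n : nat,
       (N <= m)%nat -> (N <= n)%nat ->
       Rbar_lt (metric_dist Omega rho (u m) (u n)) (Finite eps)) ->
    exists z, Omega z /\
      forall eps : R, 0 < eps -> exists N : nat, forall n : nat,
        (N <= n)%nat -> Rbar_lt (metric_dist Omega rho (u n) z) (Finite eps).

(** [rho^2 |dz|^2] is the hyperbolic metric of [Omega]; the values of [rho]
    outside [Omega] are irrelevant. *)
Definition hyperbolic_metric (Omega : C -> Prop) (rho : C -> R) : Prop :=
  (forall z, Omega z -> 0 < rho z) /\
  smooth_on Omega rho /\
  (forall z, Omega z -> gaussian_curvature rho z = -1) /\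
  complete_metric Omega rho.

Definition boundary (Omega : C -> Prop) (w : C) : Prop :=
  forall eps : R, 0 < eps ->
    (exists a, disc w eps a /\ Omega a) /\ (exists b, disc w eps b /\ ~ Omega b).

Definition dist_boundary (Omega : C -> Prop) (z : C) : Rbar :=
  Glb_Rbar (fun d => exists w, boundary Omega w /\ d = Cmod (z - w)%C).

(** A hyperbolic domain carries exactly one hyperbolic metric, so [rho] below is
    determined on [Omega] and the notion depends on [Omega] only. *)
Definition strongly_hyperbolic (Omega : C -> Prop) : Prop :=
  hyperbolic_domain Omega /\
  exists c : R, 0 < c /\
    forall rho, hyperbolic_metric Omega rho ->
      forall z, Omega z ->
        Rbar_le (Rbar_div (Finite c) (dist_boundary Omega z)) (Finite (rho z)).

(** A quadratic differential [phi dz^2] on [Omega] is given by its coefficient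
    [phi]. *)
Definition qd_norm (rho : C -> R) (phi : C -> C) (z : C) : R :=
  Cmod (phi z) / (rho z) ^ 2.

Definition qd_sup_norm (Omega : C -> Prop) (rho : C -> R) (phi : C -> C) : Rbar :=
  Lub_Rbar (fun x => exists z, Omega z /\ x = qd_norm rho phi z).

Definition sqrt_branch (phi : C -> C) (z0 : C) (delta : R) (s : C -> C) : Prop :=
  holomorphic_on (disc z0 delta) s /\
  forall z, disc z0 delta z -> (s z * s z)%C = phi z.

(** Complex line integral of [s] along the segment from [z0] to [z]. *)
Definition segment_integral (s : C -> C) (z0 z : C) : C :=
  let h (t : R) : C := (s (z0 + RtoC t * (z - z0)) * (z - z0))%C in
  (RInt (fun t => Re (h t)) 0 1, RInt (fun t => Im (h t)) 0 1).

(** The inverse near [z0] of [f z = int_{z0}^z sqrt phi] extends to a conformal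
    diffeomorphism [g] of [{|w| < r}] onto a subset of [Omega].  The choice of
    the branch is immaterial: replacing [s] by [- s] replaces [g w] by [g (- w)]. *)
Definition inverse_extends_to_disc
    (Omega : C -> Prop) (phi : C -> C) (z0 : C) (r : R) : Prop :=
  exists (delta : R) (s g : C -> C),
    0 < delta /\
    (forall z, disc z0 delta z -> Omega z) /\
    sqrt_branch phi z0 delta s /\
    conformal_diffeo_into (disc (RtoC 0) r) Omega g /\
    locally z0 (fun z => g (segment_integral s z0 z) = z).

Definition phi_radius (Omega : C -> Prop) (phi : C -> C) (z0 : C) : Rbar :=
  if Ceq_dec (phi z0) (RtoC 0) then Finite 0
  else Lub_Rbar (fun r => 0 < r /\ inverse_extends_to_disc Omega phi z0 r).

(** [x^a] for [0 < x <= +oo] and [a > 0]. *)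
Definition Rbar_power (x : Rbar) (a : R) : Rbar :=
  match x with
  | Finite y => Finite (Rpower y a)
  | p_infty => p_infty
  | m_infty => Finite 0
  end.

(* Main.v *)
From Stdlib Require Import Reals Lra Lia Classical ClassicalEpsilon.
From Coquelicot Require Import Coquelicot.
Require Import Defs.
Open Scope R_scope.

(** Upper bound.  If the inverse [g] of [f = int sqrt phi] extends to the disc of radius
    [r] with values in [Omega], then the Schwarz-Pick inequality in Ahlfors' form gives
    [rho (g 0) |g' 0| <= 2 / r].  Since [g 0 = z0] and [|g' 0| = |phi z0|^(-1/2)], this
    reads [r <= 2 |phi z0|^(1/2) / rho z0 = 2 ||Phi||^(1/2)], so the constant 2 works
    ([ahlfors], [inverse_extends_radius_le]).  Ahlfors' inequality only uses that the metric
    is smooth, positive and of curvature -1: at an interior maximum of the quotient of the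
    pulled-back metric by the hyperbolic metric of a slightly smaller disc, the second
    derivatives of the logarithm of this quotient along the two coordinate directions are
    nonpositive, and their sum compares the two curvatures ([directional_max_inequality],
    [ahlfors_at_max]).  The maximum is examined in [Omega], through [h = g^-1]; there the
    terms [ln (r^2 - |h|^2)] and [ln |h'|] have explicit second derivatives, and the second
    one is harmonic.

    Lower bound.  Let [d] be the distance from [z0] to the boundary, [m] the norm of [Phi]
    at [z0] and [M] its supremum.  Strong hyperbolicity gives [rho z0 >= c / d], hence
    [|phi z0| >= c^2 m / d^2], while Ahlfors' inequality for Euclidean discs contained in
    [Omega] gives [rho <= 4 / d], hence [|phi| <= 16 M / d^2], on the disc of radius [d / 2].
    By Cauchy's estimate [phi] differs from [phi z0] by at most [|phi z0| / 2] on a disc of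
    radius comparable to [m d / M].  There [sqrt phi] has a branch, and its primitive [f]
    is so close to an affine map that a fixed-slope Newton iteration inverts it over a disc
    of radius comparable to [|phi z0|^(1/2) m d / M >= c m^(3/2) / M], which is at least
    [c m^2 / M^(3/2)] because [m <= M] ([inverse_extends_of_near_const],
    [phi_radius_lower]).  When [M] is infinite the bound is [0].

    Since holomorphic means only complex differentiable, both parts rest on Cauchy theory on
    discs: Goursat's theorem for triangles makes [segment_integral] a primitive
    ([segment_integral_primitive]); differentiating circle averages of a primitive under the
    integral sign yields the mean value property and Cauchy's formula for the derivative,
    and from these the holomorphy of derivatives and Cauchy's estimate
    ([holomorphic_derivative], [cauchy_estimate]). *)

(** * Estimates in the complex plane *)

Lemma Cmod_Re_le (z : C) : Rabs (Re z) <= Cmod z.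
Proof. exact (Rle_trans _ _ _ (Rmax_l _ _) (Rmax_Cmod z)). Qed.

Lemma Cmod_Im_le (z : C) : Rabs (Im z) <= Cmod z.
Proof. exact (Rle_trans _ _ _ (Rmax_r _ _) (Rmax_Cmod z)). Qed.

Lemma Cmod_sum_le (z : C) : Cmod z <= Rabs (Re z) + Rabs (Im z).
Proof.
  destruct z as [x y]; simpl.
  replace (x, y) with (RtoC x + Ci * RtoC y)%C
    by (unfold RtoC, Ci, Cplus, Cmult; simpl; f_equal; ring).
  eapply Rle_trans; [apply Cmod_triangle|].
  rewrite Cmod_mult, Cmod_Ci, !Cmod_R; lra.
Qed.

Lemma Cmod_sub_sym (a b : C) : Cmod (a - b)%C = Cmod (b - a)%C.
Proof. rewrite <- Cmod_opp; f_equal; ring. Qed.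

Lemma Cmod_sub_triangle (a b c : C) :
  Cmod (a - c)%C <= Cmod (a - b)%C + Cmod (b - c)%C.
Proof. replace (a - c)%C with ((a - b) + (b - c))%C by ring; apply Cmod_triangle. Qed.

Lemma Cmod_triangle_rev (a b : C) : Cmod a - Cmod b <= Cmod (a - b)%C.
Proof.
  assert (H := Cmod_triangle (a - b)%C b).
  replace (a - b + b)%C with a in H by ring; lra.
Qed.

Lemma Cmod_self_sub (z : C) : Cmod (z - z)%C = 0.
Proof. replace (z - z)%C with (RtoC 0) by ring; apply Cmod_0. Qed.

Lemma Cmod_sqr (z : C) : Cmod z * Cmod z = Re z * Re z + Im z * Im z.
Proof. assert (H := Cmod2_alt z); simpl in H; lra. Qed.

Lemma C_ext (a b : C) : Re a = Re b -> Im a = Im b -> a = b.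
Proof. destruct a, b; simpl; intros -> ->; reflexivity. Qed.

Lemma Re_plus (a b : C) : Re (a + b)%C = Re a + Re b.
Proof. reflexivity. Qed.
Lemma Im_plus (a b : C) : Im (a + b)%C = Im a + Im b.
Proof. reflexivity. Qed.
Lemma Re_minus (a b : C) : Re (a - b)%C = Re a - Re b.
Proof. reflexivity. Qed.
Lemma Im_minus (a b : C) : Im (a - b)%C = Im a - Im b.
Proof. reflexivity. Qed.
Lemma Re_mult (a b : C) : Re (a * b)%C = Re a * Re b - Im a * Im b.
Proof. reflexivity. Qed.
Lemma Im_mult (a b : C) : Im (a * b)%C = Re a * Im b + Im a * Re b.
Proof. reflexivity. Qed.

(** * Complex derivatives and continuity *)

(** [l] is the complex derivative of [f] at [z], in Landau form. *)
Definition cderiv (f : C -> C) (z l : C) : Prop :=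
  forall eps, 0 < eps -> exists del, 0 < del /\
    forall w, Cmod (w - z)%C < del ->
      Cmod (f w - f z - l * (w - z))%C <= eps * Cmod (w - z)%C.

(** Continuity of a function of a complex variable. *)
Definition ccont (f : C -> C) (z : C) : Prop :=
  forall eps, 0 < eps -> exists del, 0 < del /\
    forall w, Cmod (w - z)%C < del -> Cmod (f w - f z)%C < eps.

(** Continuity of a complex-valued function of a real variable. *)
Definition pcont (f : R -> C) (t : R) : Prop :=
  forall eps, 0 < eps -> exists del, 0 < del /\
    forall s, Rabs (s - t) < del -> Cmod (f s - f t)%C < eps.

(** [l] is the derivative at [t] of a complex-valued function of a real variable. *)
Definition pderiv (f : R -> C) (t : R) (l : C) : Prop :=
  forall eps, 0 < eps -> exists del, 0 < del /\
    forall s, Rabs (s - t) < del ->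
      Cmod (f s - f t - l * RtoC (s - t))%C <= eps * Rabs (s - t).

Lemma is_derive_cderiv (f : C -> C) (z l : C) :
  is_derive (K := C_AbsRing) (V := C_NormedModule) f z l <-> cderiv f z l.
Proof.
  split.
  - intros [_ H] eps Heps.
    destruct (H z (fun P HP => HP) (mkposreal eps Heps)) as [d Hd].
    exists d; split; [apply cond_pos|]. intros w Hw.
    specialize (Hd w Hw). simpl in Hd.
    replace (f w - f z - l * (w - z))%C with (f w - f z - (w - z) * l)%C by ring.
    exact Hd.
  - intros H. split.
    + apply is_linear_scal_l.
    + intros x Hx eps.
      assert (Ex : z = x).
      { apply (@is_filter_lim_locally_unique C_AbsRing (AbsRing_NormedModule C_AbsRing)).
        exact Hx. }
      subst x.
      destruct (H eps (cond_pos eps)) as (d & Hd & H').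
      exists (mkposreal d Hd). intros w Hw.
      specialize (H' w Hw).
      replace (f w - f z - l * (w - z))%C with (f w - f z - (w - z) * l)%C in H' by ring.
      exact H'.
Qed.

Lemma holomorphic_cderiv (U : C -> Prop) (f : C -> C) :
  holomorphic_on U f <-> forall z, U z -> exists l, cderiv f z l.
Proof.
  split; intros H z Hz; destruct (H z Hz) as [l Hl]; exists l;
    apply is_derive_cderiv; exact Hl.
Qed.

Lemma is_derive_epsilon (f : R -> R) (t l : R) :
  is_derive f t l <->
  forall eps, 0 < eps -> exists del, 0 < del /\
    forall s, Rabs (s - t) < del ->
      Rabs (f s - f t - l * (s - t)) <= eps * Rabs (s - t).
Proof.
  split.
  - intros [_ H] eps Heps.
    destruct (H t (fun P HP => HP) (mkposreal eps Heps)) as [d Hd].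
    exists d; split; [apply cond_pos|]. intros w Hw.
    specialize (Hd w Hw). simpl in Hd.
    replace (f w - f t - l * (w - t)) with (f w - f t - (w - t) * l) by ring.
    exact Hd.
  - intros H. split.
    + apply (@is_linear_scal_l R_AbsRing R_NormedModule).
    + intros x Hx eps.
      assert (Ex : t = x).
      { apply (@is_filter_lim_locally_unique R_AbsRing R_NormedModule).
        exact Hx. }
      subst x.
      destruct (H eps (cond_pos eps)) as (d & Hd & H').
      exists (mkposreal d Hd). intros w Hw.
      specialize (H' w Hw).
      replace (f w - f t - l * (w - t)) with (f w - f t - (w - t) * l) in H' by ring.
      exact H'.
Qed.

Lemma continuous_epsilon (f : R -> R) (t : R) :
  continuous f t <->
  forall eps, 0 < eps -> exists del, 0 < del /\
    forall s, Rabs (s - t) < del -> Rabs (f s - f t) < eps.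
Proof.
  split.
  - intros H eps Heps.
    destruct (proj1 (filterlim_locally _ _) H (mkposreal eps Heps)) as [d Hd].
    exists d; split; [apply cond_pos|exact Hd].
  - intros H. apply filterlim_locally. intros eps.
    destruct (H eps (cond_pos eps)) as (d & Hd & H').
    exists (mkposreal d Hd). exact H'.
Qed.

Lemma pderiv_Re (f : R -> C) t l : pderiv f t l -> is_derive (fun s => Re (f s)) t (Re l).
Proof.
  intros H; apply is_derive_epsilon; intros eps Heps.
  destruct (H eps Heps) as (d & Hd & H'). exists d; split; auto.
  intros s Hs. eapply Rle_trans; [|apply (H' s Hs)].
  eapply Rle_trans; [|apply Cmod_Re_le]. right; f_equal.
  rewrite !Re_minus, Re_mult, re_RtoC, im_RtoC; ring.
Qed.

Lemma pderiv_Im (f : R -> C) t l : pderiv f t l -> is_derive (fun s => Im (f s)) t (Im l).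
Proof.
  intros H; apply is_derive_epsilon; intros eps Heps.
  destruct (H eps Heps) as (d & Hd & H'). exists d; split; auto.
  intros s Hs. eapply Rle_trans; [|apply (H' s Hs)].
  eapply Rle_trans; [|apply Cmod_Im_le]. right; f_equal.
  rewrite !Im_minus, Im_mult, re_RtoC, im_RtoC; ring.
Qed.

Lemma pderiv_pair (f : R -> C) t l :
  is_derive (fun s => Re (f s)) t (Re l) -> is_derive (fun s => Im (f s)) t (Im l) ->
  pderiv f t l.
Proof.
  intros H1 H2 eps Heps.
  destruct (proj1 (is_derive_epsilon _ _ _) H1 (eps/2)) as (d1 & Hd1 & H1'); [lra|].
  destruct (proj1 (is_derive_epsilon _ _ _) H2 (eps/2)) as (d2 & Hd2 & H2'); [lra|].
  exists (Rmin d1 d2); split; [apply Rmin_pos; auto|]. intros s Hs.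
  assert (Hs1 : Rabs (s - t) < d1) by (eapply Rlt_le_trans; [exact Hs|apply Rmin_l]).
  assert (Hs2 : Rabs (s - t) < d2) by (eapply Rlt_le_trans; [exact Hs|apply Rmin_r]).
  specialize (H1' s Hs1). specialize (H2' s Hs2).
  eapply Rle_trans; [apply Cmod_sum_le|].
  rewrite !Re_minus, !Im_minus, Re_mult, Im_mult, re_RtoC, im_RtoC.
  replace (Re (f s) - Re (f t) - (Re l * (s - t) - Im l * 0))
    with (Re (f s) - Re (f t) - Re l * (s - t)) by ring.
  replace (Im (f s) - Im (f t) - (Re l * 0 + Im l * (s - t)))
    with (Im (f s) - Im (f t) - Im l * (s - t)) by ring.
  lra.
Qed.

Lemma pcont_Re (f : R -> C) t : pcont f t -> continuous (fun s => Re (f s)) t.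
Proof.
  intros H; apply continuous_epsilon; intros eps Heps.
  destruct (H eps Heps) as (d & Hd & H'). exists d; split; auto.
  intros s Hs. eapply Rle_lt_trans; [|apply (H' s Hs)].
  eapply Rle_trans; [|apply Cmod_Re_le]. right; reflexivity.
Qed.

Lemma pcont_Im (f : R -> C) t : pcont f t -> continuous (fun s => Im (f s)) t.
Proof.
  intros H; apply continuous_epsilon; intros eps Heps.
  destruct (H eps Heps) as (d & Hd & H'). exists d; split; auto.
  intros s Hs. eapply Rle_lt_trans; [|apply (H' s Hs)].
  eapply Rle_trans; [|apply Cmod_Im_le]. right; reflexivity.
Qed.

(** Choice of a positive factor absorbing a given nonnegative constant. *)
Lemma small_cofactor (eps K : R) : 0 < eps -> 0 <= K -> exists e, 0 < e /\ e * K <= eps.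
Proof.
  intros He HK. exists (eps / (K + 1)). split.
  - apply Rdiv_lt_0_compat; lra.
  - assert (H := Rdiv_lt_0_compat eps (K + 1) He ltac:(lra)).
    assert (Heq : eps / (K + 1) * (K + 1) = eps) by (field; lra). nra.
Qed.

Lemma cderiv_lipschitz (f : C -> C) z l : cderiv f z l ->
  exists del, 0 < del /\ forall w, Cmod (w - z)%C < del ->
    Cmod (f w - f z)%C <= (Cmod l + 1) * Cmod (w - z)%C.
Proof.
  intros H. destruct (H 1 Rlt_0_1) as (d & Hd & H'). exists d; split; auto.
  intros w Hw. specialize (H' w Hw).
  assert (H2 := Cmod_triangle (f w - f z - l * (w - z))%C (l * (w - z))%C).
  replace (f w - f z - l * (w - z) + l * (w - z))%C with (f w - f z)%C in H2 by ring.
  rewrite Cmod_mult in H2. lra.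
Qed.

Lemma cderiv_ccont (f : C -> C) z l : cderiv f z l -> ccont f z.
Proof.
  intros H eps Heps. destruct (cderiv_lipschitz f z l H) as (d & Hd & H').
  destruct (small_cofactor (eps/2) (Cmod l + 1)) as (e & He & He');
    [lra|assert (H2 := Cmod_ge_0 l); lra|].
  exists (Rmin d e); split; [apply Rmin_pos; auto|]. intros w Hw.
  assert (Hw1 : Cmod (w - z)%C < d) by (eapply Rlt_le_trans; [exact Hw|apply Rmin_l]).
  assert (Hw2 : Cmod (w - z)%C < e) by (eapply Rlt_le_trans; [exact Hw|apply Rmin_r]).
  specialize (H' w Hw1). assert (H2 := Cmod_ge_0 l).
  assert ((Cmod l + 1) * Cmod (w - z)%C <= (Cmod l + 1) * e) by (apply Rmult_le_compat_l; lra).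
  lra.
Qed.

Lemma pderiv_lipschitz (f : R -> C) t l : pderiv f t l ->
  exists del, 0 < del /\ forall s, Rabs (s - t) < del ->
    Cmod (f s - f t)%C <= (Cmod l + 1) * Rabs (s - t).
Proof.
  intros H. destruct (H 1 Rlt_0_1) as (d & Hd & H'). exists d; split; auto.
  intros w Hw. specialize (H' w Hw).
  assert (H2 := Cmod_triangle (f w - f t - l * RtoC (w - t))%C (l * RtoC (w - t))%C).
  replace (f w - f t - l * RtoC (w - t) + l * RtoC (w - t))%C with (f w - f t)%C in H2 by ring.
  rewrite Cmod_mult, Cmod_R in H2. lra.
Qed.

Lemma pderiv_pcont (f : R -> C) t l : pderiv f t l -> pcont f t.
Proof.
  intros H eps Heps. destruct (pderiv_lipschitz f t l H) as (d & Hd & H').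
  destruct (small_cofactor (eps/2) (Cmod l + 1)) as (e & He & He');
    [lra|assert (H2 := Cmod_ge_0 l); lra|].
  exists (Rmin d e); split; [apply Rmin_pos; auto|]. intros w Hw.
  assert (Hw1 : Rabs (w - t) < d) by (eapply Rlt_le_trans; [exact Hw|apply Rmin_l]).
  assert (Hw2 : Rabs (w - t) < e) by (eapply Rlt_le_trans; [exact Hw|apply Rmin_r]).
  specialize (H' w Hw1). assert (H2 := Cmod_ge_0 l).
  assert ((Cmod l + 1) * Rabs (w - t) <= (Cmod l + 1) * e) by (apply Rmult_le_compat_l; lra).
  lra.
Qed.

Lemma ccont_pcont (f : C -> C) (g : R -> C) t :
  ccont f (g t) -> pcont g t -> pcont (fun s => f (g s)) t.
Proof.
  intros Hf Hg eps Heps. destruct (Hf eps Heps) as (d & Hd & H').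
  destruct (Hg d Hd) as (d' & Hd' & H''). exists d'; split; auto.
Qed.

Lemma pcont_const (c : C) t : pcont (fun _ => c) t.
Proof.
  intros eps Heps; exists 1; split; [lra|]. intros; rewrite Cmod_self_sub; auto.
Qed.

Lemma pcont_plus (f g : R -> C) t : pcont f t -> pcont g t -> pcont (fun s => (f s + g s)%C) t.
Proof.
  intros Hf Hg eps Heps. destruct (Hf (eps/2)) as (d & Hd & H'); [lra|].
  destruct (Hg (eps/2)) as (d' & Hd' & H''); [lra|].
  exists (Rmin d d'); split; [apply Rmin_pos; auto|]. intros s Hs.
  specialize (H' s (Rlt_le_trans _ _ _ Hs (Rmin_l _ _))).
  specialize (H'' s (Rlt_le_trans _ _ _ Hs (Rmin_r _ _))).
  replace (f s + g s - (f t + g t))%C with ((f s - f t) + (g s - g t))%C by ring.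
  eapply Rle_lt_trans; [apply Cmod_triangle|lra].
Qed.

Lemma pcont_mult (f g : R -> C) t : pcont f t -> pcont g t -> pcont (fun s => (f s * g s)%C) t.
Proof.
  intros Hf Hg eps Heps.
  assert (P1 := Cmod_ge_0 (f t)). assert (P2 := Cmod_ge_0 (g t)).
  destruct (small_cofactor (eps/2) (Cmod (f t) + Cmod (g t) + 1)) as (e & He & He'); [lra|lra|].
  destruct (Hf (Rmin e 1)) as (d & Hd & H'); [apply Rmin_pos; lra|].
  destruct (Hg (Rmin e 1)) as (d' & Hd' & H''); [apply Rmin_pos; lra|].
  exists (Rmin d d'); split; [apply Rmin_pos; auto|]. intros s Hs.
  specialize (H' s (Rlt_le_trans _ _ _ Hs (Rmin_l _ _))).
  specialize (H'' s (Rlt_le_trans _ _ _ Hs (Rmin_r _ _))).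
  assert (M1 := Rmin_l e 1). assert (M2 := Rmin_r e 1).
  replace (f s * g s - f t * g t)%C
    with ((f s - f t) * (g s - g t) + (f t * (g s - g t) + (f s - f t) * g t))%C by ring.
  eapply Rle_lt_trans; [apply Cmod_triangle|].
  eapply Rle_lt_trans; [apply Rplus_le_compat_l, Cmod_triangle|].
  rewrite !Cmod_mult.
  assert (Q1 := Cmod_ge_0 (f s - f t)%C). assert (Q2 := Cmod_ge_0 (g s - g t)%C).
  assert (Cmod (f s - f t)%C * Cmod (g s - g t)%C <= e * 1) by (apply Rmult_le_compat; lra).
  assert (Cmod (f t) * Cmod (g s - g t)%C <= Cmod (f t) * e) by (apply Rmult_le_compat_l; lra).
  assert (Cmod (f s - f t)%C * Cmod (g t) <= e * Cmod (g t)) by (apply Rmult_le_compat_r; lra).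
  lra.
Qed.

Lemma pcont_minus (f g : R -> C) t : pcont f t -> pcont g t -> pcont (fun s => (f s - g s)%C) t.
Proof.
  intros Hf Hg eps Heps.
  destruct (pcont_plus _ _ t Hf (pcont_mult _ _ t (pcont_const (- RtoC 1)%C t) Hg) eps Heps)
    as (d & Hd & H).
  exists d; split; auto. intros s Hs. specialize (H s Hs).
  replace (f s - g s - (f t - g t))%C
    with (f s + - RtoC 1 * g s - (f t + - RtoC 1 * g t))%C by ring.
  exact H.
Qed.

Lemma pderiv_comp (F : C -> C) (g : R -> C) t l d :
  cderiv F (g t) l -> pderiv g t d -> pderiv (fun s => F (g s)) t (l * d)%C.
Proof.
  intros HF Hg eps Heps.
  destruct (pderiv_lipschitz g t d Hg) as (d1 & Hd1 & L).
  assert (P1 := Cmod_ge_0 l). assert (P2 := Cmod_ge_0 d).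
  destruct (small_cofactor (eps/2) (Cmod d + 1)) as (e & He & He'); [lra|lra|].
  destruct (small_cofactor (eps/2) (Cmod l)) as (e2 & He2 & He2'); [lra|lra|].
  destruct (HF e He) as (d2 & Hd2 & H2).
  destruct (pderiv_pcont g t d Hg d2 Hd2) as (d3 & Hd3 & H3).
  destruct (Hg e2 He2) as (d4 & Hd4 & H4).
  exists (Rmin d1 (Rmin d3 d4)); split; [repeat apply Rmin_pos; auto|]. intros s Hs.
  assert (M1 := Rmin_l d1 (Rmin d3 d4)). assert (M2 := Rmin_r d1 (Rmin d3 d4)).
  assert (M3 := Rmin_l d3 d4). assert (M4 := Rmin_r d3 d4).
  specialize (L s ltac:(lra)). specialize (H3 s ltac:(lra)). specialize (H4 s ltac:(lra)).
  specialize (H2 _ H3).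
  replace (F (g s) - F (g t) - l * d * RtoC (s - t))%C
    with ((F (g s) - F (g t) - l * (g s - g t)) + l * (g s - g t - d * RtoC (s - t)))%C by ring.
  eapply Rle_trans; [apply Cmod_triangle|]. rewrite Cmod_mult.
  assert (P3 := Rabs_pos (s - t)).
  assert (e * Cmod (g s - g t)%C <= e * ((Cmod d + 1) * Rabs (s - t)))
    by (apply Rmult_le_compat_l; lra).
  assert (Cmod l * Cmod (g s - g t - d * RtoC (s - t))%C <= Cmod l * (e2 * Rabs (s - t)))
    by (apply Rmult_le_compat_l; lra).
  assert (e * (Cmod d + 1) * Rabs (s - t) <= eps / 2 * Rabs (s - t))
    by (apply Rmult_le_compat_r; lra).
  assert (e2 * Cmod l * Rabs (s - t) <= eps / 2 * Rabs (s - t))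
    by (apply Rmult_le_compat_r; lra).
  nra.
Qed.

Lemma pderiv_mult (f g : R -> C) t lf lg :
  pderiv f t lf -> pderiv g t lg -> pderiv (fun s => (f s * g s)%C) t (lf * g t + f t * lg)%C.
Proof.
  intros Hf Hg. apply pderiv_pair.
  - apply is_derive_ext with (fun s => Re (f s) * Re (g s) - Im (f s) * Im (g s));
      [intros; rewrite Re_mult; reflexivity|].
    assert (H := is_derive_minus _ _ _ _ _
      (is_derive_mult _ _ _ _ _ (pderiv_Re _ _ _ Hf) (pderiv_Re _ _ _ Hg) Rmult_comm)
      (is_derive_mult _ _ _ _ _ (pderiv_Im _ _ _ Hf) (pderiv_Im _ _ _ Hg) Rmult_comm)).
    evar_last; [exact H|]. rewrite Re_plus, !Re_mult. unfold minus, plus, opp, mult; simpl. unfold Re, Im; ring.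
  - apply is_derive_ext with (fun s => Re (f s) * Im (g s) + Im (f s) * Re (g s));
      [intros; rewrite Im_mult; reflexivity|].
    assert (H := is_derive_plus _ _ _ _ _
      (is_derive_mult _ _ _ _ _ (pderiv_Re _ _ _ Hf) (pderiv_Im _ _ _ Hg) Rmult_comm)
      (is_derive_mult _ _ _ _ _ (pderiv_Im _ _ _ Hf) (pderiv_Re _ _ _ Hg) Rmult_comm)).
    evar_last; [exact H|]. rewrite Im_plus, !Im_mult. unfold minus, plus, opp, mult; simpl. unfold Re, Im; ring.
Qed.

Lemma pderiv_line (a e : C) t : pderiv (fun s => (a + RtoC s * e)%C) t e.
Proof.
  intros eps Heps; exists 1; split; [lra|]. intros s _.
  replace (a + s * e - (a + t * e) - e * RtoC (s - t))%C with (RtoC 0)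
    by (rewrite RtoC_minus; ring).
  rewrite Cmod_0. assert (H := Rabs_pos (s - t)). nra.
Qed.

(** * Integrals of complex-valued functions of a real variable *)

(** Componentwise Riemann integral. *)
Definition cint (f : R -> C) (a b : R) : C :=
  (RInt (fun t => Re (f t)) a b, RInt (fun t => Im (f t)) a b).

Lemma ex_RInt_pcont_Re f a b :
  (forall t, Rmin a b <= t <= Rmax a b -> pcont f t) -> ex_RInt (fun t => Re (f t)) a b.
Proof. intros H. apply (@ex_RInt_continuous R_CompleteNormedModule).
  intros; apply pcont_Re, H; auto. Qed.

Lemma ex_RInt_pcont_Im f a b :
  (forall t, Rmin a b <= t <= Rmax a b -> pcont f t) -> ex_RInt (fun t => Im (f t)) a b.
Proof. intros H. apply (@ex_RInt_continuous R_CompleteNormedModule).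
  intros; apply pcont_Im, H; auto. Qed.

Lemma cint_ext f g a b : a <= b -> (forall t, a < t < b -> f t = g t) ->
  cint f a b = cint g a b.
Proof.
  intros Hab H. apply C_ext; simpl; apply RInt_ext; intros t;
    rewrite Rmin_left, Rmax_right by auto; intros Ht; rewrite H; auto.
Qed.

Lemma cint_plus f g a b : a <= b ->
  (forall t, a <= t <= b -> pcont f t) -> (forall t, a <= t <= b -> pcont g t) ->
  cint (fun t => f t + g t)%C a b = (cint f a b + cint g a b)%C.
Proof.
  intros Hab Hf Hg.
  assert (Hf' : forall t, Rmin a b <= t <= Rmax a b -> pcont f t)
    by (rewrite Rmin_left, Rmax_right; auto).
  assert (Hg' : forall t, Rmin a b <= t <= Rmax a b -> pcont g t)
    by (rewrite Rmin_left, Rmax_right; auto).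
  apply C_ext; simpl.
  - exact (RInt_plus _ _ a b (ex_RInt_pcont_Re f a b Hf') (ex_RInt_pcont_Re g a b Hg')).
  - exact (RInt_plus _ _ a b (ex_RInt_pcont_Im f a b Hf') (ex_RInt_pcont_Im g a b Hg')).
Qed.

Lemma cint_scal c f a b : a <= b -> (forall t, a <= t <= b -> pcont f t) ->
  cint (fun t => c * f t)%C a b = (c * cint f a b)%C.
Proof.
  intros Hab Hf.
  assert (Hf' : forall t, Rmin a b <= t <= Rmax a b -> pcont f t)
    by (rewrite Rmin_left, Rmax_right; auto).
  assert (E1 := ex_RInt_pcont_Re f a b Hf'). assert (E2 := ex_RInt_pcont_Im f a b Hf').
  apply C_ext; simpl.
  - apply is_RInt_unique.
    exact (is_RInt_minus _ _ _ _ _ _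
      (is_RInt_scal _ _ _ (fst c) _ (RInt_correct (V := R_CompleteNormedModule) _ _ _ E1))
      (is_RInt_scal _ _ _ (snd c) _ (RInt_correct (V := R_CompleteNormedModule) _ _ _ E2))).
  - apply is_RInt_unique.
    exact (is_RInt_plus _ _ _ _ _ _
      (is_RInt_scal _ _ _ (fst c) _ (RInt_correct (V := R_CompleteNormedModule) _ _ _ E2))
      (is_RInt_scal _ _ _ (snd c) _ (RInt_correct (V := R_CompleteNormedModule) _ _ _ E1))).
Qed.

Lemma cint_minus f g a b : a <= b ->
  (forall t, a <= t <= b -> pcont f t) -> (forall t, a <= t <= b -> pcont g t) ->
  cint (fun t => f t - g t)%C a b = (cint f a b - cint g a b)%C.
Proof.
  intros Hab Hf Hg.
  transitivity (cint (fun t => f t + (- (1)) * g t)%C a b).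
  - apply cint_ext; auto; intros; ring.
  - rewrite cint_plus, cint_scal; auto; [ring|].
    intros; apply pcont_mult; auto using pcont_const.
Qed.

(** The norm inequality follows by pairing the integral with its own conjugate. *)
Lemma cint_bound f a b M : a <= b -> (forall t, a <= t <= b -> pcont f t) ->
  (forall t, a <= t <= b -> Cmod (f t) <= M) -> Cmod (cint f a b) <= M * (b - a).
Proof.
  intros Hab Hf HM. set (I := cint f a b).
  assert (HI := Cmod_ge_0 I).
  destruct (Rle_lt_or_eq_dec _ _ HI) as [Hpos|Hz].
  2:{ rewrite <- Hz. assert (0 <= M).
      { eapply Rle_trans; [apply Cmod_ge_0|apply (HM a); lra]. }
      apply Rmult_le_pos; lra. }
  assert (E : Re (cint (fun t => Cconj I * f t)%C a b) = Cmod I * Cmod I).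
  { rewrite cint_scal by auto. fold I. rewrite Cmod_sqr. destruct I; simpl; ring. }
  assert (B : Re (cint (fun t => Cconj I * f t)%C a b) <= Cmod I * M * (b - a)).
  { simpl. replace (Cmod I * M * (b - a)) with (RInt (fun _ => Cmod I * M) a b)
      by (rewrite RInt_const; unfold scal; simpl; unfold mult; simpl; ring).
    assert (Hc : forall t, Rmin a b <= t <= Rmax a b -> pcont (fun t => Cconj I * f t)%C t).
    { rewrite Rmin_left, Rmax_right by auto. intros; apply pcont_mult; auto using pcont_const. }
    apply RInt_le; auto.
    - exact (ex_RInt_pcont_Re _ a b Hc).
    - apply (ex_RInt_const (V := R_NormedModule)).
    - intros t Ht. change (Re (Cconj I * f t)%C <= Cmod I * M).
      eapply Rle_trans; [apply Rle_abs|]. eapply Rle_trans; [apply Cmod_Re_le|].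
      rewrite Cmod_mult, Cmod_conj. apply Rmult_le_compat_l; auto. apply HM; lra. }
  rewrite E in B. nra.
Qed.

Lemma cint_FTC F f a b : a <= b ->
  (forall t, a <= t <= b -> pderiv F t (f t)) -> (forall t, a <= t <= b -> pcont f t) ->
  cint f a b = (F b - F a)%C.
Proof.
  intros Hab HF Hf. apply C_ext; simpl.
  - apply is_RInt_unique.
    apply (is_RInt_derive (V := R_CompleteNormedModule) (fun t => Re (F t)) (fun t => Re (f t)));
    rewrite Rmin_left, Rmax_right by auto; intros t Ht; [apply pderiv_Re|apply pcont_Re]; auto.
  - apply is_RInt_unique.
    apply (is_RInt_derive (V := R_CompleteNormedModule) (fun t => Im (F t)) (fun t => Im (f t)));
    rewrite Rmin_left, Rmax_right by auto; intros t Ht; [apply pderiv_Im|apply pcont_Im]; auto.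
Qed.

Lemma cint_comp_lin f u v a b :
  (forall t, Rmin (u * a + v) (u * b + v) <= t <= Rmax (u * a + v) (u * b + v) -> pcont f t) ->
  cint (fun t => RtoC u * f (u * t + v)%R)%C a b = cint f (u * a + v) (u * b + v).
Proof.
  intros Hf. apply C_ext; simpl.
  - rewrite <- (RInt_comp_lin (V := R_CompleteNormedModule) (fun t => Re (f t)) u v a b)
      by (apply ex_RInt_pcont_Re; auto).
    apply RInt_ext; intros. unfold scal, Re; simpl; unfold mult; simpl; ring.
  - rewrite <- (RInt_comp_lin (V := R_CompleteNormedModule) (fun t => Im (f t)) u v a b)
      by (apply ex_RInt_pcont_Im; auto).
    apply RInt_ext; intros. unfold scal, Im; simpl; unfold mult; simpl; ring.
Qed.

Lemma cint_Chasles f a b c : a <= b -> b <= c -> (forall t, a <= t <= c -> pcont f t) ->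
  (cint f a b + cint f b c)%C = cint f a c.
Proof.
  intros Hab Hbc Hf.
  assert (H1 : forall t, Rmin a b <= t <= Rmax a b -> pcont f t)
    by (rewrite Rmin_left, Rmax_right by auto; intros; apply Hf; lra).
  assert (H2 : forall t, Rmin b c <= t <= Rmax b c -> pcont f t)
    by (rewrite Rmin_left, Rmax_right by auto; intros; apply Hf; lra).
  apply C_ext; simpl.
  - apply (RInt_Chasles (V := R_CompleteNormedModule) (fun t => Re (f t)));
      apply ex_RInt_pcont_Re; auto.
  - apply (RInt_Chasles (V := R_CompleteNormedModule) (fun t => Im (f t)));
      apply ex_RInt_pcont_Im; auto.
Qed.

(** * Integrals along segments and the Goursat theorem *)

Lemma cderiv_ext (f g : C -> C) z l :
  (forall w, f w = g w) -> cderiv f z l -> cderiv g z l.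
Proof.
  intros E H eps Heps. destruct (H eps Heps) as (d & Hd & H'). exists d; split; auto.
  intros w Hw. rewrite <- !E. auto.
Qed.

Lemma cderiv_affine (a b z : C) : cderiv (fun w => a + b * w)%C z b.
Proof.
  intros eps Heps; exists 1; split; [lra|]. intros w _.
  replace (a + b * w - (a + b * z) - b * (w - z))%C with (RtoC 0) by ring.
  rewrite Cmod_0. assert (H := Cmod_ge_0 (w - z)%C). nra.
Qed.

Lemma cderiv_quadratic (a b z : C) :
  cderiv (fun w => a * w + b * w * w / RtoC 2)%C z (a + b * z)%C.
Proof.
  intros eps Heps.
  destruct (small_cofactor eps (Cmod (b / RtoC 2)%C)) as (e & He & He'); [auto|apply Cmod_ge_0|].
  exists e; split; auto. intros w Hw.
  replace (a * w + b * w * w / RtoC 2 - (a * z + b * z * z / RtoC 2) - (a + b * z) * (w - z))%C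
    with (b / RtoC 2 * (w - z) * (w - z))%C.
  2:{ field. }
  rewrite !Cmod_mult. apply Rmult_le_compat_r; [apply Cmod_ge_0|].
  assert (H := Cmod_ge_0 (b / RtoC 2)%C).
  assert (Cmod (b / RtoC 2)%C * Cmod (w - z)%C <= Cmod (b / RtoC 2)%C * e)
    by (apply Rmult_le_compat_l; lra). lra.
Qed.

(** The point of parameter [t] on the segment from [a] to [b]. *)
Definition seg_pt (a b : C) (t : R) : C := (a + RtoC t * (b - a))%C.

Lemma seg_pt_0 a b : seg_pt a b 0 = a.
Proof. unfold seg_pt; ring. Qed.

Lemma seg_pt_1 a b : seg_pt a b 1 = b.
Proof. unfold seg_pt; ring. Qed.

Lemma seg_pt_dist a b p t : 0 <= t <= 1 ->
  Cmod (seg_pt a b t - p)%C <= (1 - t) * Cmod (a - p)%C + t * Cmod (b - p)%C.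
Proof.
  intros Ht. unfold seg_pt.
  replace (a + t * (b - a) - p)%C with (RtoC (1 - t) * (a - p) + RtoC t * (b - p))%C
    by (rewrite RtoC_minus; ring).
  eapply Rle_trans; [apply Cmod_triangle|]. rewrite !Cmod_mult, !Cmod_R.
  rewrite !Rabs_pos_eq by lra. lra.
Qed.

Lemma seg_pt_near a b p M t : 0 <= t <= 1 ->
  Cmod (a - p)%C <= M -> Cmod (b - p)%C <= M -> Cmod (seg_pt a b t - p)%C <= M.
Proof. intros Ht Ha Hb. assert (H := seg_pt_dist a b p t Ht). nra. Qed.

Lemma disc_convex c r a b t : 0 <= t <= 1 ->
  disc c r a -> disc c r b -> disc c r (seg_pt a b t).
Proof.
  unfold disc. intros Ht Ha Hb. assert (H := seg_pt_dist a b c t Ht).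
  destruct (Rle_lt_dec t (1/2)); nra.
Qed.

Lemma disc_center c r : 0 < r -> disc c r c.
Proof. unfold disc. intros; rewrite Cmod_self_sub; auto. Qed.

Lemma pderiv_seg_pt a b t : pderiv (seg_pt a b) t (b - a)%C.
Proof. apply pderiv_line. Qed.

(** [f] is continuous at every point of the segment from [a] to [b]. *)
Definition seg_cont (f : C -> C) (a b : C) : Prop :=
  forall t, 0 <= t <= 1 -> ccont f (seg_pt a b t).

Lemma pcont_seg f a b t : ccont f (seg_pt a b t) ->
  pcont (fun t => f (seg_pt a b t) * (b - a))%C t.
Proof.
  intros H. apply pcont_mult; [|apply pcont_const].
  apply ccont_pcont; auto. eapply pderiv_pcont, pderiv_seg_pt.
Qed.

Lemma seg_integral_cint f a b :
  segment_integral f a b = cint (fun t => f (seg_pt a b t) * (b - a))%C 0 1.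
Proof. reflexivity. Qed.

Lemma seg_integral_bound f a b M : seg_cont f a b ->
  (forall t, 0 <= t <= 1 -> Cmod (f (seg_pt a b t)) <= M) ->
  Cmod (segment_integral f a b) <= M * Cmod (b - a)%C.
Proof.
  intros Hc HM. rewrite seg_integral_cint.
  replace (M * Cmod (b - a)%C) with (M * Cmod (b - a)%C * (1 - 0)) by ring.
  apply cint_bound; [lra|intros; apply pcont_seg; auto|].
  intros t Ht. rewrite Cmod_mult. apply Rmult_le_compat_r; auto using Cmod_ge_0.
Qed.

Lemma seg_integral_FTC F f a b :
  (forall t, 0 <= t <= 1 -> cderiv F (seg_pt a b t) (f (seg_pt a b t))) ->
  seg_cont f a b -> segment_integral f a b = (F b - F a)%C.
Proof.
  intros HF Hc. rewrite seg_integral_cint.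
  rewrite (cint_FTC (fun t => F (seg_pt a b t))); [|lra| |].
  - rewrite seg_pt_0, seg_pt_1; reflexivity.
  - intros t Ht. apply pderiv_comp; auto using pderiv_seg_pt.
  - intros; apply pcont_seg; auto.
Qed.

Lemma seg_integral_minus f g a b : seg_cont f a b -> seg_cont g a b ->
  segment_integral (fun z => f z - g z)%C a b =
  (segment_integral f a b - segment_integral g a b)%C.
Proof.
  intros Hf Hg. rewrite !seg_integral_cint, <- cint_minus; [|lra| |];
    try (intros; apply pcont_seg; auto).
  apply cint_ext; [lra|]. intros; ring.
Qed.

Lemma seg_integral_rev f a b : seg_cont f a b ->
  segment_integral f b a = (- segment_integral f a b)%C.
Proof.
  intros Hf. rewrite !seg_integral_cint.
  assert (E := cint_comp_lin (fun t => f (seg_pt a b t) * (b - a))%C (-1) 1 0 1).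
  replace (-1 * 0 + 1) with 1 in E by ring. replace (-1 * 1 + 1) with 0 in E by ring.
  rewrite Rmin_right, Rmax_left in E by lra.
  transitivity (cint (fun t => f (seg_pt a b t) * (b - a))%C 1 0).
  - rewrite <- E by (intros; apply pcont_seg; auto).
    apply cint_ext; [lra|]. intros t Ht.
    replace (seg_pt a b (-1 * t + 1)) with (seg_pt b a t).
    + replace (RtoC (-1)) with (- RtoC 1)%C by (rewrite <- RtoC_opp; reflexivity). ring.
    + unfold seg_pt. rewrite RtoC_plus, RtoC_mult.
      replace (RtoC (-1)) with (- RtoC 1)%C by (rewrite <- RtoC_opp; reflexivity). ring.
  - unfold cint. rewrite <- (opp_RInt_swap (V := R_CompleteNormedModule)).
    + rewrite <- (opp_RInt_swap (V := R_CompleteNormedModule) (fun t => Im _)); [reflexivity|].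
      apply ex_RInt_pcont_Im. rewrite Rmin_left, Rmax_right by lra.
      intros; apply pcont_seg; auto.
    + apply ex_RInt_pcont_Re. rewrite Rmin_left, Rmax_right by lra.
      intros; apply pcont_seg; auto.
Qed.

Lemma ccont_const (k z : C) : ccont (fun _ => k) z.
Proof. intros e He. exists 1; split; [lra|]. intros; rewrite Cmod_self_sub; auto. Qed.

Lemma seg_integral_const k a b : segment_integral (fun _ => k) a b = (k * (b - a))%C.
Proof.
  rewrite (seg_integral_FTC (fun w => RtoC 0 + k * w)%C).
  - ring.
  - intros; apply cderiv_affine.
  - intros t _; apply ccont_const.
Qed.

Lemma seg_cont_minus f g a b : seg_cont f a b -> seg_cont g a b ->
  seg_cont (fun z => f z - g z)%C a b.
Proof.
  intros Hf Hg t Ht eps Heps.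
  destruct (Hf t Ht (eps/2) ltac:(lra)) as (d1 & Hd1 & G1).
  destruct (Hg t Ht (eps/2) ltac:(lra)) as (d2 & Hd2 & G2).
  exists (Rmin d1 d2); split; [apply Rmin_pos; auto|]. intros q Hq.
  specialize (G1 q (Rlt_le_trans _ _ _ Hq (Rmin_l _ _))).
  specialize (G2 q (Rlt_le_trans _ _ _ Hq (Rmin_r _ _))).
  replace (f q - g q - (f (seg_pt a b t) - g (seg_pt a b t)))%C
    with ((f q - f (seg_pt a b t)) + - (g q - g (seg_pt a b t)))%C by ring.
  eapply Rle_lt_trans; [apply Cmod_triangle|]. rewrite Cmod_opp. lra.
Qed.

(** Integrating an inequality [|f - k| <= M] along a segment. *)
Lemma seg_integral_near_const f k a b M : seg_cont f a b ->
  (forall t, 0 <= t <= 1 -> Cmod (f (seg_pt a b t) - k)%C <= M) ->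
  Cmod (segment_integral f a b - k * (b - a))%C <= M * Cmod (b - a)%C.
Proof.
  intros Hf HM. assert (Hk : seg_cont (fun _ => k) a b) by (intros t _; apply ccont_const).
  rewrite <- seg_integral_const, <- seg_integral_minus by auto.
  apply (seg_integral_bound (fun z => f z - k)%C); auto.
  apply (seg_cont_minus f (fun _ => k)); auto.
Qed.

Definition midpoint (a b : C) : C := seg_pt a b (1/2).

Lemma midpoint_eq a b : midpoint a b = ((a + b) / RtoC 2)%C.
Proof.
  unfold midpoint, seg_pt. rewrite RtoC_div by lra. field.
Qed.

Lemma midpoint_sym a b : midpoint a b = midpoint b a.
Proof. rewrite !midpoint_eq; f_equal; ring. Qed.

Lemma seg_pt_midpoint_l a b t : seg_pt a (midpoint a b) t = seg_pt a b (1/2 * t + 0).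
Proof. unfold midpoint, seg_pt. rewrite RtoC_plus, RtoC_mult. ring. Qed.

Lemma seg_pt_midpoint_r a b t : seg_pt (midpoint a b) b t = seg_pt a b (1/2 * t + 1/2).
Proof.
  unfold midpoint, seg_pt. rewrite RtoC_plus, RtoC_mult, RtoC_div by lra. field.
Qed.

Lemma seg_integral_split f a b : seg_cont f a b ->
  segment_integral f a b =
  (segment_integral f a (midpoint a b) + segment_integral f (midpoint a b) b)%C.
Proof.
  intros Hf. set (k := fun t => (f (seg_pt a b t) * (b - a))%C).
  assert (Hk : forall t, 0 <= t <= 1 -> pcont k t) by (intros; apply pcont_seg; auto).
  rewrite !seg_integral_cint. fold k.
  rewrite <- (cint_Chasles k 0 (1/2) 1) by (auto; lra).
  assert (E1 := cint_comp_lin k (1/2) 0 0 1). assert (E2 := cint_comp_lin k (1/2) (1/2) 0 1).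
  replace (1/2 * 0 + 0) with 0 in E1 by field. replace (1/2 * 1 + 0) with (1/2) in E1 by field.
  replace (1/2 * 0 + 1/2) with (1/2) in E2 by field. replace (1/2 * 1 + 1/2) with 1 in E2 by field.
  rewrite Rmin_left, Rmax_right in E1 by lra. rewrite Rmin_left, Rmax_right in E2 by lra.
  rewrite <- E1, <- E2 by (intros; apply Hk; lra).
  assert (N : RtoC 2 <> RtoC 0) by (intros H; apply RtoC_inj in H; lra).
  f_equal; apply cint_ext; try lra; intros t Ht; unfold k.
  - rewrite seg_pt_midpoint_l, midpoint_eq, RtoC_div by lra. field; auto.
  - rewrite seg_pt_midpoint_r, midpoint_eq, RtoC_div by lra. field; auto.
Qed.

(** Integral along the boundary of the triangle with vertices [a], [b], [c]. *)
Definition tri_integral (f : C -> C) (a b c : C) : C :=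
  (segment_integral f a b + segment_integral f b c + segment_integral f c a)%C.

(** Perimeter of the triangle with vertices [a], [b], [c]. *)
Definition perimeter (a b c : C) : R :=
  Cmod (a - b)%C + Cmod (b - c)%C + Cmod (c - a)%C.

(** Bisection step: one of the four half-size triangles carries at least a quarter
    of the boundary integral. *)
Lemma tri_bisect f z0 r a b c M :
  (forall z, disc z0 r z -> ccont f z) -> M < r ->
  Cmod (a - z0)%C <= M -> Cmod (b - z0)%C <= M -> Cmod (c - z0)%C <= M ->
  exists a' b' c',
    Cmod (a' - z0)%C <= M /\ Cmod (b' - z0)%C <= M /\ Cmod (c' - z0)%C <= M /\
    perimeter a' b' c' = perimeter a b c / 2 /\
    Cmod (a' - a)%C <= perimeter a b c /\
    Cmod (tri_integral f a b c) <= 4 * Cmod (tri_integral f a' b' c').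
Proof.
  intros Hf HM Ha Hb Hc.
  set (x := midpoint a b). set (y := midpoint b c). set (z := midpoint c a).
  assert (Hx : Cmod (x - z0)%C <= M) by (apply seg_pt_near; auto; lra).
  assert (Hy : Cmod (y - z0)%C <= M) by (apply seg_pt_near; auto; lra).
  assert (Hz : Cmod (z - z0)%C <= M) by (apply seg_pt_near; auto; lra).
  assert (S : forall p q, Cmod (p - z0)%C <= M -> Cmod (q - z0)%C <= M -> seg_cont f p q).
  { intros p q Hp Hq t Ht. apply Hf. unfold disc.
    eapply Rle_lt_trans; [apply seg_pt_near; eauto|auto]. }
  assert (E : tri_integral f a b c =
    (tri_integral f a x z + tri_integral f x b y + tri_integral f z y c + tri_integral f y z x)%C).
  { unfold tri_integral.
    rewrite (seg_integral_split f a b), (seg_integral_split f b c), (seg_integral_split f c a) by auto.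
    fold x y z.
    rewrite (seg_integral_rev f x z), (seg_integral_rev f x y), (seg_integral_rev f y z) by auto.
    ring. }
  assert (N : RtoC 2 <> RtoC 0) by (intros H; apply RtoC_inj in H; lra).
  assert (Half : forall p, Cmod (p / RtoC 2)%C = Cmod p / 2).
  { intros p. rewrite Cmod_div by auto. rewrite Cmod_R, Rabs_pos_eq; lra. }
  assert (D : forall p q, Cmod (midpoint p q - p)%C = Cmod (p - q)%C / 2).
  { intros p q. rewrite midpoint_eq, (Cmod_sub_sym p q), <- Half. f_equal; field; auto. }
  assert (D2 : forall p q s, Cmod (midpoint p q - midpoint q s)%C = Cmod (s - p)%C / 2).
  { intros p q s. rewrite !midpoint_eq, (Cmod_sub_sym s p), <- Half. f_equal; field; auto. }
  assert (S1 := Cmod_sub_sym a b). assert (S2 := Cmod_sub_sym b c).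
  assert (S3 := Cmod_sub_sym c a).
  assert (P1 : perimeter a x z = perimeter a b c / 2).
  { unfold perimeter. rewrite (Cmod_sub_sym a x). unfold x at 1. rewrite D.
    rewrite (Cmod_sub_sym x z). unfold z at 1, x at 1. rewrite D2.
    unfold z. rewrite midpoint_sym, D. lra. }
  assert (P2 : perimeter x b y = perimeter a b c / 2).
  { unfold perimeter. unfold x at 1. rewrite midpoint_sym, D.
    rewrite (Cmod_sub_sym b y). unfold y at 1. rewrite D.
    rewrite (Cmod_sub_sym y x). unfold x, y. rewrite D2. lra. }
  assert (P3 : perimeter z y c = perimeter a b c / 2).
  { unfold perimeter. rewrite (Cmod_sub_sym z y). unfold y at 1, z at 1. rewrite D2.
    unfold y. rewrite midpoint_sym, D. rewrite (Cmod_sub_sym c z). unfold z. rewrite D. lra. }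
  assert (P4 : perimeter y z x = perimeter a b c / 2).
  { unfold perimeter, x, y, z. rewrite !D2. lra. }
  assert (Q1 := Cmod_ge_0 (a - b)%C). assert (Q2 := Cmod_ge_0 (b - c)%C).
  assert (Q3 := Cmod_ge_0 (c - a)%C).
  assert (T : Cmod (tri_integral f a b c) <=
    Cmod (tri_integral f a x z) + Cmod (tri_integral f x b y) +
    Cmod (tri_integral f z y c) + Cmod (tri_integral f y z x)).
  { rewrite E. eapply Rle_trans; [apply Cmod_triangle|]. apply Rplus_le_compat_r.
    eapply Rle_trans; [apply Cmod_triangle|]. apply Rplus_le_compat_r. apply Cmod_triangle. }
  assert (B0 : Cmod (x - a)%C <= perimeter a b c)
    by (unfold x; rewrite D; unfold perimeter; lra).
  assert (B1 : Cmod (z - a)%C <= perimeter a b c).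
  { unfold z; rewrite midpoint_sym, D, Cmod_sub_sym; unfold perimeter; lra. }
  assert (B2 : Cmod (y - a)%C <= perimeter a b c).
  { eapply Rle_trans; [apply (Cmod_sub_triangle y b a)|]. unfold y. rewrite D.
    rewrite (Cmod_sub_sym b a). unfold perimeter. lra. }
  destruct (Rle_lt_dec (Cmod (tri_integral f a b c)) (4 * Cmod (tri_integral f a x z))) as [G|G1].
  { exists a, x, z. rewrite Cmod_self_sub. repeat split; auto. unfold perimeter; lra. }
  destruct (Rle_lt_dec (Cmod (tri_integral f a b c)) (4 * Cmod (tri_integral f x b y))) as [G|G2].
  { exists x, b, y. repeat split; auto. }
  destruct (Rle_lt_dec (Cmod (tri_integral f a b c)) (4 * Cmod (tri_integral f z y c))) as [G|G3].
  { exists z, y, c. repeat split; auto. }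
  exists y, z, x. repeat split; auto. lra.
Qed.

Lemma half_pow_pos n : 0 < (1/2) ^ n.
Proof. apply pow_lt; lra. Qed.

Lemma half_pow_small K eps : 0 < eps -> exists N, forall n, (N <= n)%nat -> K * (1/2) ^ n < eps.
Proof.
  intros Heps.
  destruct (pow_lt_1_zero (1/2) ltac:(rewrite Rabs_pos_eq; lra) (eps / (Rabs K + 1))) as (N & HN).
  { apply Rdiv_lt_0_compat; auto. assert (H := Rabs_pos K); lra. }
  exists N. intros n Hn. specialize (HN n Hn).
  rewrite Rabs_pos_eq in HN by (left; apply half_pow_pos).
  assert (H := Rabs_pos K). assert (H2 := Rle_abs K). assert (H3 := half_pow_pos n).
  apply (Rmult_lt_compat_r (Rabs K + 1)) in HN; [|lra].
  replace (eps / (Rabs K + 1) * (Rabs K + 1)) with eps in HN by (field; lra).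
  assert (K * (1/2)^n <= Rabs K * (1/2)^n) by (apply Rmult_le_compat_r; lra).
  lra.
Qed.

Lemma geometric_limit_R (u : nat -> R) K :
  (forall n, Rabs (u (S n) - u n) <= K * (1/2) ^ n) ->
  exists p, forall n, Rabs (u n - p) <= 2 * K * (1/2) ^ n.
Proof.
  intros H.
  assert (HK : 0 <= K).
  { specialize (H 0%nat). assert (P := Rabs_pos (u 1%nat - u 0%nat)). simpl in H. lra. }
  assert (T : forall n k, Rabs (u (n + k)%nat - u n) <= 2 * K * (1/2)^n - 2 * K * (1/2)^(n+k)).
  { intros n k. induction k.
    - rewrite Nat.add_0_r, Rminus_diag, Rabs_R0. lra.
    - rewrite Nat.add_succ_r. specialize (H (n + k)%nat).
      replace (u (S (n + k)) - u n) with ((u (S (n+k)) - u (n+k)%nat) + (u (n+k)%nat - u n)) by ring.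
      eapply Rle_trans; [apply Rabs_triang|]. simpl ((1/2) ^ S (n + k)). lra. }
  assert (T' : forall n m, (n <= m)%nat -> Rabs (u m - u n) <= 2 * K * (1/2)^n).
  { intros n m Hm. replace m with (n + (m - n))%nat by lia.
    eapply Rle_trans; [apply T|]. assert (P := half_pow_pos (n + (m-n))). nra. }
  assert (CC : Cauchy_crit u).
  { intros eps Heps. destruct (half_pow_small (4 * K) eps Heps) as (N & HN).
    exists N. intros n m Hn Hm. specialize (HN N (Nat.le_refl N)).
    assert (A1 := T' N n ltac:(lia)). assert (A2 := T' N m ltac:(lia)).
    unfold Rdist. replace (u n - u m) with ((u n - u N) - (u m - u N)) by ring.
    eapply Rle_lt_trans; [apply Rabs_triang|]. rewrite Rabs_Ropp. lra. }
  destruct (Rcomplete.R_complete u CC) as (p & Hp). exists p. intros n.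
  apply Rnot_lt_le. intros Hlt.
  destruct (Hp (Rabs (u n - p) - 2 * K * (1/2)^n)) as (N & HN); [lra|].
  specialize (HN (max N n) ltac:(lia)). unfold Rdist in HN.
  assert (A1 := T' n (max N n) ltac:(lia)).
  assert (A2 := Rabs_triang (u n - u (max N n)) (u (max N n) - p)).
  replace (u n - u (max N n) + (u (max N n) - p)) with (u n - p) in A2 by ring.
  rewrite Rabs_minus_sym in A1. lra.
Qed.

(** Increments bounded by a geometric sequence of ratio 1/2 force convergence. *)
Lemma geometric_limit (u : nat -> C) K :
  (forall n, Cmod (u (S n) - u n)%C <= K * (1/2) ^ n) ->
  exists p, forall n, Cmod (u n - p)%C <= 4 * K * (1/2) ^ n.
Proof.
  intros H.
  destruct (geometric_limit_R (fun n => Re (u n)) K) as (x & Hx).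
  { intros n. eapply Rle_trans; [|apply H]. apply (Cmod_Re_le (u (S n) - u n)%C). }
  destruct (geometric_limit_R (fun n => Im (u n)) K) as (y & Hy).
  { intros n. eapply Rle_trans; [|apply H]. apply (Cmod_Im_le (u (S n) - u n)%C). }
  exists (x, y). intros n. eapply Rle_trans; [apply Cmod_sum_le|].
  rewrite Re_minus, Im_minus. specialize (Hx n). specialize (Hy n).
  change (Re (x, y)) with x. change (Im (x, y)) with y. lra.
Qed.

(** Goursat's theorem for triangles: bisected triangles shrink to a point [p], near which
    [f] differs from its first-order Taylor polynomial, whose boundary integrals vanish, by
    a small multiple of the distance to [p]. *)
Lemma tri_integral_goursat f z0 r a b c :
  (forall z, disc z0 r z -> exists l, cderiv f z l) ->
  disc z0 r a -> disc z0 r b -> disc z0 r c -> tri_integral f a b c = RtoC 0.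
Proof.
  intros Hf Ha Hb Hc. unfold disc in Ha, Hb, Hc.
  assert (Hcont : forall z, disc z0 r z -> ccont f z).
  { intros z Hz. destruct (Hf z Hz) as (l & Hl). eapply cderiv_ccont; eauto. }
  set (M := Rmax (Cmod (a - z0)%C) (Rmax (Cmod (b - z0)%C) (Cmod (c - z0)%C))).
  assert (HM : M < r) by (unfold M; repeat apply Rmax_lub_lt; auto).
  assert (HaM : Cmod (a - z0)%C <= M) by apply Rmax_l.
  assert (HbM : Cmod (b - z0)%C <= M)
    by (eapply Rle_trans; [apply Rmax_l|]; eapply Rle_trans; [|apply Rmax_r]; apply Rle_refl).
  assert (HcM : Cmod (c - z0)%C <= M)
    by (eapply Rle_trans; [apply Rmax_r|]; eapply Rle_trans; [|apply Rmax_r]; apply Rle_refl).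
  set (inside := fun p : C * C * C => Cmod (fst (fst p) - z0)%C <= M /\
    Cmod (snd (fst p) - z0)%C <= M /\ Cmod (snd p - z0)%C <= M).
  set (per := fun p : C * C * C => perimeter (fst (fst p)) (snd (fst p)) (snd p)).
  set (int := fun p : C * C * C => Cmod (tri_integral f (fst (fst p)) (snd (fst p)) (snd p))).
  set (good := fun p q => inside q /\ per q = per p / 2 /\
    Cmod (fst (fst q) - fst (fst p))%C <= per p /\ int p <= 4 * int q).
  set (step := fun p => epsilon (inhabits p) (good p)).
  assert (Hstep : forall p, inside p -> good p (step p)).
  { intros p (H1 & H2 & H3). apply epsilon_spec.
    destruct (tri_bisect f z0 r _ _ _ M Hcont HM H1 H2 H3)
      as (a' & b' & c' & I1 & I2 & I3 & I4 & I5 & I6).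
    exists (a', b', c'). repeat split; auto. }
  set (p0 := (a, b, c)).
  set (u := fun n => Nat.iter n step p0).
  assert (Hin : forall n, inside (u n)).
  { induction n; [repeat split; auto|]. apply (Hstep (u n) IHn). }
  assert (Hper : forall n, per (u n) = per p0 * (1/2)^n).
  { induction n; [simpl; ring|].
    destruct (Hstep (u n) (Hin n)) as (_ & E & _). change (step (u n)) with (u (S n)) in E.
    rewrite E, IHn. simpl; field. }
  assert (Hint : forall n, int p0 * (1/2)^n * (1/2)^n <= int (u n)).
  { induction n; [simpl; lra|].
    destruct (Hstep (u n) (Hin n)) as (_ & _ & _ & E). change (step (u n)) with (u (S n)) in E.
    change ((1/2) ^ S n) with (1/2 * (1/2) ^ n). lra. }
  destruct (geometric_limit (fun n => fst (fst (u n))) (per p0)) as (p & Hp).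
  { intros n. destruct (Hstep (u n) (Hin n)) as (_ & _ & E & _).
    change (step (u n)) with (u (S n)) in E. rewrite Hper in E. exact E. }
  assert (HP : 0 <= per p0).
  { unfold per, perimeter. assert (Q1 := Cmod_ge_0 (fst (fst p0) - snd (fst p0))%C).
    assert (Q2 := Cmod_ge_0 (snd (fst p0) - snd p0)%C).
    assert (Q3 := Cmod_ge_0 (snd p0 - fst (fst p0))%C). lra. }
  assert (HpM : Cmod (p - z0)%C <= M).
  { apply Rnot_lt_le. intros Hlt.
    destruct (half_pow_small (4 * per p0) (Cmod (p - z0)%C - M)) as (N & HN); [lra|].
    specialize (HN N (Nat.le_refl N)). specialize (Hp N).
    destruct (Hin N) as (I1 & _).
    assert (T := Cmod_sub_triangle p (fst (fst (u N))) z0).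
    rewrite (Cmod_sub_sym p (fst _)) in T. cbv beta in Hp. lra. }
  destruct (Hf p) as (l & Hl); [unfold disc; lra|].
  apply Cmod_eq_0. apply Rle_antisym; [|apply Cmod_ge_0].
  change (int p0 <= 0). apply Rnot_lt_le. intros Hpos.
  (* Points of the [N]-th triangle are within [5 * per p0 * (1/2)^N] of [p]: [4] bounds the
     distance from its first vertex to [p], and [1] its perimeter. *)
  destruct (small_cofactor (int p0 / 2) (5 * per p0 * per p0)) as (eps & Heps & Heps'); [lra|nra|].
  destruct (Hl eps Heps) as (d & Hd & H').
  destruct (half_pow_small (5 * per p0) d Hd) as (N & HN). specialize (HN N (Nat.le_refl N)).
  specialize (Hp N). specialize (Hper N). specialize (Hint N). destruct (Hin N) as (I1 & I2 & I3).
  unfold int in Hint at 2. unfold per in Hper at 1.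
  revert Hp Hper Hint I1 I2 I3. generalize (u N). intros [[x y] z]. simpl fst; simpl snd.
  intros Hp Hper Hint I1 I2 I3.
  set (h := (1/2)^N) in *. assert (Hh : 0 < h) by apply half_pow_pos.
  set (g := fun w => (f p - l * p + l * w)%C).
  assert (Cg : forall w, ccont g w) by (intros; eapply cderiv_ccont, cderiv_affine).
  assert (Cf : forall v w, Cmod (v - z0)%C <= M -> Cmod (w - z0)%C <= M -> seg_cont f v w).
  { intros v w Hv Hw t Ht. apply Hcont. unfold disc.
    eapply Rle_lt_trans; [apply seg_pt_near; eauto|auto]. }
  assert (Ig : forall v w, segment_integral g v w =
    (((f p - l * p) * w + l * w * w / RtoC 2) - ((f p - l * p) * v + l * v * v / RtoC 2))%C).
  { intros v w. apply (seg_integral_FTC (fun w => (f p - l * p) * w + l * w * w / RtoC 2)%C).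
    - intros; apply cderiv_quadratic.
    - intros t Ht; apply Cg. }
  assert (Q1 := Cmod_ge_0 (x - y)%C). assert (Q2 := Cmod_ge_0 (y - z)%C).
  assert (Q3 := Cmod_ge_0 (z - x)%C). unfold perimeter in Hper.
  set (B := 5 * per p0 * h).
  assert (Kx : Cmod (x - p)%C <= B) by (unfold B; nra).
  assert (Ky : Cmod (y - p)%C <= B).
  { assert (T := Cmod_sub_triangle y x p). rewrite (Cmod_sub_sym y x) in T. unfold B. lra. }
  assert (Kz : Cmod (z - p)%C <= B).
  { assert (T := Cmod_sub_triangle z x p). unfold B. lra. }
  assert (Bd : forall v w, Cmod (v - z0)%C <= M -> Cmod (w - z0)%C <= M ->
    Cmod (v - p)%C <= B -> Cmod (w - p)%C <= B ->
    Cmod (segment_integral f v w - segment_integral g v w)%C <= eps * B * Cmod (w - v)%C).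
  { intros v w V1 W1 V2 W2. rewrite <- seg_integral_minus; auto; [|intros t Ht; apply Cg].
    apply (seg_integral_bound (fun z => f z - g z)%C).
    - apply seg_cont_minus; auto. intros t Ht; apply Cg.
    - intros t Ht. assert (K : Cmod (seg_pt v w t - p)%C <= B) by (apply seg_pt_near; auto).
      unfold g.
      replace (f (seg_pt v w t) - (f p - l * p + l * seg_pt v w t))%C
        with (f (seg_pt v w t) - f p - l * (seg_pt v w t - p))%C by ring.
      eapply Rle_trans; [apply H'; unfold B in K; lra|]. apply Rmult_le_compat_l; lra. }
  assert (E : tri_integral f x y z =
    ((segment_integral f x y - segment_integral g x y) +
     (segment_integral f y z - segment_integral g y z) +
     (segment_integral f z x - segment_integral g z x))%C).
  { unfold tri_integral. rewrite !Ig. ring. }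
  assert (Fin : Cmod (tri_integral f x y z) <= eps * B * (per p0 * h)).
  { rewrite E. eapply Rle_trans; [apply Cmod_triangle|].
    eapply Rle_trans; [apply Rplus_le_compat_r, Cmod_triangle|].
    rewrite <- Hper. assert (B1 := Bd x y I1 I2 Kx Ky). assert (B2 := Bd y z I2 I3 Ky Kz).
    assert (B3 := Bd z x I3 I1 Kz Kx).
    rewrite (Cmod_sub_sym y x) in B1. rewrite (Cmod_sub_sym z y) in B2.
    rewrite (Cmod_sub_sym x z) in B3. lra. }
  unfold B in Fin.
  assert (Fin2 : int p0 * (h * h) <= int p0 / 2 * (h * h)).
  { eapply Rle_trans; [|apply Rmult_le_compat_r; [nra|exact Heps']].
    unfold int at 1 in Hint. unfold int at 1. nra. }
  assert (0 < h * h) by nra. nra.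
Qed.

(** A holomorphic function on a disc has the segment integral from the centre as
    a primitive. *)
Lemma segment_integral_primitive f z0 r z :
  (forall z, disc z0 r z -> exists l, cderiv f z l) -> disc z0 r z ->
  cderiv (segment_integral f z0) z (f z).
Proof.
  intros Hf Hz eps Heps.
  assert (Hr : 0 < r) by (unfold disc in Hz; assert (H := Cmod_ge_0 (z - z0)%C); lra).
  assert (Hcont : forall z, disc z0 r z -> ccont f z).
  { intros w Hw. destruct (Hf w Hw) as (l & Hl). eapply cderiv_ccont; eauto. }
  destruct (Hcont z Hz eps Heps) as (d & Hd & H').
  exists (Rmin d (r - Cmod (z - z0)%C)).
  split; [apply Rmin_pos; auto; unfold disc in Hz; lra|]. intros w Hw.
  assert (Hw1 := Rlt_le_trans _ _ _ Hw (Rmin_l _ _)).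
  assert (Hw2 := Rlt_le_trans _ _ _ Hw (Rmin_r _ _)).
  assert (Dw : disc z0 r w).
  { unfold disc. assert (T := Cmod_sub_triangle w z z0). lra. }
  assert (D0 := disc_center z0 r Hr).
  assert (S : forall p q, disc z0 r p -> disc z0 r q -> seg_cont f p q).
  { intros p q Hp Hq t Ht. apply Hcont, disc_convex; auto. }
  assert (G := tri_integral_goursat f z0 r z0 z w Hf D0 Hz Dw).
  unfold tri_integral in G. rewrite (seg_integral_rev f z0 w) in G by auto.
  assert (E : segment_integral f z w = (segment_integral f z0 w - segment_integral f z0 z)%C).
  { apply Ceq_minus. rewrite <- G. ring. }
  rewrite <- E. apply seg_integral_near_const; auto.
  intros t Ht. left. apply H'.
  eapply Rle_lt_trans; [apply seg_pt_dist; auto|]. rewrite Cmod_self_sub.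
  assert (P := Cmod_ge_0 (w - z)%C). nra.
Qed.

(** * Circle averages and regularity of holomorphic functions *)

Lemma cderiv_local_ext f g z l d : 0 < d ->
  (forall w, Cmod (w - z)%C < d -> f w = g w) -> cderiv f z l -> cderiv g z l.
Proof.
  intros Hd E H eps Heps. destruct (H eps Heps) as (d' & Hd' & H').
  exists (Rmin d d'); split; [apply Rmin_pos; auto|].
  intros w Hw. rewrite <- !E.
  - apply H'. eapply Rlt_le_trans; [exact Hw|apply Rmin_r].
  - rewrite Cmod_self_sub; auto.
  - eapply Rlt_le_trans; [exact Hw|apply Rmin_l].
Qed.

Lemma ccont_local_ext f g z d : 0 < d ->
  (forall w, Cmod (w - z)%C < d -> f w = g w) -> ccont f z -> ccont g z.
Proof.
  intros Hd E H eps Heps. destruct (H eps Heps) as (d' & Hd' & H').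
  exists (Rmin d d'); split; [apply Rmin_pos; auto|].
  intros w Hw. rewrite <- !E.
  - apply H'. eapply Rlt_le_trans; [exact Hw|apply Rmin_r].
  - rewrite Cmod_self_sub; auto.
  - eapply Rlt_le_trans; [exact Hw|apply Rmin_l].
Qed.

Lemma cderiv_unique f z l1 l2 : cderiv f z l1 -> cderiv f z l2 -> l1 = l2.
Proof.
  intros H1 H2.
  transitivity (C_derive f z); [symmetry|]; apply is_C_derive_unique, is_derive_cderiv; auto.
Qed.

Lemma cderiv_scal c f z l : cderiv f z l -> cderiv (fun w => c * f w)%C z (c * l)%C.
Proof.
  intros H eps Heps. destruct (small_cofactor eps (Cmod c) Heps (Cmod_ge_0 c)) as (e & He & He').
  destruct (H e He) as (d & Hd & H'). exists d; split; auto. intros w Hw. specialize (H' w Hw).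
  replace (c * f w - c * f z - c * l * (w - z))%C with (c * (f w - f z - l * (w - z)))%C by ring.
  rewrite Cmod_mult. assert (P := Cmod_ge_0 c). assert (P2 := Cmod_ge_0 (w - z)%C).
  assert (Cmod c * Cmod (f w - f z - l * (w - z))%C <= Cmod c * (e * Cmod (w - z)%C))
    by (apply Rmult_le_compat_l; auto).
  assert (e * Cmod c * Cmod (w - z)%C <= eps * Cmod (w - z)%C) by (apply Rmult_le_compat_r; auto).
  lra.
Qed.

Lemma ccont_scal c f z : ccont f z -> ccont (fun w => c * f w)%C z.
Proof.
  intros H eps Heps. destruct (small_cofactor (eps/2) (Cmod c)) as (e & He & He');
    [lra|apply Cmod_ge_0|].
  destruct (H e He) as (d & Hd & H'). exists d; split; auto. intros w Hw. specialize (H' w Hw).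
  replace (c * f w - c * f z)%C with (c * (f w - f z))%C by ring.
  rewrite Cmod_mult. assert (P := Cmod_ge_0 c).
  assert (Cmod c * Cmod (f w - f z)%C <= Cmod c * e) by (apply Rmult_le_compat_l; lra).
  lra.
Qed.

(** Uniform continuity of [f] transversally to a compact path. *)
Lemma path_tube f (g : R -> C) a b eps :
  (forall t, a <= t <= b -> ccont f (g t)) -> (forall t, a <= t <= b -> pcont g t) ->
  0 < eps ->
  exists del, 0 < del /\ forall t h, a <= t <= b -> Cmod h < del ->
    Cmod (f (g t + h)%C - f (g t))%C < eps.
Proof.
  intros Hf Hg Heps.
  assert (L : forall t, exists d : posreal, a <= t <= b -> forall s h,
     Rabs (s - t) < d -> Cmod h < d -> Cmod (f (g s + h)%C - f (g t))%C < eps / 2).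
  { intros t. destruct (classic (a <= t <= b)) as [Ht|Ht].
    2:{ exists (mkposreal 1 Rlt_0_1); intros; contradiction. }
    destruct (Hf t Ht (eps/2) ltac:(lra)) as (d & Hd & H1).
    destruct (Hg t Ht (d/2) ltac:(lra)) as (d' & Hd' & H2).
    exists (mkposreal (Rmin (d/2) d') (Rmin_pos (d/2) d' ltac:(lra) Hd')).
    simpl. intros _ s h Hs Hh. apply H1.
    replace (g s + h - g t)%C with ((g s - g t) + h)%C by ring.
    eapply Rle_lt_trans; [apply Cmod_triangle|].
    specialize (H2 s (Rlt_le_trans _ _ _ Hs (Rmin_r _ _))).
    assert (H3 := Rlt_le_trans _ _ _ Hh (Rmin_l _ _)). lra. }
  destruct (choice _ L) as (delta & Hdelta).
  destruct (compactness_value_1d a b delta) as (d & Hd).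
  exists d; split; [apply cond_pos|]. intros s h Hs Hh.
  apply NNPP. intros Hn. apply (Hd s Hs). intros (t & Ht & Hst & Hdt). apply Hn.
  assert (A1 := Hdelta t Ht s h Hst ltac:(lra)).
  assert (A2 := Hdelta t Ht s (RtoC 0) Hst ltac:(rewrite Cmod_0; apply cond_pos)).
  rewrite Cplus_0_r in A2.
  eapply Rle_lt_trans; [apply (Cmod_sub_triangle _ (f (g t)))|].
  rewrite (Cmod_sub_sym (f (g t))). lra.
Qed.

(** Integrals of [F (g t + z * e t) * k t] over [t] in [[a, b]], as functions of the complex
    parameter [z] near [z1]; [f] is the derivative of [F] in a uniform neighbourhood of the
    path [g + z1 * e].  The factors [e] and [k] are bounded by 1. *)
Section Parametric.

Variables (F f : C -> C) (g e k : R -> C) (a b z0 eta K : R).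
Variable (z1 : C).

Let point (z : C) (t : R) : C := (g t + z * e t)%C.

Hypothesis Hab : a <= b.
Hypothesis Heta : 0 < eta.
Hypothesis HF : forall t h, a <= t <= b -> Cmod h < eta ->
  cderiv F (point z1 t + h)%C (f (point z1 t + h)%C).
Hypothesis Hf : forall t h, a <= t <= b -> Cmod h < eta -> ccont f (point z1 t + h)%C.
Hypothesis Hg : forall t, a <= t <= b -> pcont g t.
Hypothesis He : forall t, a <= t <= b -> pcont e t.
Hypothesis Hk : forall t, a <= t <= b -> pcont k t.
Hypothesis He1 : forall t, a <= t <= b -> Cmod (e t) <= 1.
Hypothesis Hk1 : forall t, a <= t <= b -> Cmod (k t) <= 1.

Lemma parametric_shift z t :
  point z t = (point z1 t + (z - z1) * e t)%C.
Proof. unfold point; ring. Qed.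

Lemma parametric_near z t : a <= t <= b -> Cmod ((z - z1) * e t)%C <= Cmod (z - z1)%C.
Proof.
  intros Ht. rewrite Cmod_mult. specialize (He1 t Ht).
  assert (P := Cmod_ge_0 (z - z1)%C). nra.
Qed.

Lemma parametric_pcont_point z t : a <= t <= b -> pcont (point z) t.
Proof.
  intros Ht. apply pcont_plus; auto. apply pcont_mult; auto using pcont_const.
Qed.

Lemma parametric_pcont_f z : Cmod (z - z1)%C < eta ->
  forall t, a <= t <= b -> pcont (fun t => f (point z t)) t.
Proof.
  intros Hz t Ht. apply ccont_pcont; [|apply parametric_pcont_point; auto].
  rewrite parametric_shift. apply Hf; auto.
  eapply Rle_lt_trans; [apply parametric_near|]; auto.
Qed.

Lemma parametric_pcont_F z : Cmod (z - z1)%C < eta ->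
  forall t, a <= t <= b -> pcont (fun t => F (point z t)) t.
Proof.
  intros Hz t Ht. apply ccont_pcont; [|apply parametric_pcont_point; auto].
  rewrite parametric_shift. eapply cderiv_ccont, HF; auto.
  eapply Rle_lt_trans; [apply parametric_near|]; auto.
Qed.

Lemma parametric_tube eps : 0 < eps -> exists del, 0 < del /\
  forall t h, a <= t <= b -> Cmod h < del ->
    Cmod (f (point z1 t + h)%C - f (point z1 t))%C < eps.
Proof.
  apply path_tube.
  - intros t Ht. replace (point z1 t) with (point z1 t + RtoC 0)%C by ring.
    apply Hf; auto. rewrite Cmod_0; auto.
  - apply parametric_pcont_point.
Qed.

(** Differentiation under the integral sign with respect to a complex parameter. *)
Lemma cint_parametric_cderiv :
  cderiv (fun z => cint (fun t => F (g t + z * e t) * k t)%C a b) z1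
    (cint (fun t => f (g t + z1 * e t) * e t * k t)%C a b).
Proof.
  intros eps Heps.
  destruct (small_cofactor eps (b - a)) as (m & Hm & Hm'); [auto|lra|].
  destruct (parametric_tube m Hm) as (d & Hd & T).
  exists (Rmin d eta); split; [apply Rmin_pos; auto|]. intros z Hz.
  assert (Hz1 := Rlt_le_trans _ _ _ Hz (Rmin_l _ _)).
  assert (Hz2 := Rlt_le_trans _ _ _ Hz (Rmin_r _ _)).
  assert (H11 : Cmod (z1 - z1)%C < eta) by (rewrite Cmod_self_sub; auto).
  assert (C1 : forall t, a <= t <= b -> pcont (fun t => F (point z t) * k t)%C t).
  { intros; apply pcont_mult; auto using parametric_pcont_F. }
  assert (C2 : forall t, a <= t <= b -> pcont (fun t => F (point z1 t) * k t)%C t).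
  { intros; apply pcont_mult; auto using parametric_pcont_F. }
  assert (C3 : forall t, a <= t <= b -> pcont (fun t => f (point z1 t) * e t * k t)%C t).
  { intros; repeat apply pcont_mult; auto using parametric_pcont_f. }
  change (Cmod (cint (fun t => F (point z t) * k t)%C a b -
    cint (fun t => F (point z1 t) * k t)%C a b -
    cint (fun t => f (point z1 t) * e t * k t)%C a b * (z - z1))%C <= eps * Cmod (z - z1)%C).
  rewrite (Cmult_comm (cint _ a b) (z - z1)%C).
  rewrite <- cint_scal, <- !cint_minus; auto.
  2:{ intros; apply pcont_minus; auto. }
  2:{ intros t Ht. apply pcont_mult; auto using pcont_const. }
  eapply Rle_trans.
  - apply cint_bound with (M := m * Cmod (z - z1)%C); auto.
    + intros. apply pcont_minus; [apply pcont_minus; auto|].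
      apply pcont_mult; auto using pcont_const.
    + intros t Ht.
      replace (F (point z t) * k t - F (point z1 t) * k t -
         (z - z1) * (f (point z1 t) * e t * k t))%C
        with ((F (point z t) - F (point z1 t) - f (point z1 t) * ((z - z1) * e t)) * k t)%C by ring.
      rewrite Cmod_mult.
      assert (N := parametric_near z t Ht).
      assert (S : Cmod (F (point z t) - F (point z1 t) - f (point z1 t) * ((z - z1) * e t))%C
        <= m * Cmod (z - z1)%C).
      { set (p := point z1 t). set (q := point z t).
        assert (Eq : q = (p + (z - z1) * e t)%C) by apply parametric_shift.
        assert (In : forall s, 0 <= s <= 1 -> exists h, Cmod h < Rmin d eta /\
          seg_pt p q s = (p + h)%C).
        { intros s Hs. exists (RtoC s * ((z - z1) * e t))%C. split.
          - rewrite Cmod_mult, Cmod_R, Rabs_pos_eq by lra.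
            assert (P := Cmod_ge_0 ((z - z1) * e t)%C). nra.
          - unfold seg_pt. rewrite Eq; ring. }
        assert (SC : seg_cont f p q).
        { intros s Hs. destruct (In s Hs) as (h & Hh & ->). apply Hf; auto.
          eapply Rlt_le_trans; [exact Hh|apply Rmin_r]. }
        assert (E : segment_integral f p q = (F q - F p)%C).
        { apply seg_integral_FTC; auto. intros s Hs.
          destruct (In s Hs) as (h & Hh & ->). apply HF; auto.
          eapply Rlt_le_trans; [exact Hh|apply Rmin_r]. }
        eapply Rle_trans; [|apply Rmult_le_compat_l; [lra|exact N]].
        replace ((z - z1) * e t)%C with (q - p)%C by (rewrite Eq; ring). rewrite <- E.
        apply seg_integral_near_const; auto.
        intros s Hs. destruct (In s Hs) as (h & Hh & ->). left. apply T; auto.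
        eapply Rlt_le_trans; [exact Hh|apply Rmin_l]. }
      assert (P := Cmod_ge_0 (k t)). specialize (Hk1 t Ht).
      assert (P2 := Cmod_ge_0 (F (point z t) - F (point z1 t) - f (point z1 t) * ((z - z1) * e t))%C).
      nra.
  - assert (P := Cmod_ge_0 (z - z1)%C). nra.
Qed.

Lemma cint_parametric_ccont :
  ccont (fun z => cint (fun t => f (g t + z * e t) * k t)%C a b) z1.
Proof.
  intros eps Heps.
  destruct (small_cofactor (eps/2) (b - a)) as (m & Hm & Hm'); [lra|lra|].
  destruct (parametric_tube m Hm) as (d & Hd & T).
  exists (Rmin d eta); split; [apply Rmin_pos; auto|]. intros z Hz.
  assert (Hz1 := Rlt_le_trans _ _ _ Hz (Rmin_l _ _)).
  assert (Hz2 := Rlt_le_trans _ _ _ Hz (Rmin_r _ _)).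
  assert (H11 : Cmod (z1 - z1)%C < eta) by (rewrite Cmod_self_sub; auto).
  assert (C1 : forall t, a <= t <= b -> pcont (fun t => f (point z t) * k t)%C t).
  { intros; apply pcont_mult; auto using parametric_pcont_f. }
  assert (C2 : forall t, a <= t <= b -> pcont (fun t => f (point z1 t) * k t)%C t).
  { intros; apply pcont_mult; auto using parametric_pcont_f. }
  change (Cmod (cint (fun t => f (point z t) * k t)%C a b -
    cint (fun t => f (point z1 t) * k t)%C a b)%C < eps).
  rewrite <- cint_minus; auto.
  eapply Rle_lt_trans; [|apply (Rle_lt_trans _ _ _ Hm'); lra].
  apply cint_bound; auto.
  - intros; apply pcont_minus; auto.
  - intros t Ht.
    replace (f (point z t) * k t - f (point z1 t) * k t)%C
      with ((f (point z t) - f (point z1 t)) * k t)%C by ring.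
    rewrite Cmod_mult, parametric_shift.
    assert (N := parametric_near z t Ht).
    assert (S := T t ((z - z1) * e t)%C Ht ltac:(lra)).
    assert (P := Cmod_ge_0 (k t)). specialize (Hk1 t Ht).
    assert (P2 := Cmod_ge_0 (f (point z1 t + (z - z1) * e t)%C - f (point z1 t))%C).
    nra.
Qed.

End Parametric.

(** The point of argument [t] on the unit circle. *)
Definition cis (t : R) : C := (cos t, sin t).

Lemma Cmod_cis t : Cmod (cis t) = 1.
Proof.
  assert (H := Cmod_sqr (cis t)). simpl in H.
  assert (H2 := sin2_cos2 t). unfold Rsqr in H2. assert (H3 := Cmod_ge_0 (cis t)).
  nra.
Qed.

Lemma cis_mul_opp t : (cis t * cis (- t))%C = RtoC 1.
Proof.
  unfold cis, Cmult, RtoC; simpl. rewrite cos_neg, sin_neg.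
  assert (H2 := sin2_cos2 t). unfold Rsqr in H2. f_equal; lra.
Qed.

Lemma cis_0 : cis 0 = RtoC 1.
Proof. unfold cis; rewrite cos_0, sin_0; reflexivity. Qed.

Lemma cis_2PI : cis (2 * PI) = RtoC 1.
Proof. unfold cis; rewrite cos_2PI, sin_2PI; reflexivity. Qed.

Lemma cis_opp_2PI : cis (- (2 * PI)) = RtoC 1.
Proof. unfold cis; rewrite cos_neg, sin_neg, cos_2PI, sin_2PI, Ropp_0; reflexivity. Qed.

Lemma pderiv_cis t : pderiv cis t (Ci * cis t)%C.
Proof.
  apply pderiv_pair; simpl.
  - evar_last; [apply is_derive_Reals, derivable_pt_lim_cos|]. ring.
  - evar_last; [apply is_derive_Reals, derivable_pt_lim_sin|]. ring.
Qed.

Lemma pderiv_cis_opp t : pderiv (fun s => cis (- s)) t (- Ci * cis (- t))%C.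
Proof.
  apply pderiv_pair; simpl; auto_derive; auto; ring.
Qed.

Lemma pcont_cis t : pcont cis t.
Proof. eapply pderiv_pcont, pderiv_cis. Qed.

Lemma pcont_cis_opp t : pcont (fun s => cis (- s)) t.
Proof. eapply pderiv_pcont, pderiv_cis_opp. Qed.

Lemma two_PI_pos : 0 < 2 * PI.
Proof. assert (H := PI_RGT_0); lra. Qed.

(** Integral of [f] over the circle of centre [z] through [z + w], against the
    angular density [k]. *)
Definition circle_int (f : C -> C) (k : R -> C) (z w : C) : C :=
  cint (fun t => f (z + w * cis t) * k t)%C 0 (2 * PI).

(** On the disc of centre [z0] and radius [r], [f] is the derivative of [F] and is continuous. *)
Definition C1_derivative (F f : C -> C) (z0 : C) (r : R) : Prop :=
  forall z, disc z0 r z -> cderiv F z (f z) /\ ccont f z.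

Lemma C1_derivative_sub F f z0 r z : C1_derivative F f z0 r ->
  C1_derivative F f z (r - Cmod (z - z0)%C).
Proof.
  intros H w Hw. apply H. unfold disc in *.
  assert (T := Cmod_sub_triangle w z z0). lra.
Qed.

Lemma circle_in_disc z0 r w t h : Cmod h < r - Cmod w ->
  disc z0 r (z0 + w * cis t + h)%C.
Proof.
  intros H. unfold disc. replace (z0 + w * cis t + h - z0)%C with (w * cis t + h)%C by ring.
  eapply Rle_lt_trans; [apply Cmod_triangle|]. rewrite Cmod_mult, Cmod_cis. lra.
Qed.

Lemma circle_in_disc' z0 r w t : Cmod w < r -> disc z0 r (z0 + w * cis t)%C.
Proof.
  intros H. replace (z0 + w * cis t)%C with (z0 + w * cis t + RtoC 0)%C by ring.
  apply circle_in_disc. rewrite Cmod_0; lra.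
Qed.

Lemma pcont_circle z w t : pcont (fun t => z + w * cis t)%C t.
Proof.
  apply pcont_plus; [apply pcont_const|]. apply pcont_mult; auto using pcont_const, pcont_cis.
Qed.

Lemma pderiv_circle z w t : pderiv (fun t => z + w * cis t)%C t (w * Ci * cis t)%C.
Proof.
  intros eps Heps.
  destruct (pderiv_mult _ _ t _ _ (pderiv_line w (RtoC 0) t) (pderiv_cis t) eps Heps)
    as (d & Hd & H').
  exists d; split; auto. intros s Hs. specialize (H' s Hs).
  eapply Rle_trans; [|exact H']. right; f_equal; ring.
Qed.

Section Circle.

Variables (F f : C -> C) (z0 : C) (r : R).
Hypothesis HF : C1_derivative F f z0 r.

Lemma circle_pcont_f w : Cmod w < r -> forall t, pcont (fun t => f (z0 + w * cis t)%C) t.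
Proof.
  intros Hw t. apply (ccont_pcont f (fun t => (z0 + w * cis t)%C)); [|apply pcont_circle].
  apply HF, circle_in_disc'; auto.
Qed.

Lemma circle_pcont_F w : Cmod w < r -> forall t, pcont (fun t => F (z0 + w * cis t)%C) t.
Proof.
  intros Hw t. apply (ccont_pcont F (fun t => (z0 + w * cis t)%C)); [|apply pcont_circle].
  eapply cderiv_ccont. apply HF, circle_in_disc'; auto.
Qed.

Lemma circle_pderiv_F w : Cmod w < r -> forall t,
  pderiv (fun t => F (z0 + w * cis t)%C) t (f (z0 + w * cis t) * (w * Ci * cis t))%C.
Proof.
  intros Hw t. apply (pderiv_comp F (fun t => (z0 + w * cis t)%C)); [|apply pderiv_circle].
  apply HF, circle_in_disc'; auto.
Qed.

Lemma cint_cis : cint cis 0 (2 * PI) = RtoC 0.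
Proof.
  assert (P := two_PI_pos).
  assert (E : cint (fun t => Ci * cis t)%C 0 (2 * PI) = RtoC 0).
  { rewrite (cint_FTC cis); [|lra| |].
    - rewrite cis_0, cis_2PI; ring.
    - intros; apply pderiv_cis.
    - intros; apply pcont_mult; auto using pcont_const, pcont_cis. }
  rewrite cint_scal in E; [|lra|intros; apply pcont_cis].
  replace (cint cis 0 (2 * PI)) with (- Ci * (Ci * cint cis 0 (2 * PI)))%C.
  - rewrite E; ring.
  - replace (- Ci * (Ci * cint cis 0 (2 * PI)))%C with (- (Ci * Ci) * cint cis 0 (2 * PI))%C by ring.
    replace (Ci * Ci)%C with (- RtoC 1)%C; [ring|].
    unfold Ci, Cmult, Copp, RtoC; simpl; f_equal; ring.
Qed.

(** Up to the factor [w * Ci] this is the integral of [f dz] along the circle, which vanishes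
    because [f] has the primitive [F]. *)
Lemma circle_int_closed w : Cmod w < r -> circle_int f cis z0 w = RtoC 0.
Proof.
  intros Hw. assert (P := two_PI_pos). unfold circle_int.
  destruct (Ceq_dec w (RtoC 0)) as [->|N].
  - transitivity (cint (fun t => f z0 * cis t)%C 0 (2 * PI)).
    + apply cint_ext; [lra|]. intros t _. replace (z0 + 0 * cis t)%C with z0 by ring. reflexivity.
    + rewrite cint_scal; [|lra|intros; apply pcont_cis]. rewrite cint_cis. ring.
  - assert (E : cint (fun t => (w * Ci) * (f (z0 + w * cis t) * cis t))%C 0 (2 * PI) = RtoC 0).
    { transitivity (cint (fun t => f (z0 + w * cis t) * (w * Ci * cis t))%C 0 (2 * PI)).
      - apply cint_ext; [lra|]. intros; ring.
      - rewrite (cint_FTC (fun t => F (z0 + w * cis t)%C)); [|lra| |].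
        + rewrite cis_0, cis_2PI; ring.
        + intros; apply circle_pderiv_F; auto.
        + intros; apply pcont_mult; [apply circle_pcont_f; auto|].
          apply pcont_mult; auto using pcont_const, pcont_cis. }
    rewrite cint_scal in E; [|lra|].
    2:{ intros; apply pcont_mult; auto using circle_pcont_f, pcont_cis. }
    apply NNPP. intros H. revert E. apply Cmult_neq_0; auto.
    apply Cmult_neq_0; auto. apply Ci_nz.
Qed.

Lemma circle_mean_F_deriv w : Cmod w < r ->
  cderiv (circle_int F (fun _ => RtoC 1) z0) w (RtoC 0).
Proof.
  intros Hw. assert (P := two_PI_pos).
  rewrite <- (circle_int_closed w Hw). unfold circle_int.
  replace (cint (fun t => f (z0 + w * cis t) * cis t)%C 0 (2 * PI))
    with (cint (fun t => f (z0 + w * cis t) * cis t * RtoC 1)%C 0 (2 * PI))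
    by (apply cint_ext; [lra|]; intros; ring).
  apply (cint_parametric_cderiv F f (fun _ => z0) cis (fun _ => RtoC 1) 0 (2 * PI) (r - Cmod w) w);
    try lra; intros.
  - apply HF, circle_in_disc; auto.
  - apply HF, circle_in_disc; auto.
  - apply pcont_const.
  - apply pcont_cis.
  - apply pcont_const.
  - rewrite Cmod_cis; lra.
  - rewrite Cmod_1; lra.
Qed.

(** Mean value property: averages over circles do not depend on the radius vector [w]. *)
Lemma circle_mean_F w : Cmod w < r ->
  circle_int F (fun _ => RtoC 1) z0 w = (RtoC (2 * PI) * F z0)%C.
Proof.
  intros Hw. assert (P := two_PI_pos).
  assert (H0 : circle_int F (fun _ => RtoC 1) z0 (RtoC 0) = (RtoC (2 * PI) * F z0)%C).
  { unfold circle_int. transitivity (cint (fun t => F z0) 0 (2 * PI)).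
    - apply cint_ext; [lra|]. intros t _. replace (z0 + 0 * cis t)%C with z0 by ring. ring.
    - unfold cint. apply C_ext; simpl; rewrite RInt_const; unfold scal; simpl; unfold mult; simpl;
        unfold Re, Im; ring. }
  rewrite <- H0.
  assert (C0 : seg_cont (fun _ => RtoC 0) (RtoC 0) w).
  { intros t _. apply ccont_const. }
  assert (E := seg_integral_FTC (circle_int F (fun _ => RtoC 1) z0) (fun _ => RtoC 0) (RtoC 0) w).
  assert (B := seg_integral_bound (fun _ => RtoC 0) (RtoC 0) w 0 C0).
  rewrite E in B; auto.
  - apply Ceq_minus, Cmod_eq_0. apply Rle_antisym; [|apply Cmod_ge_0].
    eapply Rle_trans; [apply B|lra]. intros; rewrite Cmod_0; lra.
  - intros t Ht. apply circle_mean_F_deriv.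
    unfold seg_pt. replace (0 + t * (w - 0))%C with (RtoC t * w)%C by ring.
    rewrite Cmod_mult, Cmod_R, Rabs_pos_eq by lra. assert (Q := Cmod_ge_0 w). nra.
Qed.

End Circle.

(** Mean value property for the derivative, by differentiating that of [F] with respect to
    the centre. *)
Lemma circle_mean_f F f z0 r w : C1_derivative F f z0 r -> Cmod w < r ->
  circle_int f (fun _ => RtoC 1) z0 w = (RtoC (2 * PI) * f z0)%C.
Proof.
  intros HF Hw. assert (P := two_PI_pos).
  apply (cderiv_unique (fun z => RtoC (2 * PI) * F z)%C z0).
  - apply (cderiv_local_ext (fun z => circle_int F (fun _ => RtoC 1) z w) _ _ _ (r - Cmod w)); [lra| |].
    + intros z Hz. apply circle_mean_F with f (r - Cmod (z - z0)%C); [|lra].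
      apply C1_derivative_sub; auto.
    + unfold circle_int.
      apply (cderiv_ext (fun z => cint (fun t => F (w * cis t + z * RtoC 1) * RtoC 1)%C 0 (2 * PI))).
      { intros z. apply cint_ext; [lra|]. intros. do 2 f_equal. ring. }
      replace (cint (fun t => f (z0 + w * cis t) * RtoC 1)%C 0 (2 * PI))
        with (cint (fun t => f (w * cis t + z0 * RtoC 1) * RtoC 1 * RtoC 1)%C 0 (2 * PI)).
      2:{ apply cint_ext; [lra|]. intros.
          replace (w * cis t + z0 * 1)%C with (z0 + w * cis t)%C by ring. ring. }
      apply (cint_parametric_cderiv F f (fun t => w * cis t)%C (fun _ => RtoC 1) (fun _ => RtoC 1)
               0 (2 * PI) (r - Cmod w) z0); try lra; intros;
        try (rewrite Cmod_1; lra); try apply pcont_const.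
      * replace (w * cis t + z0 * 1 + h)%C with (z0 + w * cis t + h)%C by ring.
        apply HF, circle_in_disc; auto.
      * replace (w * cis t + z0 * 1 + h)%C with (z0 + w * cis t + h)%C by ring.
        apply HF, circle_in_disc; auto.
      * apply pcont_mult; auto using pcont_const, pcont_cis.
  - apply cderiv_scal. apply HF, disc_center. assert (Q := Cmod_ge_0 w); lra.
Qed.

(** Cauchy's formula for the derivative at the centre of a circle; it comes from
    integrating the derivative of [F (z0 + w * cis t) * cis (- t)]. *)
Lemma cauchy_derivative F f z0 r w : C1_derivative F f z0 r -> Cmod w < r ->
  circle_int F (fun t => cis (- t)) z0 w = (w * RtoC (2 * PI) * f z0)%C.
Proof.
  intros HF Hw. assert (P := two_PI_pos).
  assert (CF := circle_pcont_F F f z0 r HF w Hw).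
  assert (Cf := circle_pcont_f F f z0 r HF w Hw).
  assert (A1 : forall t, pcont (fun t => f (z0 + w * cis t) * RtoC 1)%C t)
    by (intros; apply pcont_mult; auto using pcont_const).
  assert (A2 : forall t, pcont (fun t => F (z0 + w * cis t) * cis (- t))%C t)
    by (intros; apply pcont_mult; auto using pcont_cis_opp).
  assert (E : cint (fun t => w * Ci * (f (z0 + w * cis t) * RtoC 1)
     - Ci * (F (z0 + w * cis t) * cis (- t)))%C 0 (2 * PI) = RtoC 0).
  { transitivity (cint (fun t => f (z0 + w * cis t) * (w * Ci * cis t) * cis (- t)
      + F (z0 + w * cis t) * (- Ci * cis (- t)))%C 0 (2 * PI)).
    - apply cint_ext; [lra|]. intros t _.
      replace (f (z0 + w * cis t) * (w * Ci * cis t) * cis (- t))%C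
        with (f (z0 + w * cis t) * (w * Ci) * (cis t * cis (- t)))%C by ring.
      rewrite cis_mul_opp. ring.
    - rewrite (cint_FTC (fun t => F (z0 + w * cis t) * cis (- t))%C); [|lra| |].
      + rewrite Ropp_0, cis_0, cis_2PI, cis_opp_2PI. ring.
      + intros t _. apply (pderiv_mult (fun t => F (z0 + w * cis t)%C) (fun t => cis (- t))).
        * apply (circle_pderiv_F F f z0 r HF w Hw).
        * apply pderiv_cis_opp.
      + intros t _. apply pcont_plus; repeat apply pcont_mult;
          auto using pcont_const, pcont_cis, pcont_cis_opp. }
  rewrite cint_minus, !cint_scal in E; auto; try lra;
    try (intros; apply pcont_mult; auto using pcont_const).
  change (w * Ci * circle_int f (fun _ => RtoC 1) z0 w -
    Ci * circle_int F (fun t => cis (- t)) z0 w = RtoC 0)%C in E.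
  rewrite (circle_mean_f F f z0 r w HF Hw) in E.
  apply Ceq_minus. apply NNPP. intros N.
  apply (Cmult_neq_0 _ _ Ci_nz N). rewrite <- (Copp_0), <- E. ring.
Qed.

(** Near [z], Cauchy's formula holds with one and the same radius vector [w], so that both
    sides are functions of the centre. *)
Lemma cauchy_derivative_nearby F f z0 r z : C1_derivative F f z0 r -> disc z0 r z ->
  exists w : C, w <> RtoC 0 /\ 0 < Cmod w /\ 2 * Cmod w < r - Cmod (z - z0)%C /\
  (forall z', Cmod (z' - z)%C < Cmod w -> f z' =
    (/ (w * RtoC (2 * PI)) * cint (fun t => F (w * cis t + z' * RtoC 1) * cis (- t)) 0 (2 * PI))%C).
Proof.
  intros HF Hz. unfold disc in Hz. assert (P := two_PI_pos).
  set (d := (r - Cmod (z - z0)%C) / 3). assert (Hd : 0 < d) by (unfold d; lra).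
  assert (Nd : RtoC d <> RtoC 0) by (intros H; apply RtoC_inj in H; lra).
  assert (NP : RtoC (2 * PI) <> RtoC 0) by (intros H; apply RtoC_inj in H; lra).
  exists (RtoC d). rewrite Cmod_R, Rabs_pos_eq by lra.
  repeat split; auto; [unfold d; lra|].
  intros z' Hz'.
  assert (T := Cmod_sub_triangle z' z z0).
  assert (E := cauchy_derivative F f z' (r - Cmod (z' - z0)%C) (RtoC d)
    (C1_derivative_sub _ _ _ _ z' HF)).
  rewrite Cmod_R, Rabs_pos_eq in E by lra.
  replace (cint (fun t => F (d * cis t + z' * RtoC 1) * cis (- t))%C 0 (2 * PI))
    with (circle_int F (fun t => cis (- t)) z' (RtoC d)).
  - rewrite E by (unfold d in *; lra). field; auto.
  - unfold circle_int. apply cint_ext; [lra|]. intros. do 2 f_equal. ring.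
Qed.

(** Differentiating Cauchy's formula for [f] under the integral sign. *)
Lemma cderiv_of_C1_derivative F f z0 r z : C1_derivative F f z0 r -> disc z0 r z ->
  exists w : C, w <> RtoC 0 /\ 2 * Cmod w < r - Cmod (z - z0)%C /\
  forall z', Cmod (z' - z)%C < Cmod w -> cderiv f z'
    (/ (w * RtoC (2 * PI)) * cint (fun t => f (w * cis t + z' * RtoC 1) * RtoC 1 * cis (- t)) 0 (2 * PI))%C.
Proof.
  intros HF Hz. assert (P := two_PI_pos).
  destruct (cauchy_derivative_nearby F f z0 r z HF Hz) as (w & Nw & Pw & Hw & E).
  exists w. repeat split; auto. intros z' Hz'.
  assert (T := Cmod_sub_triangle z' z z0).
  eapply (cderiv_local_ext _ f z' _ (Cmod w - Cmod (z' - z)%C)); [lra| |].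
  { intros v Hv. symmetry. apply E. assert (T2 := Cmod_sub_triangle v z' z). lra. }
  apply cderiv_scal.
  apply (cint_parametric_cderiv F f (fun t => w * cis t)%C (fun _ => RtoC 1) (fun t => cis (- t))
           0 (2 * PI) (r - Cmod (z' - z0)%C - Cmod w) z'); try lra; intros;
    try (rewrite Cmod_1; lra); try apply pcont_const.
  - replace (w * cis t + z' * 1 + h)%C with (z' + w * cis t + h)%C by ring.
    apply (C1_derivative_sub _ _ _ _ z' HF), circle_in_disc; auto.
  - replace (w * cis t + z' * 1 + h)%C with (z' + w * cis t + h)%C by ring.
    apply (C1_derivative_sub _ _ _ _ z' HF), circle_in_disc; auto.
  - apply pcont_mult; auto using pcont_const, pcont_cis.
  - apply pcont_cis_opp.
  - rewrite Cmod_cis; lra.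
Qed.

(** The derivative of a holomorphic function is continuous. *)
Lemma holomorphic_C1 f f' z0 r :
  (forall z, disc z0 r z -> cderiv f z (f' z)) -> C1_derivative f f' z0 r.
Proof.
  intros Hf z Hz. split; auto. assert (P := two_PI_pos).
  assert (HF : C1_derivative (segment_integral f z0) f z0 r).
  { intros v Hv. split.
    - apply segment_integral_primitive with r; auto. intros; eexists; apply Hf; auto.
    - eapply cderiv_ccont, Hf; auto. }
  destruct (cderiv_of_C1_derivative _ f z0 r z HF Hz) as (w & Nw & Hw & E).
  assert (Pw := proj1 (Cmod_gt_0 w) Nw).
  apply (ccont_local_ext (fun z' => / (w * RtoC (2 * PI)) *
     cint (fun t => f (w * cis t + z' * RtoC 1) * (RtoC 1 * cis (- t))) 0 (2 * PI))%C _ _ (Cmod w)); auto.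
  - intros v Hv. specialize (E v Hv).
    apply (cderiv_unique f v); [|apply Hf; unfold disc].
    + replace (cint (fun t => f (w * cis t + v * RtoC 1) * (RtoC 1 * cis (- t)))%C 0 (2 * PI))
        with (cint (fun t => f (w * cis t + v * RtoC 1) * RtoC 1 * cis (- t))%C 0 (2 * PI)); auto.
      apply cint_ext; [lra|]. intros; ring.
    + assert (T := Cmod_sub_triangle v z z0). lra.
  - apply ccont_scal.
    apply (cint_parametric_ccont f (fun t => w * cis t)%C (fun _ => RtoC 1)
       (fun t => RtoC 1 * cis (- t))%C 0 (2 * PI) (r - Cmod (z - z0)%C - Cmod w) z); try lra; intros;
    try (rewrite Cmod_1; lra); try apply pcont_const.
    + replace (w * cis t + z * 1 + h)%C with (z + w * cis t + h)%C by ring.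
      apply (C1_derivative_sub _ _ _ _ z HF), circle_in_disc; auto.
    + apply pcont_mult; auto using pcont_const, pcont_cis.
    + apply pcont_mult; auto using pcont_const, pcont_cis_opp.
    + rewrite Cmod_mult, Cmod_cis, Cmod_1; lra.
Qed.

(** The derivative of a holomorphic function is holomorphic. *)
Lemma holomorphic_derivative f f' z0 r :
  (forall z, disc z0 r z -> cderiv f z (f' z)) ->
  forall z, disc z0 r z -> exists l, cderiv f' z l.
Proof.
  intros Hf z Hz.
  destruct (cderiv_of_C1_derivative f f' z0 r z (holomorphic_C1 f f' z0 r Hf) Hz)
    as (w & Nw & Hw & E).
  eexists. apply E. rewrite Cmod_self_sub. apply Cmod_gt_0; auto.
Qed.

(** Cauchy's estimate. *)
Lemma cauchy_estimate f f' z0 r M t :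
  (forall z, disc z0 r z -> cderiv f z (f' z)) ->
  (forall z, disc z0 r z -> Cmod (f z) <= M) -> 0 <= t < r -> t * Cmod (f' z0) <= M.
Proof.
  intros Hf HM Ht. assert (P := two_PI_pos).
  assert (HF := holomorphic_C1 f f' z0 r Hf).
  assert (Ht' : Cmod (RtoC t) < r) by (rewrite Cmod_R, Rabs_pos_eq; lra).
  assert (E := cauchy_derivative f f' z0 r (RtoC t) HF Ht').
  assert (B : Cmod (circle_int f (fun s => cis (- s)) z0 (RtoC t)) <= M * (2 * PI - 0)).
  { apply cint_bound; [lra| |].
    - intros; apply pcont_mult; [apply (circle_pcont_F f f' z0 r HF); auto|apply pcont_cis_opp].
    - intros s _. rewrite Cmod_mult, Cmod_cis, Rmult_1_r. apply HM, circle_in_disc'; auto. }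
  rewrite E, !Cmod_mult, !Cmod_R, !Rabs_pos_eq in B by lra. nra.
Qed.

(** * Quantitative local inversion *)

(** If the derivative [s] of [f] is within [k] of [s0], then [f z - s0 * z] is [k]-Lipschitz. *)
Lemma derivative_near_const_increment f s z0 d s0 k :
  (forall z, disc z0 d z -> cderiv f z (s z)) ->
  (forall z, disc z0 d z -> Cmod (s z - s0)%C <= k) ->
  forall a b, disc z0 d a -> disc z0 d b ->
    Cmod (f b - f a - s0 * (b - a))%C <= k * Cmod (b - a)%C.
Proof.
  intros Hf Hs a b Ha Hb.
  assert (C1 := holomorphic_C1 f s z0 d Hf).
  assert (In : forall t, 0 <= t <= 1 -> disc z0 d (seg_pt a b t))
    by (intros; apply disc_convex; auto).
  assert (Sc : seg_cont s a b) by (intros t Ht; apply C1; auto).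
  replace (f b - f a)%C with (segment_integral s a b) by (apply seg_integral_FTC; auto).
  apply seg_integral_near_const; auto.
Qed.

(** Newton iteration with fixed slope [s0] is a contraction of ratio 1/2, and solves
    [f z = w]. *)
Lemma near_affine_surjective f z0 d s0 w : s0 <> RtoC 0 ->
  (forall a b, disc z0 d a -> disc z0 d b ->
    Cmod (f b - f a - s0 * (b - a))%C <= Cmod s0 / 2 * Cmod (b - a)%C) ->
  Cmod (w - f z0)%C < Cmod s0 * d / 2 -> exists z, disc z0 d z /\ f z = w.
Proof.
  intros Ns Hf Hw. assert (Ps := proj1 (Cmod_gt_0 s0) Ns).
  assert (Pw := Cmod_ge_0 (w - f z0)%C).
  set (q := Cmod (w - f z0)%C / Cmod s0).
  assert (Hq0 : 0 <= q) by (apply Rdiv_le_0_compat; auto).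
  assert (Hqs : q * Cmod s0 = Cmod (w - f z0)%C) by (unfold q; field; lra).
  assert (Hq : 2 * q < d) by nra.
  set (T := fun z => (z - (f z - w) / s0)%C).
  assert (HT : forall a b, disc z0 d a -> disc z0 d b ->
     Cmod (T b - T a)%C <= 1/2 * Cmod (b - a)%C).
  { intros a b Ha Hb. specialize (Hf a b Ha Hb). unfold T.
    replace (b - (f b - w) / s0 - (a - (f a - w) / s0))%C
      with (- ((f b - f a - s0 * (b - a)) / s0))%C by (field; auto).
    rewrite Cmod_opp, Cmod_div by auto.
    apply (Rmult_le_reg_r (Cmod s0)); auto.
    replace (Cmod (f b - f a - s0 * (b - a))%C / Cmod s0 * Cmod s0)
      with (Cmod (f b - f a - s0 * (b - a))%C) by (field; lra). lra. }
  set (u := fun n => Nat.iter n T z0).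
  assert (Hu : forall n, Cmod (u n - z0)%C <= 2 * q * (1 - (1/2)^n) /\
     Cmod (u (S n) - u n)%C <= q * (1/2)^n).
  { induction n as [|n [I1 I2]].
    - change (u 0%nat) with z0. rewrite Cmod_self_sub. change (u 1%nat) with (T z0).
      simpl. split; [lra|]. unfold T.
      replace (z0 - (f z0 - w) / s0 - z0)%C with ((w - f z0) / s0)%C by (field; auto).
      rewrite Cmod_div by auto. fold q. lra.
    - assert (Hn := half_pow_pos n).
      assert (J : Cmod (u (S n) - z0)%C <= 2 * q * (1 - (1 / 2) ^ S n)).
      { eapply Rle_trans; [apply (Cmod_sub_triangle _ (u n))|].
        change ((1/2) ^ S n) with (1/2 * (1/2)^n). lra. }
      split; [exact J|].
      change (u (S (S n))) with (T (u (S n))). change (u (S n)) with (T (u n)) at 2.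
      eapply Rle_trans; [apply HT|].
      + unfold disc. nra.
      + unfold disc. assert (Hn' := half_pow_pos (S n)). nra.
      + change ((1/2) ^ S n) with (1/2 * (1/2)^n). lra. }
  destruct (geometric_limit u q (fun n => proj2 (Hu n))) as (p & Hp).
  assert (Dp : Cmod (p - z0)%C <= 2 * q).
  { apply Rnot_lt_le. intros Hlt.
    destruct (half_pow_small (4 * q) (Cmod (p - z0)%C - 2 * q)) as (N & HN); [lra|].
    specialize (HN N (Nat.le_refl N)). specialize (Hp N). destruct (Hu N) as (I1 & _).
    assert (Tr := Cmod_sub_triangle p (u N) z0). rewrite (Cmod_sub_sym p (u N)) in Tr.
    assert (Hn := half_pow_pos N). nra. }
  exists p. split; [unfold disc; lra|].
  apply Ceq_minus, Cmod_eq_0. apply Rle_antisym; [|apply Cmod_ge_0].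
  apply Rnot_lt_le. intros Hlt.
  (* [6 q |s0| (1/2)^N] bounds [|f p - f (u N)|], as [f] has Lipschitz constant [3/2 |s0|] and
     [|u N - p| <= 4 q (1/2)^N]; [q |s0| (1/2)^N] bounds [|f (u N) - w|]. *)
  destruct (half_pow_small (7 * (q * Cmod s0)) (Cmod (f p - w)%C)) as (N & HN); [lra|].
  specialize (HN N (Nat.le_refl N)). specialize (Hp N). destruct (Hu N) as (I1 & I2).
  assert (Hn := half_pow_pos N).
  assert (DN : disc z0 d (u N)) by (unfold disc; nra).
  specialize (Hf (u N) p DN ltac:(unfold disc; lra)).
  change (u (S N)) with (T (u N)) in I2. unfold T in I2.
  replace (u N - (f (u N) - w) / s0 - u N)%C with (- ((f (u N) - w) / s0))%C in I2 by (field; auto).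
  rewrite Cmod_opp, Cmod_div in I2 by auto.
  assert (I3 : Cmod (f (u N) - w)%C <= q * (1/2)^N * Cmod s0).
  { apply (Rmult_le_compat_r (Cmod s0)) in I2; [|lra].
    replace (Cmod (f (u N) - w)%C / Cmod s0 * Cmod s0) with (Cmod (f (u N) - w)%C) in I2
      by (field; lra). exact I2. }
  assert (Tr : Cmod (f p - w)%C <= Cmod (f p - f (u N) - s0 * (p - u N))%C +
     Cmod s0 * Cmod (p - u N)%C + Cmod (f (u N) - w)%C).
  { replace (f p - w)%C with ((f p - f (u N) - s0 * (p - u N)) + s0 * (p - u N) + (f (u N) - w))%C
      by ring.
    eapply Rle_trans; [apply Cmod_triangle|]. apply Rplus_le_compat_r.
    eapply Rle_trans; [apply Cmod_triangle|]. rewrite Cmod_mult; lra. }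
  rewrite (Cmod_sub_sym p (u N)) in *.
  assert (Cmod s0 * Cmod (u N - p)%C <= Cmod s0 * (4 * q * (1/2)^N))
    by (apply Rmult_le_compat_l; lra).
  lra.
Qed.

(** Derivative of a Lipschitz local right inverse. *)
Lemma cderiv_inverse f g w l K d : 0 < d -> 0 <= K -> l <> RtoC 0 ->
  cderiv f (g w) l ->
  (forall v, Cmod (v - w)%C < d -> f (g v) = v /\ Cmod (g v - g w)%C <= K * Cmod (v - w)%C) ->
  cderiv g w (/ l)%C.
Proof.
  intros Hd HK Nl Hf Hg eps Heps. assert (Pl := proj1 (Cmod_gt_0 l) Nl).
  destruct (small_cofactor (eps * Cmod l) K) as (e & He & He'); [nra|auto|].
  destruct (Hf e He) as (d1 & Hd1 & H1).
  destruct (small_cofactor (d1 / 2) K) as (d2 & Hd2 & Hd2'); [lra|auto|].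
  exists (Rmin d d2); split; [apply Rmin_pos; auto|]. intros v Hv.
  assert (Hv1 := Rlt_le_trans _ _ _ Hv (Rmin_l _ _)).
  assert (Hv2 := Rlt_le_trans _ _ _ Hv (Rmin_r _ _)).
  destruct (Hg v Hv1) as (E1 & L1).
  destruct (Hg w) as (E2 & _); [rewrite Cmod_self_sub; auto|].
  assert (P := Cmod_ge_0 (v - w)%C).
  assert (Sm : Cmod (g v - g w)%C < d1).
  { eapply Rle_lt_trans; [exact L1|].
    assert (K * Cmod (v - w)%C <= K * d2) by (apply Rmult_le_compat_l; lra). lra. }
  specialize (H1 (g v) Sm). rewrite E1, E2 in H1.
  replace (g v - g w - / l * (v - w))%C with (- ((v - w - l * (g v - g w)) / l))%C by (field; auto).
  rewrite Cmod_opp, Cmod_div by auto.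
  apply (Rmult_le_reg_r (Cmod l)); auto.
  replace (Cmod (v - w - l * (g v - g w))%C / Cmod l * Cmod l)
    with (Cmod (v - w - l * (g v - g w))%C) by (field; lra).
  assert (e * Cmod (g v - g w)%C <= e * (K * Cmod (v - w)%C)) by (apply Rmult_le_compat_l; lra).
  assert (e * K * Cmod (v - w)%C <= eps * Cmod l * Cmod (v - w)%C)
    by (apply Rmult_le_compat_r; lra).
  lra.
Qed.

(** If the derivative [s] of [f] stays within [|s0| / 2] of a constant [s0], then [f] has a
    holomorphic inverse on a disc of radius proportional to [|s0|]. *)
Lemma local_inverse f s z0 d s0 : s0 <> RtoC 0 ->
  (forall z, disc z0 d z -> cderiv f z (s z)) ->
  (forall z, disc z0 d z -> Cmod (s z - s0)%C <= Cmod s0 / 2) ->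
  exists g : C -> C,
    (forall w, disc (f z0) (Cmod s0 * d / 2) w ->
       disc z0 d (g w) /\ f (g w) = w /\ exists l, cderiv g w l) /\
    (forall z, disc z0 d z -> disc (f z0) (Cmod s0 * d / 2) (f z) -> g (f z) = z).
Proof.
  intros Ns Hf Hs. assert (Ps := proj1 (Cmod_gt_0 s0) Ns).
  assert (HL := derivative_near_const_increment f s z0 d s0 _ Hf Hs).
  assert (Inj : forall a b, disc z0 d a -> disc z0 d b ->
     Cmod s0 / 2 * Cmod (b - a)%C <= Cmod (f b - f a)%C).
  { intros a b Ha Hb. specialize (HL a b Ha Hb).
    assert (T := Cmod_triangle_rev (s0 * (b - a))%C (s0 * (b - a) - (f b - f a))%C).
    rewrite Cmod_mult in T.
    replace (s0 * (b - a) - (s0 * (b - a) - (f b - f a)))%C with (f b - f a)%C in T by ring.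
    rewrite (Cmod_sub_sym (s0 * (b - a))%C) in T. lra. }
  set (g := fun w => epsilon (inhabits z0) (fun z => disc z0 d z /\ f z = w)).
  assert (Hg : forall w, disc (f z0) (Cmod s0 * d / 2) w -> disc z0 d (g w) /\ f (g w) = w).
  { intros w Hw. apply epsilon_spec. apply (near_affine_surjective f z0 d s0); auto. }
  exists g. split.
  - intros w Hw. destruct (Hg w Hw) as (G1 & G2). repeat split; auto.
    exists (/ s (g w))%C. unfold disc in Hw.
    apply (cderiv_inverse f g w (s (g w)) (2 / Cmod s0) (Cmod s0 * d / 2 - Cmod (w - f z0)%C)).
    + lra.
    + apply Rdiv_le_0_compat; lra.
    + intros E. specialize (Hs (g w) G1). rewrite E in Hs.
      replace (0 - s0)%C with (- s0)%C in Hs by ring. rewrite Cmod_opp in Hs. lra.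
    + auto.
    + intros v Hv. assert (T := Cmod_sub_triangle v w (f z0)).
      destruct (Hg v) as (G3 & G4); [unfold disc; lra|]. split; auto.
      specialize (Inj (g w) (g v) G1 G3). rewrite G2, G4 in Inj.
      apply (Rmult_le_reg_l (Cmod s0 / 2)); [lra|].
      replace (Cmod s0 / 2 * (2 / Cmod s0 * Cmod (v - w)%C)) with (Cmod (v - w)%C) by (field; lra).
      exact Inj.
  - intros z Hz Hfz. destruct (Hg (f z) Hfz) as (G1 & G2).
    specialize (Inj z (g (f z)) Hz G1). rewrite G2, Cmod_self_sub in Inj.
    apply Ceq_minus, Cmod_eq_0. assert (P := Cmod_ge_0 (g (f z) - z)%C). nra.
Qed.

(** * Square roots and the inverse of their primitive *)

Lemma csqrt_exists z : exists s, (s * s)%C = z.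
Proof.
  assert (H := Cmod_sqr z). assert (P := Cmod_ge_0 z).
  assert (Ax := Cmod_Re_le z). assert (L1 := Rle_abs (Re z)).
  assert (L2 := Rle_abs (- Re z)). rewrite Rabs_Ropp in L2.
  set (a := sqrt ((Cmod z + Re z) / 2)). set (b := sqrt ((Cmod z - Re z) / 2)).
  assert (Ha : a * a = (Cmod z + Re z) / 2) by (apply sqrt_sqrt; lra).
  assert (Hb : b * b = (Cmod z - Re z) / 2) by (apply sqrt_sqrt; lra).
  assert (Pa : 0 <= a) by apply sqrt_pos. assert (Pb : 0 <= b) by apply sqrt_pos.
  assert (Hab : (2 * a * b) * (2 * a * b) = Im z * Im z).
  { replace ((2 * a * b) * (2 * a * b)) with (4 * (a * a) * (b * b)) by ring.
    rewrite Ha, Hb. field_simplify. simpl. lra. }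
  assert (Q : 0 <= 2 * a * b) by nra.
  destruct (Rle_lt_dec 0 (Im z)) as [Hi|Hi].
  - exists (a, b). apply C_ext; simpl.
    + unfold Re in *. lra.
    + assert (2 * a * b = Im z) by nra. unfold Im in *. lra.
  - exists (a, - b). apply C_ext; simpl.
    + unfold Re in *. lra.
    + assert (2 * a * b = - Im z) by nra. unfold Im in *. lra.
Qed.

(** Principal square root; the formula is meaningful on the right half plane, where
    [Re z > 0] keeps the denominator away from zero. *)
Definition csqrt (z : C) : C :=
  let a := sqrt ((Cmod z + Re z) / 2) in (a, Im z / (2 * a)).

Lemma csqrt_Re_pos z : 0 < Re z -> 0 < Re (csqrt z).
Proof. intros H. simpl. apply sqrt_lt_R0. assert (P := Cmod_ge_0 z). lra. Qed.

Lemma csqrt_sqr z : 0 < Re z -> (csqrt z * csqrt z)%C = z.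
Proof.
  intros Hz. assert (P := csqrt_Re_pos z Hz). assert (H := Cmod_sqr z).
  unfold csqrt in *. simpl in P. set (a := sqrt ((Cmod z + Re z) / 2)) in *.
  assert (P2 := Cmod_ge_0 z).
  assert (Ha : a * a = (Cmod z + Re z) / 2) by (apply sqrt_sqrt; lra).
  apply C_ext; simpl.
  - apply (Rmult_eq_reg_r (4 * (a * a))); [|nra].
    replace ((a * a - Im z / (2 * a) * (Im z / (2 * a))) * (4 * (a * a)))
      with (4 * (a * a) * (a * a) - Im z * Im z) by (field; lra).
    rewrite Ha. change (fst z) with (Re z). nra.
  - unfold Im. field. lra.
Qed.

Lemma csqrt_cderiv z : 0 < Re z -> exists l, cderiv csqrt z l.
Proof.
  intros Hz. assert (P := csqrt_Re_pos z Hz). exists (/ (RtoC 2 * csqrt z))%C.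
  apply (cderiv_inverse (fun w => w * w)%C csqrt z _ (/ Re (csqrt z)) (Re z)); auto.
  - left; apply Rinv_0_lt_compat; auto.
  - apply Cmult_neq_0.
    + intros H; apply RtoC_inj in H; lra.
    + intros H. rewrite H in P. simpl in P; lra.
  - apply (cderiv_ext (fun w => RtoC 0 * w + RtoC 2 * w * w / RtoC 2)%C).
    + intros w. field.
    + replace (RtoC 2 * csqrt z)%C with (RtoC 0 + RtoC 2 * csqrt z)%C by ring.
      apply cderiv_quadratic.
  - intros v Hv.
    assert (Hv' : 0 < Re v).
    { assert (A := Cmod_Re_le (v - z)%C). rewrite Re_minus in A.
      assert (B := Rle_abs (- (Re v - Re z))). rewrite Rabs_Ropp in B. lra. }
    assert (P' := csqrt_Re_pos v Hv'). split; [apply csqrt_sqr; auto|].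
    assert (E : (v - z)%C = ((csqrt v - csqrt z) * (csqrt v + csqrt z))%C).
    { rewrite <- (csqrt_sqr v Hv') at 1. rewrite <- (csqrt_sqr z Hz) at 1. ring. }
    rewrite E at 1. rewrite Cmod_mult.
    assert (A := Cmod_Re_le (csqrt v + csqrt z)%C). rewrite Re_plus, Rabs_pos_eq in A by lra.
    assert (Q := Cmod_ge_0 (csqrt v - csqrt z)%C).
    apply (Rmult_le_reg_l (Re (csqrt z))); auto.
    replace (Re (csqrt z) * (/ Re (csqrt z) * (Cmod (csqrt v - csqrt z)%C * Cmod (csqrt v + csqrt z)%C)))
      with (Cmod (csqrt v - csqrt z)%C * Cmod (csqrt v + csqrt z)%C) by (field; lra).
    nra.
Qed.

Lemma csqrt_near_1 z : 0 < Re z -> Cmod (csqrt z - 1)%C <= Cmod (z - 1)%C.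
Proof.
  intros Hz. assert (P := csqrt_Re_pos z Hz).
  assert (E : (z - 1)%C = ((csqrt z - 1) * (csqrt z + 1))%C).
  { rewrite <- (csqrt_sqr z Hz) at 1. ring. }
  rewrite E, Cmod_mult.
  assert (A := Cmod_Re_le (csqrt z + 1)%C). rewrite Re_plus, re_RtoC, Rabs_pos_eq in A by lra.
  assert (Q := Cmod_ge_0 (csqrt z - 1)%C). nra.
Qed.

Lemma cderiv_comp F g z l d :
  cderiv F (g z) l -> cderiv g z d -> cderiv (fun w => F (g w)) z (l * d)%C.
Proof.
  intros HF Hg eps Heps.
  destruct (cderiv_lipschitz g z d Hg) as (d1 & Hd1 & L).
  assert (P1 := Cmod_ge_0 l). assert (P2 := Cmod_ge_0 d).
  destruct (small_cofactor (eps/2) (Cmod d + 1)) as (e & He & He'); [lra|lra|].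
  destruct (small_cofactor (eps/2) (Cmod l)) as (e2 & He2 & He2'); [lra|lra|].
  destruct (HF e He) as (d2 & Hd2 & H2).
  destruct (cderiv_ccont g z d Hg d2 Hd2) as (d3 & Hd3 & H3).
  destruct (Hg e2 He2) as (d4 & Hd4 & H4).
  exists (Rmin d1 (Rmin d3 d4)); split; [repeat apply Rmin_pos; auto|]. intros w Hw.
  assert (M1 := Rmin_l d1 (Rmin d3 d4)). assert (M2 := Rmin_r d1 (Rmin d3 d4)).
  assert (M3 := Rmin_l d3 d4). assert (M4 := Rmin_r d3 d4).
  specialize (L w ltac:(lra)). specialize (H3 w ltac:(lra)). specialize (H4 w ltac:(lra)).
  specialize (H2 _ H3).
  replace (F (g w) - F (g z) - l * d * (w - z))%C
    with ((F (g w) - F (g z) - l * (g w - g z)) + l * (g w - g z - d * (w - z)))%C by ring.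
  eapply Rle_trans; [apply Cmod_triangle|]. rewrite Cmod_mult.
  assert (P3 := Cmod_ge_0 (w - z)%C).
  assert (e * Cmod (g w - g z)%C <= e * ((Cmod d + 1) * Cmod (w - z)%C))
    by (apply Rmult_le_compat_l; lra).
  assert (Cmod l * Cmod (g w - g z - d * (w - z))%C <= Cmod l * (e2 * Cmod (w - z)%C))
    by (apply Rmult_le_compat_l; lra).
  assert (e * (Cmod d + 1) * Cmod (w - z)%C <= eps / 2 * Cmod (w - z)%C)
    by (apply Rmult_le_compat_r; lra).
  assert (e2 * Cmod l * Cmod (w - z)%C <= eps / 2 * Cmod (w - z)%C)
    by (apply Rmult_le_compat_r; lra).
  nra.
Qed.

Lemma locally_Cmod (z : C) (P : C -> Prop) :
  locally z P <-> exists d, 0 < d /\ forall w, Cmod (w - z)%C < d -> P w.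
Proof.
  split.
  - intros H. apply locally_C in H. destruct H as (d & Hd).
    exists d; split; [apply cond_pos|]. intros w Hw. apply Hd, Hw.
  - intros (d & Hd & H). apply locally_C. exists (mkposreal d Hd). intros w Hw. apply H, Hw.
Qed.

Lemma segment_integral_same f z : segment_integral f z z = RtoC 0.
Proof.
  rewrite seg_integral_cint.
  transitivity (cint (fun _ => RtoC 0) 0 1).
  - apply cint_ext; [lra|]. intros; ring.
  - apply C_ext; simpl; rewrite RInt_const; unfold scal; simpl; unfold mult; simpl; ring.
Qed.

(** If [phi] differs from [phi z0] by at most [|phi z0| / 2] on a disc, then a branch of its
    square root exists there and [local_inverse] inverts its primitive. *)
Lemma inverse_extends_of_near_const Omega phi z0 d : 0 < d ->
  (forall z, disc z0 d z -> Omega z) ->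
  (forall z, disc z0 d z -> exists l, cderiv phi z l) ->
  phi z0 <> RtoC 0 ->
  (forall z, disc z0 d z -> Cmod (phi z - phi z0)%C <= Cmod (phi z0) / 2) ->
  inverse_extends_to_disc Omega phi z0 (sqrt (Cmod (phi z0)) * d / 2).
Proof.
  intros Hd HO Hphi N Hn.
  destruct (csqrt_exists (phi z0)) as (s0 & Hs0).
  assert (P := proj1 (Cmod_gt_0 _) N).
  assert (Ns : s0 <> RtoC 0) by (intros E; apply N; rewrite <- Hs0, E; ring).
  assert (Ps := proj1 (Cmod_gt_0 _) Ns).
  assert (Es : Cmod s0 = sqrt (Cmod (phi z0))).
  { rewrite <- Hs0, Cmod_mult. symmetry. apply sqrt_square. lra. }
  set (q := fun z => (RtoC 0 + / phi z0 * phi z)%C).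
  assert (Q1 : forall z, disc z0 d z -> Cmod (q z - 1)%C <= 1/2).
  { intros z Hz. specialize (Hn z Hz). unfold q.
    replace (0 + / phi z0 * phi z - 1)%C with ((phi z - phi z0) / phi z0)%C by (field; auto).
    rewrite Cmod_div by auto. apply (Rmult_le_reg_r (Cmod (phi z0))); auto.
    replace (Cmod (phi z - phi z0)%C / Cmod (phi z0) * Cmod (phi z0))
      with (Cmod (phi z - phi z0)%C) by (field; lra). lra. }
  assert (Q2 : forall z, disc z0 d z -> 0 < Re (q z)).
  { intros z Hz. specialize (Q1 z Hz). assert (A := Cmod_Re_le (q z - 1)%C).
    rewrite Re_minus, re_RtoC in A. assert (B := Rle_abs (- (Re (q z) - 1))).
    rewrite Rabs_Ropp in B. lra. }
  set (s := fun z => (s0 * csqrt (q z))%C).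
  assert (Hs : forall z, disc z0 d z -> exists l, cderiv s z l).
  { intros z Hz. destruct (Hphi z Hz) as (l & Hl). destruct (csqrt_cderiv (q z) (Q2 z Hz)) as (m & Hm).
    eexists. apply cderiv_scal. apply (cderiv_comp csqrt q z m (/ phi z0 * l)%C); auto.
    unfold q. apply (cderiv_comp (fun w => RtoC 0 + / phi z0 * w)%C phi); auto.
    apply cderiv_affine. }
  set (f := segment_integral s z0).
  assert (Hf : forall z, disc z0 d z -> cderiv f z (s z)).
  { intros z Hz. apply segment_integral_primitive with d; auto. }
  assert (f0 : f z0 = RtoC 0) by apply segment_integral_same.
  destruct (local_inverse f s z0 d s0 Ns Hf) as (g & G1 & G2).
  { intros z Hz. unfold s. replace (s0 * csqrt (q z) - s0)%C with (s0 * (csqrt (q z) - 1))%C by ring.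
    rewrite Cmod_mult. assert (A := csqrt_near_1 (q z) (Q2 z Hz)). specialize (Q1 z Hz). nra. }
  rewrite f0, Es in *.
  exists d, s, g. split; [auto|]. split; [auto|]. split; [split|split].
  - apply holomorphic_cderiv; auto.
  - intros z Hz. unfold s.
    replace (s0 * csqrt (q z) * (s0 * csqrt (q z)))%C
      with ((s0 * s0) * (csqrt (q z) * csqrt (q z)))%C by ring.
    rewrite Hs0, csqrt_sqr by auto. unfold q. field; auto.
  - split; [|split].
    + apply holomorphic_cderiv. intros w Hw. apply G1; auto.
    + intros w Hw. apply HO, G1; auto.
    + exists f. split.
      * apply holomorphic_cderiv. intros z (w & Hw & <-). exists (s (g w)). apply Hf, G1; auto.
      * intros w Hw. apply G1; auto.
  - apply locally_Cmod.
    destruct (cderiv_ccont f z0 (s z0) (Hf z0 (disc_center _ _ Hd)) (sqrt (Cmod (phi z0)) * d / 2))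
      as (d' & Hd' & H').
    { rewrite <- Es. nra. }
    exists (Rmin d d'); split; [apply Rmin_pos; auto|]. intros w Hw.
    apply G2.
    + eapply Rlt_le_trans; [exact Hw|apply Rmin_l].
    + unfold disc. rewrite <- f0. apply H'. eapply Rlt_le_trans; [exact Hw|apply Rmin_r].
Qed.

(** * Maxima of continuous functions and second derivatives *)

Lemma continuous_C_epsilon (u : C -> R) (z : C) :
  continuous u z <->
  forall eps, 0 < eps -> exists del, 0 < del /\
    forall w, Cmod (w - z)%C < del -> Rabs (u w - u z) < eps.
Proof.
  split.
  - intros H eps Heps. apply locally_Cmod.
    exact (proj1 (filterlim_locally _ _) H (mkposreal eps Heps)).
  - intros H. apply filterlim_locally. intros eps.
    apply locally_Cmod. exact (H eps (cond_pos eps)).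
Qed.

Lemma ccont_continuous_comp (u : C -> R) (g : C -> C) z :
  ccont g z -> continuous u (g z) -> continuous (fun w => u (g w)) z.
Proof.
  intros Hg Hu. apply continuous_C_epsilon. intros eps Heps.
  destruct (proj1 (continuous_C_epsilon _ _) Hu eps Heps) as (d & Hd & H').
  destruct (Hg d Hd) as (d' & Hd' & H''). exists d'; split; auto.
Qed.

Lemma continuous_Cmod z : continuous Cmod z.
Proof.
  apply continuous_C_epsilon. intros eps Heps. exists eps; split; auto.
  intros w Hw. eapply Rle_lt_trans; [|exact Hw].
  apply Rabs_le. assert (A := Cmod_triangle_rev w z). assert (B := Cmod_triangle_rev z w).
  rewrite (Cmod_sub_sym z w) in B. lra.
Qed.

(** A continuous function attains its maximum on a closed disc.  Composing with
    [atan] makes the supremum finite without a separate boundedness argument. *)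
Lemma closed_disc_max (u : C -> R) r : 0 <= r ->
  (forall z, Cmod z <= r -> continuous u z) ->
  exists z1, Cmod z1 <= r /\ forall z, Cmod z <= r -> u z <= u z1.
Proof.
  intros Hr Hu. set (v := fun z => atan (u z)).
  assert (Hv : forall z, Cmod z <= r -> continuous v z).
  { intros z Hz. apply (continuous_comp u atan); [apply Hu; auto|].
    apply (ex_derive_continuous (K := R_AbsRing) (V := R_NormedModule)).
    eexists. apply is_derive_Reals, derivable_pt_lim_atan. }
  destruct (completeness (fun y => exists z, Cmod z <= r /\ y = v z)) as (S & HS1 & HS2).
  { exists (PI / 2). intros y (z & _ & ->). left. apply atan_bound. }
  { exists (v (RtoC 0)), (RtoC 0). rewrite Cmod_0. auto. }
  assert (HS : forall z, Cmod z <= r -> v z <= S) by (intros z Hz; apply HS1; eauto).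
  apply NNPP. intros Hno.
  assert (Hlt : forall z, Cmod z <= r -> v z < S).
  { intros z Hz. destruct (Rle_lt_or_eq_dec _ _ (HS z Hz)) as [|E]; auto.
    exfalso. apply Hno. exists z; split; auto. intros w Hw.
    apply Rnot_lt_le. intros Hl. apply atan_increasing in Hl. specialize (HS w Hw).
    fold (v w) in Hl. fold (v z) in Hl. lra. }
  (* If [S] is not attained, each point has a neighbourhood of some size [d] on which
     [v <= S - d]; a lower bound for these sizes improves the supremum. *)
  assert (L : forall p : R * R, exists d : posreal, forall w : C,
     Rabs (Re w - fst p) < d -> Rabs (Im w - snd p) < d -> Cmod w <= r -> v w <= S - d).
  { intros p. destruct (Rle_lt_dec (Cmod p) r) as [Hp|Hp].
    - assert (G := Hlt p Hp).
      destruct (proj1 (continuous_C_epsilon _ _) (Hv p Hp) ((S - v p) / 2)) as (d & Hd & H'); [lra|].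
      assert (Pm : 0 < Rmin (d / 2) ((S - v p) / 2)) by (apply Rmin_pos; lra).
      exists (mkposreal _ Pm). simpl. intros w W1 W2 _.
      assert (M1 := Rmin_l (d / 2) ((S - v p) / 2)). assert (M2 := Rmin_r (d / 2) ((S - v p) / 2)).
      assert (Dw : Cmod (w - p)%C < d).
      { eapply Rle_lt_trans; [apply Cmod_sum_le|]. rewrite Re_minus, Im_minus.
        unfold Re at 2, Im at 2. lra. }
      specialize (H' w Dw). assert (Q := Rle_abs (v w - v p)). lra.
    - assert (Pm : 0 < (Cmod p - r) / 2) by lra.
      exists (mkposreal _ Pm). simpl. intros w W1 W2 Hw.
      assert (Dw : Cmod (w - p)%C < Cmod p - r).
      { eapply Rle_lt_trans; [apply Cmod_sum_le|]. rewrite Re_minus, Im_minus.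
        unfold Re at 2, Im at 2. lra. }
      assert (T := Cmod_triangle_rev p w). rewrite (Cmod_sub_sym p w) in T. lra. }
  destruct (choice _ L) as (delta & Hdelta).
  destruct (compactness_value_2d (- r) r (- r) r (fun x y => delta (x, y))) as (d & Hd).
  assert (Pd := cond_pos d).
  assert (HS3 : S <= S - d); [|lra].
  apply HS2. intros y (z & Hz & ->).
  apply Rnot_lt_le. intros Hl.
  assert (A1 := Cmod_Re_le z). assert (A2 := Cmod_Im_le z).
  apply (Hd (Re z) (Im z)).
  - apply Rabs_le_between. lra.
  - apply Rabs_le_between. lra.
  - intros (x & y & _ & _ & W1 & W2 & W3).
    assert (K := Hdelta (x, y) z W1 W2 Hz). lra.
Qed.

(** Here [D] is the derivative of [L] near [0], and [m] the second derivative at [0]. *)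
Lemma second_derivative_test (L D : R -> R) eta m : 0 < eta ->
  (forall t, Rabs t < eta -> is_derive L t (D t) /\ L t <= L 0) ->
  is_derive D 0 m -> m <= 0.
Proof.
  intros Heta HL HD. apply Rnot_lt_le. intros Hm.
  assert (H00 : Rabs 0 < eta) by (rewrite Rabs_R0; auto).
  assert (D0 : D 0 = 0).
  { destruct (HL 0 H00) as (H0 & _).
    assert (Hmin : forall s, (s = 1 \/ s = -1) -> s * D 0 <= 0).
    { intros s Hs. apply Rnot_lt_le. intros Hp.
      destruct (proj1 (is_derive_epsilon _ _ _) H0 (s * D 0 / 2)) as (d & Hd & H'); [lra|].
      set (t := Rmin (d / 2) (eta / 2)).
      assert (Pt : 0 < t) by (apply Rmin_pos; lra).
      assert (T1 : t <= d / 2) by apply Rmin_l. assert (T2 : t <= eta / 2) by apply Rmin_r.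
      assert (As : Rabs (s * t) = t).
      { rewrite Rabs_mult, (Rabs_pos_eq t) by lra.
        destruct Hs as [-> | ->]; [rewrite Rabs_R1|rewrite Rabs_left by lra]; ring. }
      specialize (H' (s * t)). rewrite Rminus_0_r, As in H'. specialize (H' ltac:(lra)).
      destruct (HL (s * t)) as (_ & Le); [rewrite As; lra|].
      apply Rabs_le_between in H'. nra. }
    assert (B1 := Hmin 1 (or_introl eq_refl)). assert (B2 := Hmin (-1) (or_intror eq_refl)). lra. }
  destruct (proj1 (is_derive_epsilon _ _ _) HD (m / 2)) as (d & Hd & H'); [lra|].
  set (t := Rmin (d / 2) (eta / 2)).
  assert (Pt : 0 < t) by (apply Rmin_pos; lra).
  assert (T1 : t <= d / 2) by apply Rmin_l. assert (T2 : t <= eta / 2) by apply Rmin_r.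
  destruct (HL t) as (_ & Le); [rewrite Rabs_pos_eq; lra|].
  assert (Pos : forall x, 0 < x <= t -> 0 < D x).
  { intros x Hx. specialize (H' x). rewrite Rminus_0_r, D0, Rminus_0_r in H'.
    rewrite Rabs_pos_eq in H' at 1 by lra. specialize (H' ltac:(lra)).
    rewrite (Rabs_pos_eq x) in H' by lra. apply Rabs_le_between in H'. nra. }
  assert (MV : forall p q, 0 <= p -> p < q -> q <= t ->
     exists c, p <= c <= q /\ L q - L p = D c * (q - p)).
  { intros p q Hp Hpq Hq. destruct (MVT_gen L p q D) as (c & Hc & E).
    - rewrite Rmin_left, Rmax_right by lra. intros x Hx. apply HL. rewrite Rabs_pos_eq; lra.
    - rewrite Rmin_left, Rmax_right by lra. intros x Hx.
      apply continuity_pt_filterlim, (ex_derive_continuous (K := R_AbsRing) (V := R_NormedModule)).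
      eexists. apply HL. rewrite Rabs_pos_eq; lra.
    - rewrite Rmin_left, Rmax_right in Hc by lra. eauto. }
  (* [L] is nondecreasing on [0, t/2] and strictly increasing on [t/2, t]; the mean value
     point of the first interval may be [0], where [D] vanishes. *)
  destruct (MV (t / 2) t) as (c & Hc & E); try lra.
  destruct (MV 0 (t / 2)) as (c2 & Hc2 & E2); try lra.
  assert (Q := Pos c ltac:(lra)).
  assert (Q2 : 0 <= D c2).
  { destruct (Req_dec c2 0) as [->|]; [lra|]. left; apply Pos; lra. }
  nra.
Qed.

(** First derivative of [ln (c + k (X^2 + Y^2))] for functions [X], [Y] of a real variable,
    in terms of the values [x], [y] and of the first derivatives [x1], [y1]. *)
Definition log_quad_1 (c k x y x1 y1 : R) : R :=
  2 * k * (x * x1 + y * y1) / (c + k * (x * x + y * y)).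

(** Second derivative of the same function; [x2], [y2] are the second derivatives of [X]
    and [Y]. *)
Definition log_quad_2 (c k x y x1 y1 x2 y2 : R) : R :=
  (2 * k * (x1 * x1 + y1 * y1 + x * x2 + y * y2) * (c + k * (x * x + y * y))
   - (2 * k * (x * x1 + y * y1)) * (2 * k * (x * x1 + y * y1))) /
  ((c + k * (x * x + y * y)) * (c + k * (x * x + y * y))).

Lemma is_derive_log_quad c k X Y t x1 y1 :
  is_derive X t x1 -> is_derive Y t y1 -> 0 < c + k * (X t * X t + Y t * Y t) ->
  is_derive (fun t => ln (c + k * (X t * X t + Y t * Y t))) t (log_quad_1 c k (X t) (Y t) x1 y1).
Proof.
  intros HX HY Hp. unfold log_quad_1. auto_derive.
  - repeat split; auto; eexists; eauto.
  - replace (Derive (fun x : R => X x) t) with x1 by (symmetry; apply is_derive_unique, HX).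
    replace (Derive (fun x : R => Y x) t) with y1 by (symmetry; apply is_derive_unique, HY).
    field. lra.
Qed.

Lemma is_derive_log_quad_1 c k X Y X1 Y1 t x2 y2 :
  is_derive X t (X1 t) -> is_derive Y t (Y1 t) -> is_derive X1 t x2 -> is_derive Y1 t y2 ->
  0 < c + k * (X t * X t + Y t * Y t) ->
  is_derive (fun t => log_quad_1 c k (X t) (Y t) (X1 t) (Y1 t)) t
    (log_quad_2 c k (X t) (Y t) (X1 t) (Y1 t) x2 y2).
Proof.
  intros HX HY HX1 HY1 Hp. unfold log_quad_1, log_quad_2. auto_derive.
  - repeat split; try (eexists; eauto); lra.
  - replace (Derive (fun x : R => X x) t) with (X1 t) by (symmetry; apply is_derive_unique, HX).
    replace (Derive (fun x : R => Y x) t) with (Y1 t) by (symmetry; apply is_derive_unique, HY).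
    replace (Derive (fun x : R => X1 x) t) with x2 by (symmetry; apply is_derive_unique, HX1).
    replace (Derive (fun x : R => Y1 x) t) with y2 by (symmetry; apply is_derive_unique, HY1).
    field. lra.
Qed.

(** Laplacian of [ln (c + k |h|^2)] for holomorphic [h], from its second derivatives in
    the directions [1] and [Ci]: here [h = x + i y], [h' = x1 + i y1], [h'' = x2 + i y2]. *)
Lemma log_quad_laplacian c k x y x1 y1 x2 y2 : c + k * (x * x + y * y) <> 0 ->
  log_quad_2 c k x y x1 y1 x2 y2 + log_quad_2 c k x y (- y1) x1 (- x2) (- y2) =
  4 * k * c * (x1 * x1 + y1 * y1) /
  ((c + k * (x * x + y * y)) * (c + k * (x * x + y * y))).
Proof. intros H. unfold log_quad_2. field. auto. Qed.

(** * The Ahlfors lemma *)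

Lemma locally_horizontal (Omega : C -> Prop) z : open Omega -> Omega z ->
  locally (Re z) (fun t => Omega (t, Im z)).
Proof.
  intros HO Hz. destruct (proj1 (locally_Cmod z Omega) (HO z Hz)) as (d & Hd & H).
  exists (mkposreal d Hd). intros t Ht. apply H.
  eapply Rle_lt_trans; [apply Cmod_sum_le|]. rewrite Re_minus, Im_minus. simpl.
  unfold Im at 1. rewrite Rminus_diag, Rabs_R0, Rplus_0_r. exact Ht.
Qed.

Lemma locally_vertical (Omega : C -> Prop) z : open Omega -> Omega z ->
  locally (Im z) (fun t => Omega (Re z, t)).
Proof.
  intros HO Hz. destruct (proj1 (locally_Cmod z Omega) (HO z Hz)) as (d & Hd & H).
  exists (mkposreal d Hd). intros t Ht. apply H.
  eapply Rle_lt_trans; [apply Cmod_sum_le|]. rewrite Re_minus, Im_minus. simpl.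
  unfold Re at 1. rewrite Rminus_diag, Rabs_R0, Rplus_0_l. exact Ht.
Qed.

Lemma ex_derive_ln_comp (u : R -> R) t : 0 < u t -> ex_derive u t ->
  ex_derive (fun s => ln (u s)) t /\ Derive (fun s => ln (u s)) t = Derive u t / u t.
Proof.
  intros Hp Hu. assert (H : is_derive (fun s => ln (u s)) t (Derive u t / u t)).
  { evar_last.
    - apply (is_derive_comp ln u); [apply is_derive_Reals, derivable_pt_lim_ln; exact Hp|].
      apply Derive_correct, Hu.
    - unfold scal; simpl; unfold mult; simpl; field; lra. }
  split; [eexists; exact H|apply is_derive_unique, H].
Qed.

Section LogMetric.

Variables (Omega : C -> Prop) (rho : C -> R).
Hypothesis HO : open Omega.
Hypothesis Hpos : forall z, Omega z -> 0 < rho z.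
Hypothesis Hsm : smooth_on Omega rho.

Let v (w : C) : R := ln (rho w).

Lemma log_metric_ex_dx z : Omega z -> ex_derive (fun t => v (t, Im z)) (Re z).
Proof.
  intros Hz. destruct (Hsm 1%nat) as (_ & H & _).
  apply (ex_derive_ln_comp (fun t => rho (t, Im z)) (Re z)); [|apply H; auto].
  rewrite <- surjective_pairing. auto.
Qed.

Lemma log_metric_ex_dy z : Omega z -> ex_derive (fun t => v (Re z, t)) (Im z).
Proof.
  intros Hz. destruct (Hsm 1%nat) as (_ & _ & H & _).
  apply (ex_derive_ln_comp (fun t => rho (Re z, t)) (Im z)); [|apply H; auto].
  rewrite <- surjective_pairing. auto.
Qed.

Lemma log_metric_dx z : Omega z -> dx v z = dx rho z / rho z.
Proof.
  intros Hz. destruct (Hsm 1%nat) as (_ & H & _).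
  destruct (ex_derive_ln_comp (fun t => rho (t, Im z)) (Re z)) as (_ & E).
  - rewrite <- surjective_pairing. auto.
  - apply H; auto.
  - rewrite <- surjective_pairing in E. exact E.
Qed.

Lemma log_metric_dy z : Omega z -> dy v z = dy rho z / rho z.
Proof.
  intros Hz. destruct (Hsm 1%nat) as (_ & _ & H & _).
  destruct (ex_derive_ln_comp (fun t => rho (Re z, t)) (Im z)) as (_ & E).
  - rewrite <- surjective_pairing. auto.
  - apply H; auto.
  - rewrite <- surjective_pairing in E. exact E.
Qed.

Lemma log_metric_ex_dxx z : Omega z -> ex_derive (fun t => dx v (t, Im z)) (Re z).
Proof.
  intros Hz. apply (ex_derive_ext_loc (fun t => dx rho (t, Im z) / rho (t, Im z))).
  - apply (filter_imp (fun t => Omega (t, Im z))); [|apply locally_horizontal; auto].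
    intros t Ht. symmetry. apply log_metric_dx; auto.
  - destruct (Hsm 2%nat) as (_ & H1 & _ & (_ & H2 & _) & _).
    apply (ex_derive_div (fun t => dx rho (t, Im z)) (fun t => rho (t, Im z))).
    + apply H2; auto.
    + apply H1; auto.
    + rewrite <- surjective_pairing. apply Rgt_not_eq, Hpos; auto.
Qed.

Lemma log_metric_ex_dyy z : Omega z -> ex_derive (fun t => dy v (Re z, t)) (Im z).
Proof.
  intros Hz. apply (ex_derive_ext_loc (fun t => dy rho (Re z, t) / rho (Re z, t))).
  - apply (filter_imp (fun t => Omega (Re z, t))); [|apply locally_vertical; auto].
    intros t Ht. symmetry. apply log_metric_dy; auto.
  - destruct (Hsm 2%nat) as (_ & _ & H1 & _ & (_ & _ & H2 & _)).
    apply (ex_derive_div (fun t => dy rho (Re z, t)) (fun t => rho (Re z, t))).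
    + apply H2; auto.
    + apply H1; auto.
    + rewrite <- surjective_pairing. apply Rgt_not_eq, Hpos; auto.
Qed.

End LogMetric.

(** The point at parameter [t] on the line through [z] in direction [e]. *)
Definition line_pt (z e : C) (t : R) : C := (z + RtoC t * e)%C.

Lemma line_pt_0 z e : line_pt z e 0 = z.
Proof. unfold line_pt; ring. Qed.

Lemma line_pt_dist z e t : Cmod e = 1 -> Cmod (line_pt z e t - z)%C = Rabs t.
Proof.
  intros He. unfold line_pt. replace (z + t * e - z)%C with (RtoC t * e)%C by ring.
  rewrite Cmod_mult, Cmod_R, He; ring.
Qed.

Lemma line_pt_1 z t : line_pt z (RtoC 1) t = (Re z + t, Im z).
Proof. apply C_ext; unfold line_pt; simpl; unfold Re, Im; simpl; ring. Qed.

Lemma line_pt_Ci z t : line_pt z Ci t = (Re z, Im z + t).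
Proof. apply C_ext; unfold line_pt; simpl; unfold Re, Im; simpl; ring. Qed.

Lemma is_derive_shift (u : R -> R) a t l :
  is_derive u (a + t) l -> is_derive (fun s => u (a + s)) t l.
Proof.
  intros H. evar_last.
  - apply (is_derive_comp u (fun s => a + s)); [exact H|].
    apply (is_derive_plus (K := R_AbsRing) (V := R_NormedModule) (fun _ => a) (fun s => s));
      [apply is_derive_const|apply is_derive_id].
  - unfold scal, plus, zero, one; simpl; unfold mult; simpl; ring.
Qed.

Lemma pderiv_on_line f z e t l :
  cderiv f (line_pt z e t) l -> pderiv (fun s => f (line_pt z e s)) t (e * l)%C.
Proof.
  intros H. rewrite Cmult_comm. apply pderiv_comp; auto. apply pderiv_line.
Qed.

(** Second derivative test at a local maximum [z] of [a + ln (r^2 - |h|^2) - ln |h'|] along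
    the line of direction [e].  The function [a] of the line parameter stands for the
    restriction of [ln rho], with derivatives [a1] and, at [0], [a2]; [h1], [h2], [h3] are
    the successive derivatives of [h]. *)
Lemma directional_max_inequality (h h1 h2 : C -> C) (h3 z e : C) (a a1 : R -> R) (a2 r eta : R) :
  Cmod e = 1 -> 0 < eta ->
  (forall w, Cmod (w - z)%C < eta -> cderiv h w (h1 w) /\ cderiv h1 w (h2 w) /\
     h1 w <> RtoC 0 /\ Cmod (h w) < r) ->
  cderiv h2 z h3 ->
  (forall t, Rabs t < eta -> is_derive a t (a1 t)) -> is_derive a1 0 a2 ->
  (forall t, Rabs t < eta ->
     a t + ln (r * r - Cmod (h (line_pt z e t)) * Cmod (h (line_pt z e t)))
       - ln (Cmod (h1 (line_pt z e t)) * Cmod (h1 (line_pt z e t))) / 2 <=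
     a 0 + ln (r * r - Cmod (h z) * Cmod (h z)) - ln (Cmod (h1 z) * Cmod (h1 z)) / 2) ->
  a2 + log_quad_2 (r * r) (-1) (Re (h z)) (Im (h z)) (Re (e * h1 z)%C) (Im (e * h1 z)%C)
         (Re (e * (e * h2 z))%C) (Im (e * (e * h2 z))%C)
     - log_quad_2 0 1 (Re (h1 z)) (Im (h1 z)) (Re (e * h2 z)%C) (Im (e * h2 z)%C)
         (Re (e * (e * h3))%C) (Im (e * (e * h3))%C) / 2 <= 0.
Proof.
  intros He Heta Hh Hh3 Ha Ha1 Hmax.
  set (p := line_pt z e).
  set (X := fun t => Re (h (p t))). set (Y := fun t => Im (h (p t))).
  set (X1 := fun t => Re (e * h1 (p t))%C). set (Y1 := fun t => Im (e * h1 (p t))%C).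
  set (U := fun t => Re (h1 (p t))). set (V := fun t => Im (h1 (p t))).
  set (U1 := fun t => Re (e * h2 (p t))%C). set (V1 := fun t => Im (e * h2 (p t))%C).
  assert (Pn : forall t, Rabs t < eta -> Cmod (p t - z)%C < eta)
    by (intros t Ht; unfold p; rewrite line_pt_dist; auto).
  assert (P0 : p 0 = z) by apply line_pt_0.
  assert (Q1 : forall t, r * r - Cmod (h (p t)) * Cmod (h (p t)) =
      r * r + -1 * (X t * X t + Y t * Y t)) by (intros; rewrite Cmod_sqr; unfold X, Y; ring).
  assert (Q2 : forall t, Cmod (h1 (p t)) * Cmod (h1 (p t)) =
      0 + 1 * (U t * U t + V t * V t)) by (intros; rewrite Cmod_sqr; unfold U, V; ring).
  assert (Pos1 : forall t, Rabs t < eta -> 0 < r * r + -1 * (X t * X t + Y t * Y t)).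
  { intros t Ht. rewrite <- Q1. destruct (Hh (p t) (Pn t Ht)) as (_ & _ & _ & B).
    assert (B2 := Cmod_ge_0 (h (p t))). nra. }
  assert (Pos2 : forall t, Rabs t < eta -> 0 < 0 + 1 * (U t * U t + V t * V t)).
  { intros t Ht. rewrite <- Q2. destruct (Hh (p t) (Pn t Ht)) as (_ & _ & B & _).
    apply Cmod_gt_0 in B. nra. }
  assert (DX : forall t, Rabs t < eta -> is_derive X t (X1 t) /\ is_derive Y t (Y1 t)).
  { intros t Ht. assert (G := pderiv_on_line h z e t _ (proj1 (Hh (p t) (Pn t Ht)))).
    split; [apply (pderiv_Re _ _ _ G)|apply (pderiv_Im _ _ _ G)]. }
  assert (DU : forall t, Rabs t < eta -> is_derive U t (U1 t) /\ is_derive V t (V1 t)).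
  { intros t Ht. assert (G := pderiv_on_line h1 z e t _ (proj1 (proj2 (Hh (p t) (Pn t Ht))))).
    split; [apply (pderiv_Re _ _ _ G)|apply (pderiv_Im _ _ _ G)]. }
  assert (H00 : Rabs 0 < eta) by (rewrite Rabs_R0; auto).
  assert (DX1 : is_derive X1 0 (Re (e * (e * h2 z))%C) /\ is_derive Y1 0 (Im (e * (e * h2 z))%C)).
  { assert (G := pderiv_on_line (fun w => e * h1 w)%C z e 0 (e * h2 z)%C).
    rewrite line_pt_0 in G.
    assert (G' := G (cderiv_scal e h1 z _ (proj1 (proj2 (Hh z ltac:(rewrite Cmod_self_sub; auto)))))).
    split; [apply (pderiv_Re _ _ _ G')|apply (pderiv_Im _ _ _ G')]. }
  assert (DU1 : is_derive U1 0 (Re (e * (e * h3))%C) /\ is_derive V1 0 (Im (e * (e * h3))%C)).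
  { assert (G := pderiv_on_line (fun w => e * h2 w)%C z e 0 (e * h3)%C).
    rewrite line_pt_0 in G.
    assert (G' := G (cderiv_scal e h2 z _ Hh3)).
    split; [apply (pderiv_Re _ _ _ G')|apply (pderiv_Im _ _ _ G')]. }
  apply (second_derivative_test
    (fun t => a t + ln (r * r + -1 * (X t * X t + Y t * Y t)) +
              - / 2 * ln (0 + 1 * (U t * U t + V t * V t)))
    (fun t => a1 t + log_quad_1 (r * r) (-1) (X t) (Y t) (X1 t) (Y1 t) +
              - / 2 * log_quad_1 0 1 (U t) (V t) (U1 t) (V1 t)) eta); auto.
  - intros t Ht. destruct (DX t Ht) as (D1 & D2). destruct (DU t Ht) as (D3 & D4). split.
    + apply (is_derive_plus (K := R_AbsRing) (V := R_NormedModule)).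
      * apply (is_derive_plus (K := R_AbsRing) (V := R_NormedModule)); auto.
        apply is_derive_log_quad; auto.
      * apply (is_derive_scal (fun t => ln (0 + 1 * (U t * U t + V t * V t)))).
        apply is_derive_log_quad; auto.
    + specialize (Hmax t Ht). fold (p t) in Hmax. rewrite <- P0 in Hmax.
      rewrite !Q1, !Q2 in Hmax. lra.
  - destruct (DX 0 H00) as (D1 & D2). destruct (DU 0 H00) as (D3 & D4).
    destruct DX1 as (D5 & D6). destruct DU1 as (D7 & D8).
    assert (G1 := is_derive_log_quad_1 (r * r) (-1) X Y X1 Y1 0 _ _ D1 D2 D5 D6 (Pos1 0 H00)).
    assert (G2 := is_derive_log_quad_1 0 1 U V U1 V1 0 _ _ D3 D4 D7 D8 (Pos2 0 H00)).
    assert (G3 := is_derive_plus (K := R_AbsRing) (V := R_NormedModule) _ _ 0 _ _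
      (is_derive_plus (K := R_AbsRing) (V := R_NormedModule) _ _ 0 _ _ Ha1 G1)
      (is_derive_scal _ 0 (- / 2) _ G2)).
    match goal with |- is_derive _ _ ?m => replace m with
      (a2 + log_quad_2 (r * r) (-1) (X 0) (Y 0) (X1 0) (Y1 0) (Re (e * (e * h2 z))%C)
         (Im (e * (e * h2 z))%C) + - / 2 * log_quad_2 0 1 (U 0) (V 0) (U1 0) (V1 0)
         (Re (e * (e * h3))%C) (Im (e * (e * h3))%C)) end.
    + exact G3.
    + unfold X, Y, X1, Y1, U, V, U1, V1. rewrite P0. field.
Qed.

(** A holomorphic map is open at points where its derivative does not vanish. *)
Lemma image_neighbourhood g dg c r w : (forall z, disc c r z -> cderiv g z (dg z)) ->
  disc c r w -> dg w <> RtoC 0 ->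
  exists eta, 0 < eta /\ forall z, Cmod (z - g w)%C < eta -> exists v, disc c r v /\ g v = z.
Proof.
  intros Hg Hw N. assert (P := proj1 (Cmod_gt_0 _) N).
  destruct (holomorphic_C1 g dg c r Hg w Hw) as (_ & Hc).
  destruct (Hc (Cmod (dg w) / 2)) as (d0 & Hd0 & H0); [lra|].
  set (d := Rmin d0 (r - Cmod (w - c)%C)).
  assert (Hd : 0 < d) by (apply Rmin_pos; unfold disc in Hw; lra).
  assert (D1 : d <= d0) by apply Rmin_l. assert (D2 : d <= r - Cmod (w - c)%C) by apply Rmin_r.
  assert (Sub : forall z, disc w d z -> disc c r z).
  { intros z Hz. unfold disc in *. assert (T := Cmod_sub_triangle z w c). lra. }
  exists (Cmod (dg w) * d / 2). split; [nra|]. intros z Hz.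
  destruct (near_affine_surjective g w d (dg w) z N) as (v & V1 & V2); auto.
  - apply derivative_near_const_increment with dg; auto.
    intros v Hv. left. apply H0. unfold disc in Hv. lra.
  - exists v; split; auto.
Qed.

Lemma laplacian_log_metric Omega rho z : hyperbolic_metric Omega rho -> Omega z ->
  laplacian (fun w => ln (rho w)) z = rho z * rho z.
Proof.
  intros (Hpos & _ & Hc & _) Hz. specialize (Hpos z Hz). specialize (Hc z Hz).
  unfold gaussian_curvature in Hc.
  apply (Rmult_eq_compat_r (- (rho z ^ 2))) in Hc.
  transitivity (- laplacian (fun w => ln (rho w)) z / rho z ^ 2 * - rho z ^ 2); [|rewrite Hc; ring].
  field. lra.
Qed.

(** At a local maximum of [rho (r^2 - |h|^2) / |h'|], the metric [rho] is dominated by the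
    pull-back [2 r |h'| / (r^2 - |h|^2)] under [h] of the hyperbolic metric of the disc of
    radius [r].  Adding the inequalities of the two directions [1] and [Ci], the first
    terms give [rho^2] by the curvature equation, the second ones the curvature of the
    pull-back, and the third ones cancel as [ln |h'|] is harmonic. *)
Lemma ahlfors_at_max Omega rho (h h1 h2 : C -> C) h3 z r eta :
  open Omega -> hyperbolic_metric Omega rho -> 0 < eta -> 0 < r ->
  (forall w, Cmod (w - z)%C < eta -> Omega w /\ cderiv h w (h1 w) /\ cderiv h1 w (h2 w) /\
     h1 w <> RtoC 0 /\ Cmod (h w) < r) ->
  cderiv h2 z h3 ->
  (forall w, Cmod (w - z)%C < eta ->
     rho w * (r * r - Cmod (h w) * Cmod (h w)) / Cmod (h1 w) <=
     rho z * (r * r - Cmod (h z) * Cmod (h z)) / Cmod (h1 z)) ->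
  rho z * (r * r - Cmod (h z) * Cmod (h z)) <= 2 * r * Cmod (h1 z).
Proof.
  intros HO HM Heta Hr Hh Hh3 Hmax.
  assert (HM' := HM). destruct HM' as (Hpos & Hsm & _ & _).
  set (v := fun w => ln (rho w)).
  assert (Hz : Cmod (z - z)%C < eta) by (rewrite Cmod_self_sub; auto).
  assert (Hh' : forall w, Cmod (w - z)%C < eta -> cderiv h w (h1 w) /\ cderiv h1 w (h2 w) /\
     h1 w <> RtoC 0 /\ Cmod (h w) < r) by (intros w Hw; apply Hh; auto).
  assert (Fac : forall w, Cmod (w - z)%C < eta ->
     0 < rho w /\ 0 < r * r - Cmod (h w) * Cmod (h w) /\ 0 < Cmod (h1 w)).
  { intros w Hw. destruct (Hh w Hw) as (A1 & _ & _ & A2 & A3).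
    assert (B := Cmod_ge_0 (h w)). split; [apply Hpos; auto|split; [nra|apply Cmod_gt_0; auto]]. }
  assert (Elog : forall w, Cmod (w - z)%C < eta ->
     v w + ln (r * r - Cmod (h w) * Cmod (h w)) - ln (Cmod (h1 w) * Cmod (h1 w)) / 2 =
     ln (rho w * (r * r - Cmod (h w) * Cmod (h w)) / Cmod (h1 w))).
  { intros w Hw. destruct (Fac w Hw) as (F1 & F2 & F3). unfold v, Rdiv.
    rewrite !ln_mult, ln_Rinv; auto using Rinv_0_lt_compat, Rmult_lt_0_compat. field. }
  assert (Lmax : forall e, Cmod e = 1 -> forall t, Rabs t < eta ->
     v (line_pt z e t) + ln (r * r - Cmod (h (line_pt z e t)) * Cmod (h (line_pt z e t)))
       - ln (Cmod (h1 (line_pt z e t)) * Cmod (h1 (line_pt z e t))) / 2 <=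
     v (line_pt z e 0) + ln (r * r - Cmod (h z) * Cmod (h z)) - ln (Cmod (h1 z) * Cmod (h1 z)) / 2).
  { intros e He t Ht. rewrite line_pt_0.
    assert (Hl : Cmod (line_pt z e t - z)%C < eta) by (rewrite line_pt_dist; auto).
    rewrite !Elog by auto.
    destruct (Fac _ Hl) as (F1 & F2 & F3).
    assert (Pos : 0 < rho (line_pt z e t) * (r * r - Cmod (h (line_pt z e t)) * Cmod (h (line_pt z e t)))
       / Cmod (h1 (line_pt z e t))).
    { apply Rdiv_lt_0_compat; auto. apply Rmult_lt_0_compat; auto. }
    destruct (Hmax _ Hl) as [Lt|Eq]; [left; apply ln_increasing; auto|right; rewrite Eq; auto]. }
  assert (M1 := directional_max_inequality h h1 h2 h3 z (RtoC 1)
    (fun t => v (line_pt z (RtoC 1) t)) (fun t => dx v (Re z + t, Im z)) (dx (dx v) z) r eta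
    Cmod_1 Heta Hh' Hh3).
  assert (M2 := directional_max_inequality h h1 h2 h3 z Ci
    (fun t => v (line_pt z Ci t)) (fun t => dy v (Re z, Im z + t)) (dy (dy v) z) r eta
    Cmod_Ci Heta Hh' Hh3).
  assert (Oz : Omega z) by (apply Hh; auto).
  assert (M1' := M1
    ltac:(intros t Ht;
      apply (is_derive_ext (fun s => v (Re z + s, Im z))); [intros; rewrite line_pt_1; reflexivity|];
      apply (is_derive_shift (fun s => v (s, Im z)));
      assert (Ot : Omega (Re z + t, Im z))
        by (rewrite <- line_pt_1; apply Hh; rewrite line_pt_dist; [auto|apply Cmod_1]);
      apply Derive_correct, (log_metric_ex_dx Omega rho Hpos Hsm _ Ot))
    ltac:(apply (is_derive_shift (fun s => dx v (s, Im z))); rewrite Rplus_0_r;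
      apply Derive_correct, (log_metric_ex_dxx Omega rho HO Hpos Hsm _ Oz))
    (Lmax _ Cmod_1)).
  assert (M2' := M2
    ltac:(intros t Ht;
      apply (is_derive_ext (fun s => v (Re z, Im z + s))); [intros; rewrite line_pt_Ci; reflexivity|];
      apply (is_derive_shift (fun s => v (Re z, s)));
      assert (Ot : Omega (Re z, Im z + t))
        by (rewrite <- line_pt_Ci; apply Hh; rewrite line_pt_dist; [auto|apply Cmod_Ci]);
      apply Derive_correct, (log_metric_ex_dy Omega rho Hpos Hsm _ Ot))
    ltac:(apply (is_derive_shift (fun s => dy v (Re z, s))); rewrite Rplus_0_r;
      apply Derive_correct, (log_metric_ex_dyy Omega rho HO Hpos Hsm _ Oz))
    (Lmax _ Cmod_Ci)).
  clear M1 M2.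
  assert (Lap : dx (dx v) z + dy (dy v) z = rho z * rho z)
    by apply (laplacian_log_metric Omega rho z HM Oz).
  destruct (Fac z Hz) as (F1 & F2 & F3).
  rewrite !Cmult_1_l in M1'.
  assert (I2 : forall c, (Ci * (Ci * c))%C = (- c)%C).
  { intros c. apply C_ext; unfold Ci, Cmult, Copp; simpl; unfold Re, Im; simpl; ring. }
  rewrite !I2 in M2'.
  assert (R1 : forall c, Re (Ci * c)%C = - Im c)
    by (intros c; unfold Ci, Cmult; simpl; unfold Re, Im; simpl; ring).
  assert (R2 : forall c, Im (Ci * c)%C = Re c)
    by (intros c; unfold Ci, Cmult; simpl; unfold Re, Im; simpl; ring).
  assert (R3 : forall c, Re (- c)%C = - Re c) by reflexivity.
  assert (R4 : forall c, Im (- c)%C = - Im c) by reflexivity.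
  rewrite !R1, !R2, !R3, !R4 in M2'.
  set (Q := r * r - Cmod (h z) * Cmod (h z)) in *.
  assert (EQ : r * r + -1 * (Re (h z) * Re (h z) + Im (h z) * Im (h z)) = Q)
    by (unfold Q; rewrite Cmod_sqr; ring).
  assert (EQ2 : 0 + 1 * (Re (h1 z) * Re (h1 z) + Im (h1 z) * Im (h1 z)) = Cmod (h1 z) * Cmod (h1 z))
    by (rewrite Cmod_sqr; ring).
  assert (S1 := log_quad_laplacian (r * r) (-1) (Re (h z)) (Im (h z)) (Re (h1 z)) (Im (h1 z))
    (Re (h2 z)) (Im (h2 z)) ltac:(rewrite EQ; lra)).
  assert (S2 := log_quad_laplacian 0 1 (Re (h1 z)) (Im (h1 z)) (Re (h2 z)) (Im (h2 z))
    (Re h3) (Im h3) ltac:(rewrite EQ2; nra)).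
  rewrite EQ, <- Cmod_sqr in S1. rewrite Rmult_0_r, Rmult_0_l in S2. unfold Rdiv at 1 in S2.
  rewrite Rmult_0_l in S2.
  assert (Main : rho z * rho z <= 4 * (r * r) * (Cmod (h1 z) * Cmod (h1 z)) / (Q * Q)).
  { replace (4 * (r * r) * (Cmod (h1 z) * Cmod (h1 z)) / (Q * Q))
      with (- (4 * -1 * (r * r) * (Cmod (h1 z) * Cmod (h1 z)) / (Q * Q))) by (field; lra). lra. }
  apply (Rmult_le_compat_r (Q * Q)) in Main; [|nra].
  replace (4 * (r * r) * (Cmod (h1 z) * Cmod (h1 z)) / (Q * Q) * (Q * Q))
    with ((2 * r * Cmod (h1 z)) * (2 * r * Cmod (h1 z))) in Main by (field; lra).
  assert (0 < 2 * r * Cmod (h1 z)) by (repeat apply Rmult_lt_0_compat; lra).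
  assert (0 < rho z * Q) by (apply Rmult_lt_0_compat; lra).
  nra.
Qed.

(** A conformal map [g] of the disc of radius [rad] into [Omega], with inverse [h]. *)
Section Ahlfors.

Variables (Omega : C -> Prop) (rho : C -> R) (g h : C -> C) (rad : R).
Hypothesis HO : open Omega.
Hypothesis HM : hyperbolic_metric Omega rho.
Hypothesis Hg : forall w, disc (RtoC 0) rad w -> Omega (g w) /\ exists l, cderiv g w l.
Hypothesis Hh : forall w, disc (RtoC 0) rad w -> h (g w) = w /\ exists l, cderiv h (g w) l.

Lemma cderiv_C_derive f z : (exists l, cderiv f z l) -> cderiv f z (C_derive f z).
Proof.
  intros (l & Hl). replace (C_derive f z) with l; auto.
  symmetry. apply is_C_derive_unique, is_derive_cderiv; auto.
Qed.

Lemma ahlfors_inverse_derivative w : disc (RtoC 0) rad w ->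
  (C_derive h (g w) * C_derive g w)%C = RtoC 1.
Proof.
  intros Hw. destruct (Hg w Hw) as (_ & G). destruct (Hh w Hw) as (_ & H).
  apply cderiv_C_derive in G. apply cderiv_C_derive in H.
  apply (cderiv_unique (fun v => h (g v)) w); [apply cderiv_comp; auto|].
  assert (Pd : 0 < rad - Cmod (w - 0)%C) by (unfold disc in Hw; lra).
  apply (cderiv_local_ext (fun v => RtoC 0 + RtoC 1 * v)%C _ w _ _ Pd).
  - intros v Hv. assert (Hv' : disc (RtoC 0) rad v).
    { unfold disc. assert (T := Cmod_sub_triangle v w (RtoC 0)). lra. }
    rewrite (proj1 (Hh v Hv')). ring.
  - apply cderiv_affine.
Qed.

(** On a smaller closed disc, of radius [r], the function [rho (g w) (r^2 - |w|^2) |g' w|]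
    vanishes on the boundary circle, so that its maximum is interior and
    [ahlfors_at_max] bounds it by [2 r]; its value at [0] is [rho (g 0) r^2 |g' 0|]. *)
Lemma ahlfors_inner r : 0 < r < rad -> rho (g (RtoC 0)) * r <= 2 * Cmod (C_derive h (g (RtoC 0))).
Proof.
  intros Hr.
  set (dg := C_derive g).
  assert (Dg : forall w, disc (RtoC 0) rad w -> cderiv g w (dg w))
    by (intros w Hw; apply cderiv_C_derive, Hg; auto).
  assert (In : forall w, Cmod w < rad -> disc (RtoC 0) rad w).
  { intros w Hw. unfold disc. replace (w - 0)%C with w by ring. auto. }
  assert (In' : forall w, disc (RtoC 0) rad w -> Cmod w < rad).
  { intros w Hw. unfold disc in Hw. replace (w - 0)%C with w in Hw by ring. auto. }
  assert (Ndg : forall w, disc (RtoC 0) rad w -> 0 < Cmod (dg w) /\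
     Cmod (C_derive h (g w)) = / Cmod (dg w)).
  { intros w Hw. assert (E := ahlfors_inverse_derivative w Hw). fold dg in E.
    assert (N : dg w <> RtoC 0).
    { intros E0. rewrite E0, Cmult_0_r in E. apply RtoC_inj in E. lra. }
    apply Cmod_gt_0 in N. split; auto.
    apply (f_equal Cmod) in E. rewrite Cmod_mult, Cmod_1 in E.
    apply (Rmult_eq_reg_r (Cmod (dg w))); [|lra]. rewrite E. field. lra. }
  destruct HM as (Hpos & Hsm & _).
  set (E := fun w => rho (g w) * (r * r - Cmod w * Cmod w) * Cmod (dg w)).
  destruct (closed_disc_max E r) as (w1 & Hw1 & Hmax); [lra| |].
  { intros w Hw. assert (Dw : disc (RtoC 0) rad w) by (apply In; lra).
    apply (continuous_mult (fun w => rho (g w) * (r * r - Cmod w * Cmod w)) (fun w => Cmod (dg w))).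
    - apply (continuous_mult (fun w => rho (g w)) (fun w => r * r - Cmod w * Cmod w)).
      + apply ccont_continuous_comp; [eapply cderiv_ccont, Dg; auto|].
        apply (Hsm 0%nat). apply Hg; auto.
      + apply (continuous_minus (fun _ => r * r) (fun w => Cmod w * Cmod w));
          [apply continuous_const|].
        apply (continuous_mult Cmod Cmod); apply continuous_Cmod.
    - apply (ccont_continuous_comp Cmod dg); [|apply continuous_Cmod].
      apply (holomorphic_C1 g dg (RtoC 0) rad Dg w Dw). }
  assert (Z0 : disc (RtoC 0) rad (RtoC 0)) by (apply disc_center; lra).
  assert (E0 : E (RtoC 0) = rho (g (RtoC 0)) * (r * r) * Cmod (dg (RtoC 0))).
  { unfold E. rewrite Cmod_0. ring. }
  assert (P0 : 0 < rho (g (RtoC 0))) by (apply Hpos, Hg; auto).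
  destruct (Ndg _ Z0) as (N0 & I0).
  assert (PE0 : 0 < E (RtoC 0)).
  { rewrite E0. repeat apply Rmult_lt_0_compat; lra. }
  assert (LE0 : E (RtoC 0) <= E w1) by (apply Hmax; rewrite Cmod_0; lra).
  assert (Dw1 : disc (RtoC 0) rad w1) by (apply In; lra).
  assert (Lt1 : Cmod w1 < r).
  { destruct Hw1 as [|Eq]; auto. exfalso. unfold E in LE0 at 2. rewrite Eq in LE0. lra. }
  destruct (Ndg w1 Dw1) as (N1 & I1).
  destruct (image_neighbourhood g dg (RtoC 0) rad w1 Dg Dw1) as (eta1 & He1 & Him).
  { apply Cmod_gt_0; auto. }
  set (z1 := g w1) in *.
  set (h1 := C_derive h). set (h2 := C_derive h1). set (h3 := C_derive h2 z1).
  assert (Dh : forall z, disc z1 eta1 z -> cderiv h z (h1 z)).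
  { intros z Hz. destruct (Him z Hz) as (w & Hw & <-). apply cderiv_C_derive, Hh; auto. }
  assert (Dh1 : forall z, disc z1 eta1 z -> cderiv h1 z (h2 z)).
  { intros z Hz. apply cderiv_C_derive, (holomorphic_derivative h h1 z1 eta1); auto. }
  assert (Dh2 : cderiv h2 z1 h3).
  { apply cderiv_C_derive, (holomorphic_derivative h1 h2 z1 eta1); auto. apply disc_center; auto. }
  assert (H1 : h z1 = w1) by (apply Hh; auto).
  destruct (cderiv_ccont h z1 _ (Dh z1 (disc_center _ _ He1)) (r - Cmod w1)) as (eta2 & He2 & H2); [lra|].
  set (eta := Rmin eta1 eta2).
  assert (Le1 : eta <= eta1) by apply Rmin_l. assert (Le2 : eta <= eta2) by apply Rmin_r.
  assert (Near : forall z, Cmod (z - z1)%C < eta -> disc (RtoC 0) rad (h z) /\ g (h z) = z /\ Cmod (h z) < r).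
  { intros z Hz. destruct (Him z) as (w & Hw & <-); [lra|].
    specialize (H2 (g w) ltac:(lra)). rewrite H1 in H2.
    rewrite (proj1 (Hh w Hw)) in *. repeat split; auto.
    assert (T := Cmod_triangle_rev w w1). lra. }
  assert (Ez : forall z, Cmod (z - z1)%C < eta ->
     rho z * (r * r - Cmod (h z) * Cmod (h z)) / Cmod (h1 z) = E (h z)).
  { intros z Hz. destruct (Near z Hz) as (A1 & A2 & A3). destruct (Ndg _ A1) as (A4 & A5).
    unfold E. rewrite A2 in A5 |- *. fold h1 in A5. rewrite A5. field. lra. }
  assert (He : 0 < eta) by (apply Rmin_pos; auto).
  assert (Hzz : Cmod (z1 - z1)%C < eta) by (rewrite Cmod_self_sub; auto).
  assert (Key : rho z1 * (r * r - Cmod (h z1) * Cmod (h z1)) <= 2 * r * Cmod (h1 z1)).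
  { apply (ahlfors_at_max Omega rho h h1 h2 h3 z1 r eta); auto; [lra| |].
    - intros z Hz. destruct (Near z Hz) as (A1 & A2 & A3). destruct (Ndg _ A1) as (A4 & A5).
      rewrite A2 in A5. fold h1 in A5.
      repeat split; auto.
      + rewrite <- A2. apply Hg; auto.
      + apply Dh. unfold disc; lra.
      + apply Dh1. unfold disc; lra.
      + apply Cmod_gt_0. rewrite A5. apply Rinv_0_lt_compat; auto.
    - intros z Hz. rewrite !Ez by auto. rewrite H1. apply Hmax.
      left. apply Near; auto. }
  assert (Fin : E w1 <= 2 * r).
  { rewrite <- H1, <- (Ez z1 Hzz).
    assert (Ph : 0 < Cmod (h1 z1)).
    { unfold h1. rewrite I1. apply Rinv_0_lt_compat; auto. }
    apply (Rmult_le_reg_r (Cmod (h1 z1))); auto.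
    replace (rho z1 * (r * r - Cmod (h z1) * Cmod (h z1)) / Cmod (h1 z1) * Cmod (h1 z1))
      with (rho z1 * (r * r - Cmod (h z1) * Cmod (h z1))) by (field; lra). lra. }
  fold h1 in I0. rewrite I0. apply (Rmult_le_reg_r (r * Cmod (dg (RtoC 0)))); [nra|].
  replace (2 * / Cmod (dg (RtoC 0)) * (r * Cmod (dg (RtoC 0)))) with (2 * r) by (field; lra).
  replace (rho (g (RtoC 0)) * r * (r * Cmod (dg (RtoC 0)))) with (E (RtoC 0)) by (rewrite E0; ring).
  lra.
Qed.

(** The Schwarz-Pick bound [rho (g 0) |g' 0| <= 2 / rad], written with the derivative [l] of
    the inverse [h] of [g]. *)
Lemma ahlfors l : 0 < rad -> cderiv h (g (RtoC 0)) l -> rho (g (RtoC 0)) * rad <= 2 * Cmod l.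
Proof.
  intros HR Hl.
  replace l with (C_derive h (g (RtoC 0))) by (apply is_C_derive_unique, is_derive_cderiv; auto).
  assert (P0 : 0 < rho (g (RtoC 0))) by (apply (proj1 HM), Hg, disc_center; auto).
  apply Rnot_lt_le. intros Hlt.
  set (A := 2 * Cmod (C_derive h (g (RtoC 0)))) in *.
  assert (PA : 0 <= A) by (unfold A; assert (Q := Cmod_ge_0 (C_derive h (g (RtoC 0)))); lra).
  (* Otherwise [ahlfors_inner] fails for a radius strictly between [q] and [rad]. *)
  set (q := A / rho (g (RtoC 0))).
  assert (Eq : q * rho (g (RtoC 0)) = A) by (unfold q; field; lra).
  assert (Q0 : 0 <= q) by (apply Rdiv_le_0_compat; lra).
  assert (Q1 : q < rad) by nra.
  assert (K := ahlfors_inner ((q + rad) / 2) ltac:(lra)). fold A in K. nra.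
Qed.

End Ahlfors.

(** * Bounds for the maximal radius *)

(** Schwarz-Pick bound for a Euclidean disc contained in [Omega]. *)
Lemma metric_disc_bound Omega rho z r : open Omega -> hyperbolic_metric Omega rho -> 0 < r ->
  (forall w, disc z r w -> Omega w) -> rho z * r <= 2.
Proof.
  intros HO HM Hr Hd.
  assert (K := ahlfors Omega rho (fun w => z + RtoC 1 * w)%C (fun w => - z + RtoC 1 * w)%C r HO HM).
  cbv beta in K. replace (z + 1 * 0)%C with z in K by ring.
  rewrite <- (Rmult_1_r 2), <- Cmod_1. apply K; auto.
  - intros w Hw. split; [|eexists; apply cderiv_affine]. apply Hd. unfold disc in *.
    replace (z + 1 * w - z)%C with (w - 0)%C by ring. auto.
  - intros w Hw. split; [ring|eexists; apply cderiv_affine].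
  - apply cderiv_affine.
Qed.

(** On the way out of [Omega] along a segment one meets the boundary. *)
Lemma segment_meets_boundary Omega z w : Omega z -> ~ Omega w ->
  exists T, 0 <= T <= 1 /\ boundary Omega (seg_pt z w T).
Proof.
  intros Hz Hw.
  set (E := fun t => 0 <= t <= 1 /\ forall s, 0 <= s <= t -> Omega (seg_pt z w s)).
  assert (E0 : E 0).
  { split; [lra|]. intros s Hs. replace s with 0 by lra. rewrite seg_pt_0; auto. }
  destruct (completeness E) as (T & HT1 & HT2).
  { exists 1. intros t (Ht & _). lra. }
  { exists 0; auto. }
  assert (T0 : 0 <= T) by (apply HT1; auto).
  assert (T1 : T <= 1) by (apply HT2; intros t (Ht & _); lra).
  assert (Below : forall s, 0 <= s < T -> exists t, E t /\ s < t).
  { intros s Hs. apply NNPP. intros N.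
    assert (T <= s); [|lra]. apply HT2. intros t Ht. apply Rnot_lt_le. intros Hlt. apply N; eauto. }
  assert (Dist : forall s, Cmod (seg_pt z w s - seg_pt z w T)%C = Rabs (s - T) * Cmod (w - z)%C).
  { intros s. rewrite <- Cmod_R, <- Cmod_mult. f_equal. unfold seg_pt. rewrite RtoC_minus. ring. }
  exists T. split; auto. intros eps Heps.
  destruct (small_cofactor (eps / 2) (Cmod (w - z)%C)) as (d & Hd & Hd'); [lra|apply Cmod_ge_0|].
  assert (Near : forall s, Rabs (s - T) <= d -> disc (seg_pt z w T) eps (seg_pt z w s)).
  { intros s Hs. unfold disc. rewrite Dist.
    assert (P := Cmod_ge_0 (w - z)%C). nra. }
  split.
  - destruct (Rle_lt_dec T 0) as [H0|H0].
    + exists (seg_pt z w 0). split.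
      * apply Near. replace (0 - T) with 0 by lra. rewrite Rabs_R0; lra.
      * rewrite seg_pt_0; auto.
    + destruct (Below (Rmax 0 (T - d))) as (t & (Ht1 & Ht2) & Ht3).
      { split; [apply Rmax_l|apply Rmax_lub_lt; lra]. }
      assert (Q := Rmax_r 0 (T - d)). assert (t <= T) by (apply HT1; split; auto).
      exists (seg_pt z w t). split; [|apply Ht2; lra]. apply Near. apply Rabs_le. lra.
  - apply NNPP. intros N.
    assert (All : forall v, disc (seg_pt z w T) eps v -> Omega v).
    { intros v Hv. apply NNPP. intros Nv. apply N. eauto. }
    assert (M1 := Rmin_l (T + d) 1). assert (M2 := Rmin_r (T + d) 1).
    assert (ET : E (Rmin (T + d) 1)).
    { split; [split; [apply Rmin_glb|]; lra|]. intros s Hs.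
      destruct (Rlt_le_dec s T) as [Hs'|Hs'].
      - destruct (Below s) as (t & (Ht1 & Ht2) & Ht3); [lra|]. apply Ht2; lra.
      - apply All, Near. rewrite Rabs_pos_eq; lra. }
    assert (LT := HT1 _ ET).
    destruct (Rle_lt_dec 1 (T + d)) as [H1|H1].
    + rewrite Rmin_right in LT, ET by lra. apply Hw. rewrite <- (seg_pt_1 z w).
      apply (proj2 ET). lra.
    + rewrite Rmin_left in LT by lra. lra.
Qed.

Lemma dist_boundary_disc Omega z w : Omega z ->
  Rbar_lt (Finite (Cmod (w - z)%C)) (dist_boundary Omega z) -> Omega w.
Proof.
  intros Hz Hlt. apply NNPP. intros Hw.
  destruct (segment_meets_boundary Omega z w Hz Hw) as (T & HT & HB).
  apply (Rbar_lt_not_le _ _ Hlt).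
  apply (Rbar_le_trans _ (Finite (Cmod (z - seg_pt z w T)%C))).
  - unfold dist_boundary. apply (proj1 (Glb_Rbar_correct _)). eauto.
  - simpl. rewrite Cmod_sub_sym. eapply Rle_trans; [apply seg_pt_dist; auto|].
    rewrite Cmod_self_sub. assert (P := Cmod_ge_0 (w - z)%C). nra.
Qed.

Lemma dist_boundary_ge Omega z r : (forall w, disc z r w -> Omega w) ->
  open Omega -> Rbar_le (Finite r) (dist_boundary Omega z).
Proof.
  intros Hd HO. unfold dist_boundary. apply (proj2 (Glb_Rbar_correct _)).
  intros x (w & Hw & ->). simpl. apply Rnot_lt_le. intros Hlt.
  assert (Ow : Omega w) by (apply Hd; unfold disc; rewrite Cmod_sub_sym; auto).
  destruct (proj1 (locally_Cmod w Omega) (HO w Ow)) as (e & He & H).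
  destruct (Hw e He) as (_ & b & Hb & Nb). apply Nb, H, Hb.
Qed.

(** In the presence of a hyperbolic metric the distance to the boundary is a positive
    real number, and the disc of this radius lies in [Omega]. *)
Lemma dist_boundary_finite Omega rho z : open Omega -> hyperbolic_metric Omega rho -> Omega z ->
  exists d, 0 < d /\ dist_boundary Omega z = Finite d /\ forall w, disc z d w -> Omega w.
Proof.
  intros HO HM Hz.
  destruct (proj1 (locally_Cmod z Omega) (HO z Hz)) as (e & He & H).
  assert (Ge := dist_boundary_ge Omega z e H HO).
  assert (Sub := fun w => dist_boundary_disc Omega z w Hz).
  destruct (dist_boundary Omega z) as [d| |].
  - exists d. split; [simpl in Ge; lra|]. split; auto.
  - (* [Omega] would be the whole plane and contain discs of radius [3 / rho z]. *)
    exfalso. assert (P := proj1 HM z Hz).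
    assert (K := metric_disc_bound Omega rho z (3 / rho z) HO HM ltac:(apply Rdiv_lt_0_compat; lra)
      (fun w _ => Sub w I)).
    replace (rho z * (3 / rho z)) with 3 in K by (field; lra). lra.
  - simpl in Ge. contradiction.
Qed.

(** The primitive [f] of the square root has [|f' z0|^2 = |phi z0|], and [f' z0] is the
    derivative at [z0] of the inverse of [g], to which the Schwarz-Pick bound applies. *)
Lemma inverse_extends_radius_le Omega rho phi z0 r : open Omega -> hyperbolic_metric Omega rho ->
  Omega z0 -> 0 < r -> inverse_extends_to_disc Omega phi z0 r ->
  r <= 2 * sqrt (qd_norm rho phi z0).
Proof.
  intros HO HM Hz Hr (d & s & g & Hd & _ & (Hs1 & Hs2) & (Hg1 & Hg2 & h & Hh1 & Hh2) & Hloc).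
  assert (Hs := proj1 (holomorphic_cderiv _ _) Hs1).
  assert (Hg := proj1 (holomorphic_cderiv _ _) Hg1).
  assert (Hh := proj1 (holomorphic_cderiv _ _) Hh1).
  set (f := segment_integral s z0) in *.
  assert (D0 : disc z0 d z0) by (apply disc_center; auto).
  assert (Df : cderiv f z0 (s z0)) by (apply segment_integral_primitive with d; auto).
  assert (f0 : f z0 = RtoC 0) by apply segment_integral_same.
  apply locally_Cmod in Hloc. destruct Hloc as (e & He & Hloc).
  assert (g0 : g (RtoC 0) = z0) by (rewrite <- f0; apply Hloc; rewrite Cmod_self_sub; auto).
  assert (Z0 : disc (RtoC 0) r (RtoC 0)) by (apply disc_center; auto).
  (* Near [z0] the holomorphic inverse [h] of [g] is [f]: both invert [g]. *)
  assert (Dh : cderiv h (g (RtoC 0)) (s z0)).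
  { rewrite g0.
    destruct (cderiv_ccont f z0 _ Df r Hr) as (e' & He' & Hf').
    apply (cderiv_local_ext f h z0 _ (Rmin e e')); auto; [apply Rmin_pos; auto|].
    intros w Hw. assert (W1 := Rlt_le_trans _ _ _ Hw (Rmin_l _ _)).
    assert (W2 := Rlt_le_trans _ _ _ Hw (Rmin_r _ _)).
    rewrite <- (Hloc w W1) at 2. symmetry. apply Hh2. unfold disc. rewrite <- f0. auto. }
  assert (K := ahlfors Omega rho g h r HO HM (fun w Hw => conj (Hg2 w Hw) (Hg w Hw))
    (fun w Hw => conj (Hh2 w Hw) (Hh (g w) (ex_intro _ w (conj Hw eq_refl)))) (s z0) Hr Dh).
  rewrite g0 in K. assert (P := proj1 HM z0 Hz).
  assert (Ps := Cmod_ge_0 (s z0)).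
  assert (E : sqrt (qd_norm rho phi z0) = Cmod (s z0) / rho z0).
  { unfold qd_norm. rewrite <- (Hs2 z0 D0), Cmod_mult.
    replace (Cmod (s z0) * Cmod (s z0) / rho z0 ^ 2)
      with ((Cmod (s z0) / rho z0) * (Cmod (s z0) / rho z0)) by (field; lra).
    apply sqrt_square. apply Rdiv_le_0_compat; lra. }
  rewrite E. apply (Rmult_le_reg_r (rho z0)); auto.
  replace (2 * (Cmod (s z0) / rho z0) * rho z0) with (2 * Cmod (s z0)) by (field; lra). lra.
Qed.

Lemma phi_radius_ge Omega phi z0 r : phi z0 <> RtoC 0 -> 0 < r ->
  inverse_extends_to_disc Omega phi z0 r -> Rbar_le (Finite r) (phi_radius Omega phi z0).
Proof.
  intros N Hr HI. unfold phi_radius. destruct (Ceq_dec (phi z0) (RtoC 0)); [contradiction|].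
  apply (proj1 (Lub_Rbar_correct _)). auto.
Qed.

(** Where [phi] does not vanish, the local inverse exists on some disc. *)
Lemma phi_radius_pos Omega phi z0 : open Omega -> Omega z0 -> holomorphic_on Omega phi ->
  phi z0 <> RtoC 0 -> Rbar_le (Finite 0) (phi_radius Omega phi z0).
Proof.
  intros HO Hz Hphi N. assert (P := proj1 (Cmod_gt_0 _) N).
  assert (Hp := proj1 (holomorphic_cderiv _ _) Hphi).
  destruct (proj1 (locally_Cmod z0 Omega) (HO z0 Hz)) as (d1 & Hd1 & H1).
  destruct (Hp z0 Hz) as (l & Hl).
  destruct (cderiv_ccont _ _ _ Hl (Cmod (phi z0) / 2)) as (d2 & Hd2 & H2); [lra|].
  set (d := Rmin d1 d2). assert (Hd : 0 < d) by (apply Rmin_pos; auto).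
  assert (L1 : d <= d1) by apply Rmin_l. assert (L2 : d <= d2) by apply Rmin_r.
  assert (Sub : forall z, disc z0 d z -> Omega z).
  { intros z Hz'. unfold disc in Hz'. apply H1. lra. }
  assert (Pr : 0 < sqrt (Cmod (phi z0)) * d / 2).
  { assert (Q := sqrt_lt_R0 _ P). nra. }
  apply (Rbar_le_trans _ (Finite (sqrt (Cmod (phi z0)) * d / 2))); [simpl; lra|].
  apply phi_radius_ge; auto. apply inverse_extends_of_near_const; auto.
  intros z Hz'. unfold disc in Hz'. left. apply H2. lra.
Qed.

Lemma Rpower_three_halves x : 0 < x -> Rpower x (3 / 2) = x * sqrt x.
Proof.
  intros Hx. replace (3 / 2) with (1 + / 2) by field.
  rewrite Rpower_plus, Rpower_1, Rpower_sqrt by auto. reflexivity.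
Qed.

(** The bound [rho <= 4 / d] on the disc of radius [d / 2] gives [|phi| <= 16 M / d^2] there,
    hence, by Cauchy's estimate with radius [d / 8], [|phi'| <= 128 M / d^3] on the disc of
    radius [d / 4].  Together with [c / d <= rho z0] this keeps [phi] within
    [|phi z0| / 2] of [phi z0] on the disc of radius [c^2 m d / (256 M)], where [m] is the
    norm at [z0]; that radius is at most [d / 4] because [c <= 2] and [m <= M]. *)
Lemma phi_radius_lower Omega rho phi z0 c d M : open Omega -> hyperbolic_metric Omega rho ->
  Omega z0 -> holomorphic_on Omega phi -> phi z0 <> RtoC 0 -> 0 < c -> 0 < d ->
  (forall w, disc z0 d w -> Omega w) -> c / d <= rho z0 ->
  (forall z, Omega z -> qd_norm rho phi z <= M) ->
  Rbar_le (Finite (c ^ 3 / 512 * qd_norm rho phi z0 ^ 2 / Rpower M (3 / 2)))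
    (phi_radius Omega phi z0).
Proof.
  intros HO HM Hz Hphi N Hc Hd Hsub Hcd HMb.
  assert (Pphi := proj1 (Cmod_gt_0 _) N).
  assert (Hp := proj1 (holomorphic_cderiv _ _) Hphi).
  assert (Prho : forall z, Omega z -> 0 < rho z) by apply HM.
  assert (P0 := Prho z0 Hz).
  set (m := qd_norm rho phi z0).
  assert (Em : Cmod (phi z0) = m * (rho z0 * rho z0)) by (unfold m, qd_norm; field; lra).
  assert (Pm : 0 < m).
  { unfold m, qd_norm. apply Rdiv_lt_0_compat; auto. apply pow_lt; auto. }
  assert (HmM : m <= M) by (apply HMb; auto). clearbody m.
  assert (Cd : c <= rho z0 * d).
  { apply (Rmult_le_compat_r d) in Hcd; [|lra].
    replace (c / d * d) with c in Hcd by (field; lra). lra. }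
  assert (C2 : c <= 2) by (assert (K := metric_disc_bound Omega rho z0 d HO HM Hd Hsub); lra).
  assert (Bphi : forall z, disc z0 (d / 2) z -> Cmod (phi z) <= 16 * M / (d * d)).
  { intros z Hz'. unfold disc in Hz'.
    assert (Oz : Omega z) by (apply Hsub; unfold disc; lra).
    assert (K : rho z * (d / 2) <= 2).
    { apply (metric_disc_bound Omega); auto; [lra|]. intros w Hw. apply Hsub. unfold disc in *.
      assert (T := Cmod_sub_triangle w z z0). lra. }
    assert (Q := HMb z Oz). unfold qd_norm in Q. assert (Pz := Prho z Oz).
    assert (E : Cmod (phi z) = Cmod (phi z) / rho z ^ 2 * (rho z * rho z)) by (field; lra).
    assert (Q1 : Cmod (phi z) <= M * (rho z * rho z)) by (rewrite E; apply Rmult_le_compat_r; nra).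
    apply (Rmult_le_reg_r (d * d)); [nra|].
    replace (16 * M / (d * d) * (d * d)) with (M * (4 * 4)) by (field; lra).
    eapply Rle_trans; [apply Rmult_le_compat_r; [nra|exact Q1]|].
    replace (M * (rho z * rho z) * (d * d)) with (M * ((rho z * d) * (rho z * d))) by ring.
    apply Rmult_le_compat_l; [lra|]. assert (0 < rho z * d) by nra.
    apply Rmult_le_compat; lra. }
  set (k := 128 * M / (d * d * d)).
  assert (Dphi : forall z, disc z0 (d / 4) z -> cderiv phi z (C_derive phi z) /\
     Cmod (C_derive phi z - 0)%C <= k).
  { intros z Hz'. unfold disc in Hz'.
    assert (Sub : forall w, disc z (d / 4) w -> disc z0 (d / 2) w).
    { intros w Hw. unfold disc in *. assert (T := Cmod_sub_triangle w z z0). lra. }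
    assert (Dw : forall w, disc z (d / 4) w -> cderiv phi w (C_derive phi w)).
    { intros w Hw. apply cderiv_C_derive, Hp, Hsub. specialize (Sub w Hw). unfold disc in *. lra. }
    split; [apply Dw, disc_center; lra|].
    replace (C_derive phi z - 0)%C with (C_derive phi z) by ring.
    assert (K := cauchy_estimate phi (C_derive phi) z (d / 4) (16 * M / (d * d)) (d / 8) Dw
      (fun w Hw => Bphi w (Sub w Hw)) ltac:(lra)).
    apply (Rmult_le_reg_l (d / 8)); [lra|]. unfold k.
    replace (d / 8 * (128 * M / (d * d * d))) with (16 * M / (d * d)) by (field; lra). exact K. }
  assert (PM : 0 < M) by lra.
  set (del := c * c * m * d / (256 * M)).
  assert (Pdel : 0 < del).
  { unfold del. apply Rdiv_lt_0_compat; [|lra]. repeat apply Rmult_lt_0_compat; auto. }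
  assert (Edel : del * (256 * M) = c * c * m * d) by (unfold del; field; lra).
  assert (Ldel : del <= d / 4).
  { apply (Rmult_le_reg_r (256 * M)); [lra|]. rewrite Edel.
    assert (c * c <= 4) by nra.
    assert (c * c * (m * d) <= 4 * (M * d)) by (apply Rmult_le_compat; nra). nra. }
  assert (HI : inverse_extends_to_disc Omega phi z0 (sqrt (Cmod (phi z0)) * del / 2)).
  { apply inverse_extends_of_near_const; auto.
    - intros z Hz'. apply Hsub. unfold disc in *; lra.
    - intros z Hz'. apply Hp, Hsub. unfold disc in *; lra.
    - intros z Hz'. unfold disc in Hz'.
      assert (K := derivative_near_const_increment phi (C_derive phi) z0 (d / 4) (RtoC 0) k
        (fun w Hw => proj1 (Dphi w Hw)) (fun w Hw => proj2 (Dphi w Hw)) z0 z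
        (disc_center z0 (d / 4) ltac:(lra)) ltac:(unfold disc; lra)).
      replace (phi z - phi z0 - 0 * (z - z0))%C with (phi z - phi z0)%C in K by ring.
      eapply Rle_trans; [exact K|].
      assert (Pk : 0 < k) by (unfold k; apply Rdiv_lt_0_compat; [lra|repeat apply Rmult_lt_0_compat; auto]).
      apply (Rle_trans _ (k * del)); [apply Rmult_le_compat_l; lra|].
      replace (k * del) with (c * c * m / (d * d) / 2) by (unfold k, del; field; lra).
      rewrite Em. apply (Rmult_le_reg_r (2 * (d * d))); [nra|].
      replace (c * c * m / (d * d) / 2 * (2 * (d * d))) with (m * (c * c)) by (field; lra).
      replace (m * (rho z0 * rho z0) / 2 * (2 * (d * d))) with (m * ((rho z0 * d) * (rho z0 * d)))
        by field.
      apply Rmult_le_compat_l; [lra|]. apply Rmult_le_compat; lra. }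
  assert (Sphi : sqrt (Cmod (phi z0)) = sqrt m * rho z0).
  { rewrite Em, sqrt_mult, sqrt_square by nra. reflexivity. }
  assert (Psm : 0 < sqrt m) by (apply sqrt_lt_R0; auto).
  assert (PsM : 0 < sqrt M) by (apply sqrt_lt_R0; auto).
  assert (LsM : sqrt m <= sqrt M) by (apply sqrt_le_1_alt; auto).
  assert (Pr : 0 < sqrt (Cmod (phi z0)) * del / 2).
  { rewrite Sphi. assert (0 < sqrt m * rho z0) by nra. nra. }
  eapply Rbar_le_trans; [|apply phi_radius_ge; [auto|exact Pr|exact HI]].
  simpl. change (c * (c * (c * 1))) with (c ^ 3). change (m * (m * 1)) with (m ^ 2).
  rewrite Rpower_three_halves, Sphi by auto.
  apply (Rmult_le_reg_r (512 * (M * sqrt M))); [nra|].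
  replace (c ^ 3 / 512 * m ^ 2 / (M * sqrt M) * (512 * (M * sqrt M)))
    with (c * c * m * (sqrt m * sqrt m) * c).
  2:{ rewrite sqrt_sqrt by lra. field. lra. }
  replace (sqrt m * rho z0 * del / 2 * (512 * (M * sqrt M)))
    with (sqrt m * sqrt M * rho z0 * (del * (256 * M))) by field.
  rewrite Edel.
  replace (sqrt m * sqrt M * rho z0 * (c * c * m * d))
    with (c * c * m * (sqrt m * sqrt M) * (rho z0 * d)) by ring.
  assert (0 < c * c * m) by (repeat apply Rmult_lt_0_compat; auto).
  apply Rmult_le_compat; try lra; [repeat apply Rmult_le_pos; lra|].
  apply Rmult_le_compat_l; [lra|]. apply Rmult_le_compat_l; lra.
Qed.

(* Division by [p_infty] in [Rbar] gives 0, so the lower bound reads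
   [0 <= R_z] when the supremum norm is infinite. *)
Theorem proposition2p1 :
  exists K : R, 0 < K /\
  forall Omega : C -> Prop, hyperbolic_domain Omega ->
    (forall rho : C -> R, hyperbolic_metric Omega rho ->
     forall phi : C -> C, holomorphic_on Omega phi ->
     forall z : C, Omega z ->
       Rbar_le (phi_radius Omega phi z) (Finite (K * sqrt (qd_norm rho phi z))))
    /\
    (strongly_hyperbolic Omega ->
     exists K' : R, 0 < K' /\
     forall rho : C -> R, hyperbolic_metric Omega rho ->
     forall phi : C -> C, holomorphic_on Omega phi ->
     forall z : C, Omega z -> phi z <> RtoC 0 ->
       Rbar_le
         (Rbar_div (Finite (K' * (qd_norm rho phi z) ^ 2))
                   (Rbar_power (qd_sup_norm Omega rho phi) (3 / 2)))
         (phi_radius Omega phi z)).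
Proof.
  exists 2. split; [lra|]. intros Omega ((HO & _) & _). split.
  - intros rho HM phi Hphi z Hz. unfold phi_radius.
    destruct (Ceq_dec (phi z) (RtoC 0)) as [E|N].
    + simpl. assert (Q := sqrt_pos (qd_norm rho phi z)). lra.
    + apply (proj2 (Lub_Rbar_correct _)). intros r (Hr & HI).
      apply (inverse_extends_radius_le Omega); auto.
  - intros (_ & c & Hc & Hstrong). exists (c ^ 3 / 512).
    split; [assert (0 < c ^ 3) by (apply pow_lt; auto); lra|].
    intros rho HM phi Hphi z Hz N.
    destruct (dist_boundary_finite Omega rho z HO HM Hz) as (d & Hd & Ed & Hsub).
    specialize (Hstrong rho HM z Hz). rewrite Ed in Hstrong.
    assert (Hcd : c / d <= rho z) by exact Hstrong.
    assert (Ub : forall w, Omega w ->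
      Rbar_le (Finite (qd_norm rho phi w)) (qd_sup_norm Omega rho phi)).
    { intros w Hw. apply (proj1 (Lub_Rbar_correct _)). eauto. }
    destruct (qd_sup_norm Omega rho phi) as [M| |].
    + exact (phi_radius_lower Omega rho phi z c d M HO HM Hz Hphi N Hc Hd Hsub Hcd Ub).
    + simpl. rewrite Rmult_0_r. apply phi_radius_pos; auto.
    + exfalso. exact (Ub z Hz).
Qed.
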